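(* Let $X$ be a fractional Wiener--Weierstra\ss\ bridge with parameters $\alpha\in(0,1)$, $b\in\{2,3,\dots\}$ and $H\in(0,1)$, and put $K:=1\wedge(-\log_b\alpha)$. Suppose $H\neq K$ and set $p:=1/(H\wedge K)$. Then, $\mathbb P$-almost surely, $\langle X\rangle^{(q)}_1=\infty$ for every $q<p$ and $\langle X\rangle^{(q)}_1=0$ for every $q>p$. More precisely: (a) If $H>K$, there exists a random variable $V$ with $0<V<\infty$ a.s. such that $\mathbb P$-a.s., for all $t\in[0,1]$, $\langle X\rangle^{(1/K)}_t=V\cdot t$. (b) If $H<K$, then $\mathbb P$-a.s., for all $t\in[0,1]$, $$\langle X\rangle^{(1/H)}_t=\frac{2^{1/(2H)}\,\Gamma\big(\frac{H+1}{2H}\big)}{\sqrt\pi\,(1-\alpha^2b^{2H})^{1/(2H)}}\cdot t .$$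
   Context: Let $W=(W(t))_{t\ge0}$ be a fractional Brownian motion with Hurst parameter $H\in(0,1)$. Let $\kappa:[0,1]\to[0,1]$ be a deterministic function with $\kappa(0)=0$, $\kappa(1)=1$ that is H\''older continuous with some exponent $\tau\in(H,1]$. The fractional Brownian bridge is $B(t):=W(t)-\kappa(t)W(1)$, $t\in[0,1]$. For $x\ge0$, $\{x\}$ denotes the fractional part of $x$. For $\alpha\in(0,1)$, $b\in\{2,3,\dots\}$, the fractional Wiener--Weierstra\ss\ bridge is $X(t):=\sum_{n=0}^\infty\alpha^nB(\{b^nt\})$, $0\le t\le1$. For a function $f:[0,1]\to\mathbb R$ and $p>0$, the $p$-th variation along the $b$-adic partitions is $\langle f\rangle^{(p)}_t:=\lim_{n\to\infty}\sum_{k=0}^{\lfloor tb^n\rfloor-1}|f((k+1)b^{-n})-f(kb^{-n})|^p$, $t\in[0,1]$, provided the limit exists (possibly $+\infty$). *)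

(* Defs.v *)
From HB Require Import structures.
From mathcomp Require Import all_boot all_order all_algebra.
From mathcomp Require Import all_classical all_reals all_analysis.
Set Implicit Arguments. Unset Strict Implicit. Unset Printing Implicit Defensive.
Import Order.TTheory GRing.Theory Num.Theory.
Import numFieldNormedType.Exports.
Local Open Scope classical_set_scope.
Local Open Scope ring_scope.

Section defs.
Context {R : realType}.

Definition frac (x : R) : R := x - (Num.floor x)%:~R.

Definition fcov (H s t : R) : R :=
  (powR s (2 * H) + powR t (2 * H) - powR `|t - s| (2 * H)) / 2.

(* W is a fractional Brownian motion with Hurst index H on the probability
   space P: each W t is a random variable, paths are continuous on [0,oo), and
   W is a centered Gaussian process with covariance fcov H, expressed through
   the characteristic functions of all finite linear combinations
   (Cramer-Wold): E[exp(i S)] = exp(-Var S / 2). *)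
Definition is_fBm {d} {T : measurableType d} (P : probability T R) (H : R)
  (W : R -> T -> R) : Prop :=
  (forall t, measurable_fun setT (W t)) /\
  (forall w, {within `[0, +oo[%classic, continuous (fun t => W t w)}) /\
  (forall (n : nat) (c s : 'I_n -> R), (forall i, 0 <= s i) ->
     ('E_P[fun w => cos (\sum_i c i * W (s i) w)])%E
       = (expR (- (\sum_i \sum_j c i * c j * fcov H (s i) (s j)) / 2))%:E /\
     ('E_P[fun w => sin (\sum_i c i * W (s i) w)])%E = 0%E).

Definition holder01 (kappa : R -> R) (tau : R) : Prop :=
  exists C : R, forall s t, 0 <= s <= 1 -> 0 <= t <= 1 ->
    `|kappa s - kappa t| <= C * powR `|s - t| tau.

Definition fbridge {T : Type} (W : R -> T -> R) (kappa : R -> R) (t : R) (w : T) : R :=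
  W t w - kappa t * W 1 w.

Definition wwbridge {T : Type} (W : R -> T -> R) (kappa : R -> R) (alpha : R) (b : nat)
  (t : R) (w : T) : R :=
  limn (fun N => \sum_(0 <= n < N) alpha ^+ n * fbridge W kappa (frac (b%:R ^+ n * t)) w).

Definition pvar_sum (b : nat) (p : R) (f : R -> R) (t : R) (n : nat) : R :=
  \sum_(k < Num.truncn (t * b%:R ^+ n))
     powR `|f (k.+1%:R / b%:R ^+ n) - f (k%:R / b%:R ^+ n)| p.

Definition pvar_is (b : nat) (p : R) (f : R -> R) (t : R) (l : \bar R) : Prop :=
  (fun n => (pvar_sum b p f t n)%:E) @ \oo --> l.

Definition Gamma (x : R) : R :=
  Rintegral lebesgue_measure `]0, +oo[%classic (fun s => powR s (x - 1) * expR (- s)).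

End defs.

(* Main.v *)
Require Import Defs.
From HB Require Import structures.
From mathcomp Require Import all_boot all_order all_algebra.
From mathcomp Require Import all_classical all_reals all_analysis.
Import Order.TTheory GRing.Theory Num.Theory.
Import numFieldNormedType.Exports.
Local Open Scope classical_set_scope.
Local Open Scope ring_scope.
From mathcomp Require Import measurable_realfun.
From mathcomp Require Import ring lra.
Set Implicit Arguments.
Unset Strict Implicit.
Unset Printing Implicit Defensive.

(* Only the b-adic grid matters: the increment of X over [k/b^n, (k+1)/b^n] is
   the sum over i < n of alpha^i times the increment of the bridge over the b-adic
   interval of order n - i whose index is k modulo b^(n-i).

   If K < H, then alpha = b^(-K), and alpha^(-n) times these increments converges
   geometrically fast, uniformly in k, because the bridge is Hoelder of every order
   below H.  The averages of the K^(-1)-th powers therefore converge to a limit V,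
   along every initial segment of the grid.  V is positive as soon as the limit of
   the rescaled increments at the origin does not vanish; that limit is a limit of
   Gaussian variables with variances bounded away from 0, so it has no atom at 0.

   If H < K, then b^(Hn) times these increments is a Gaussian array with variances
   close to (1 - alpha^2 b^(2H))^(-1) and, for most pairs, small correlations.  The
   formula |x|^p = const * int_0^oo (1 - cos (u x))^r u^(-1-p) du reduces the law
   of large numbers for the p-th powers to characteristic functions of sums and
   differences of pairs, with a geometric rate in L^1, whence almost surely.  The
   deterministic correction kappa is of smaller order.

   In both cases the variations for the other exponents follow from the fact that
   the largest increment tends to 0. *)

(** * Differences of power functions *)

(** [is_fBm] describes [W] only through characteristic functions, and this shapes the proof: no
    joint density, chaos expansion or zero-one law enters. Powers of 1 - cos are trigonometric
    polynomials, so moments and laws of large numbers reduce to values E cos(a xi), as does the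
    absence of an atom. The power r is there because 1 - cos alone makes the moment kernel
    integrable at 0 only for p < 2, while p = 1/H may be large.

    Cells of different orders can overlap, so correlations are not uniformly small; only their
    average over all pairs is, and the law of large numbers is built on that average. It asks for
    y^4 to return y: one square root is lost in passing from L^2 to L^1, another in balancing two
    bounds on the error.

    For K < H the increments at the origin are strongly dependent, and their weighted sum might
    degenerate by cancellation. Its variance is bounded below by testing against a second difference
    of [W] with centre 1/b and small step h: one term contributes h^(2H), all others O(h^2), and H <
    1 decides. *)

Section PowerFunction.
Context {R : realType}.
Implicit Types a u x y s l h : R.

Lemma powR_continuous_gt0 a x : 0 < x -> {for x, continuous (fun y : R => y `^ a)}.
Proof.
move=> x0; apply: differentiable_continuous; apply/derivable1_diffP.
by apply: derivable_powR; rewrite in_itv/= x0.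
Qed.

Lemma mean_value_le (f df : R -> R) x s M : 0 <= s ->
  (forall y, x <= y <= x + s -> is_derive y 1 f (df y)) ->
  (forall y, x <= y <= x + s -> `|df y| <= M) ->
  `|f (x + s) - f x| <= M * s.
Proof.
move=> s0 df_ dfM.
have [] := @MVT_segment R f df x (x + s).
- by rewrite lerDl.
- by move=> y; rewrite in_itv/= => /andP[/ltW xy /ltW ys]; apply: df_; rewrite xy.
- apply: derivable_within_continuous => y; rewrite in_itv/= => xy.
  by case: (df_ y xy).
move=> c; rewrite in_itv/= => cxs ->.
by rewrite (addrC x) addrK normrM (ger0_norm s0) ler_wpM2r// dfM.
Qed.

(** As a <= 1, the derivative a z^(a-1) is largest in absolute value at the left end, so its bound
    at [u] serves the whole segment. *)
Lemma powR_diff_le a x y u : a <= 1 -> 0 < u -> u <= x -> u <= y ->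
  `|y `^ a - x `^ a| <= `|a| * u `^ (a - 1) * `|y - x|.
Proof.
move=> a1 u0.
wlog xy : x y / x <= y => [hw|ux uy].
  move=> ux uy; have [|/ltW] := leP x y; first by move=> xy; apply: hw.
  by move=> yx; rewrite distrC (distrC y); apply: hw.
have := @mean_value_le (fun z => z `^ a) (fun z => a * z `^ (a - 1)) x (y - x)
  (`|a| * u `^ (a - 1)).
rewrite [x + _]addrC subrK subr_ge0 (ger0_norm (_ : 0 <= y - x)) ?subr_ge0//; apply => //.
- move=> z /andP[xz _]; apply: is_derive1_powR.
  by apply: lt_le_trans xz; apply: lt_le_trans ux.
- move=> z /andP[xz _]; rewrite normrM ler_wpM2l// ger0_norm ?powR_ge0//.
  have z0 : 0 < z by apply: lt_le_trans xz; apply: lt_le_trans ux.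
  rewrite -(opprK (a - 1)) !(powRN _ (- (a - 1))) lef_pV2 ?posrE ?powR_gt0//.
  by apply: ge0_ler_powR; rewrite ?nnegrE ?opprB ?subr_ge0 ?(ltW u0) ?(ltW z0)// (le_trans ux).
Qed.

(** Mean value theorem in the shift [s] for z -> (z + l)^a - z^a; its derivative is again a first
    difference, with exponent a - 1, bounded by [powR_diff_le]. With a = 2H this controls
    covariances of separated increments. *)
Lemma powR_diff2_le a u s l : a <= 2 -> 0 < u -> 0 <= s -> 0 <= l ->
  `|(u + s + l) `^ a - (u + s) `^ a - (u + l) `^ a + u `^ a|
    <= `|a * (a - 1)| * s * l * u `^ (a - 2).
Proof.
move=> a2 u0 s0 l0.
have := @mean_value_le (fun z => (z + l) `^ a - z `^ a)
  (fun z => a * (z + l) `^ (a - 1) - a * z `^ (a - 1)) u s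
  (`|a * (a - 1)| * l * u `^ (a - 2)) s0.
rewrite opprB addrA -!addrA -(addrC (u `^ a)) !addrA [X in _ -> _ -> _ <= X]mulrAC.
rewrite [_ * s * l]mulrAC; apply.
- move=> z /andP[uz _]; have z0 : 0 < z by apply: lt_le_trans uz.
  apply: is_deriveB; last exact: is_derive1_powR.
  have zl0 : 0 < z + l by rewrite ltr_wpDr.
  rewrite -[X in is_derive _ _ _ X]mulr1.
  apply: (@is_derive1_comp _ (fun z => z `^ a) (fun z => z + l)).
    exact: is_derive1_powR.
  by rewrite -[X in is_derive _ _ _ X]addr0; apply: is_deriveD.
- move=> z /andP[uz _]; have z0 : 0 < z by apply: lt_le_trans uz.
  rewrite -mulrBr normrM; apply: (@le_trans _ _ (`|a| * (`|a - 1| * u `^ (a - 1 - 1) * `|z + l - z|))).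
    rewrite ler_wpM2l//; apply: powR_diff_le => //; first lra.
    by rewrite (le_trans uz)// lerDl.
  rewrite (addrC z) addrK (ger0_norm l0) normrM.
  by rewrite -addrA -opprD !mulrA [_ * l]mulrAC.
Qed.

(** One more derivative of the second difference. It compares second differences at two neighbouring
    points and gains the factor [s], which makes a series in [lcov_lorigin_ge] summable. *)
Lemma powR_diff3_le a u s h l : a <= 3 -> 0 < u -> 0 <= s -> 0 <= h -> 0 <= l ->
  `|((u + s + h + l) `^ a - (u + s + h) `^ a - (u + s + l) `^ a + (u + s) `^ a)
    - ((u + h + l) `^ a - (u + h) `^ a - (u + l) `^ a + u `^ a)|
    <= `|a * (a - 1) * (a - 2)| * h * l * s * u `^ (a - 3).
Proof.
move=> a3 u0 s0 h0 l0.
have := @mean_value_le (fun z => (z + h + l) `^ a - (z + h) `^ a - (z + l) `^ a + z `^ a)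
  (fun z => a * (z + h + l) `^ (a - 1) - a * (z + h) `^ (a - 1)
            - a * (z + l) `^ (a - 1) + a * z `^ (a - 1)) u s
  (`|a * (a - 1) * (a - 2)| * h * l * u `^ (a - 3)) s0.
rewrite [X in _ -> _ -> _ <= X]mulrAC; apply.
- move=> z /andP[uz _]; have z0 : 0 < z by apply: lt_le_trans uz.
  have D k : 0 <= k -> is_derive z 1 (fun z => (z + k) `^ a) (a * (z + k) `^ (a - 1)).
    move=> k0; have zk : 0 < z + k by rewrite ltr_wpDr.
    rewrite -[X in is_derive _ _ _ X]mulr1.
    apply: (@is_derive1_comp _ (fun z => z `^ a) (fun z => z + k)).
      exact: is_derive1_powR.
    by rewrite -[X in is_derive _ _ _ X]addr0; apply: is_deriveD.
  apply: is_deriveD; last exact: is_derive1_powR.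
  apply: is_deriveB; last exact: D.
  apply: is_deriveB; last exact: D.
  have -> : (fun x0 : R => (x0 + h + l) `^ a) = (fun x0 => (x0 + (h + l)) `^ a).
    by apply/funext => y; rewrite addrA.
  by rewrite -(addrA z); apply: D; rewrite addr_ge0.
- move=> z /andP[uz _]; have z0 : 0 < z by apply: lt_le_trans uz.
  rewrite -!mulrBr -mulrDr normrM.
  apply: (@le_trans _ _ (`|a| * (`|(a - 1) * (a - 1 - 1)| * h * l * z `^ (a - 1 - 2)))).
    by rewrite ler_wpM2l//; apply: powR_diff2_le => //; lra.
  have -> : a - 1 - 2 = a - 3 by lra.
  have -> : a - 1 - 1 = a - 2 by lra.
  rewrite !mulrA -normrM !mulrA ler_wpM2l//.
    by rewrite !mulr_ge0.
  rewrite -(opprK (a - 3)) !(powRN _ (- (a - 3))) lef_pV2 ?posrE ?powR_gt0//.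
  by apply: ge0_ler_powR; rewrite ?nnegrE ?opprB ?subr_ge0 ?(ltW u0) ?(ltW z0).
Qed.

Lemma powR_lipschitz p M x y : 1 <= p -> 0 <= x <= M -> 0 <= y <= M ->
  `|y `^ p - x `^ p| <= p * M `^ (p - 1) * `|y - x|.
Proof.
move=> p1.
have p0 : 0 < p by apply: lt_le_trans p1.
wlog xy : x y / x <= y => [hw|/andP[x0 xM] /andP[y0 yM]].
  move=> ux uy; have [|/ltW] := leP x y; first by move=> xy; apply: hw.
  by move=> yx; rewrite distrC (distrC y); apply: hw.
have Mp : 0 <= p * M `^ (p - 1) by rewrite mulr_ge0 ?powR_ge0// ltW.
(* The derivative formula needs a positive base, so x = 0 is compared directly. *)
have [->|x0'] := eqVneq x 0.
  rewrite powR0 ?gt_eqF// !subr0 (ger0_norm y0) ger0_norm ?powR_ge0//.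
  rewrite -[X in X <= _](@mulr_powRB1 _ y) // mulrC ler_wpM2r//.
  apply: (@le_trans _ _ (1 * M `^ (p - 1))); last by rewrite ler_wpM2r ?powR_ge0.
  by rewrite mul1r; apply: ge0_ler_powR; rewrite ?nnegrE ?subr_ge0// (le_trans y0).
have xpos : 0 < x by rewrite lt_neqAle eq_sym x0'.
have := @mean_value_le (fun z => z `^ p) (fun z => p * z `^ (p - 1)) x (y - x)
  (p * M `^ (p - 1)).
rewrite [x + _]addrC subrK subr_ge0 (ger0_norm (_ : 0 <= y - x)) ?subr_ge0//; apply => //.
- move=> z /andP[xz _]; apply: is_derive1_powR; exact: lt_le_trans xz.
- move=> z /andP[xz zy]; rewrite ger0_norm ?mulr_ge0 ?powR_ge0 ?(ltW p0)//.
  rewrite ler_wpM2l ?(ltW p0)//; apply: ge0_ler_powR; rewrite ?nnegrE ?subr_ge0//.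
  - by rewrite (le_trans x0).
  - by rewrite (le_trans x0).
  - by rewrite (le_trans zy).
Qed.

(** With e <= 1 one has y <= x + 1, and (x + 1)^p <= 2^p (1 + x^p). As only [x] occurs on the right,
    a bounded average of the x^p controls the average of the y^p. *)
Lemma powR_perturb p e x y : 1 <= p -> 0 <= e <= 1 -> 0 <= x -> 0 <= y -> `|y - x| <= e ->
  `|y `^ p - x `^ p| <= p * 2 `^ p * e * (1 + x `^ p).
Proof.
move=> p1 /andP[e0 e1] x0 y0 yxe.
have p0 : 0 < p by apply: lt_le_trans p1.
have yx : y <= x + 1.
  by move: yxe; rewrite ler_norml; lra.
have := @powR_lipschitz p (x + 1) x y p1.
rewrite x0 y0 yx lerDl ler01 => /(_ isT isT) /le_trans; apply.
rewrite [leRHS]mulrAC -!mulrA ler_wpM2l ?(ltW p0)// mulrA.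
apply: ler_pM => //; first by rewrite powR_ge0.
apply: (@le_trans _ _ ((x + 1) `^ p)).
  by apply: ler_powR; rewrite ?lerDr//; lra.
have [x1|x1] := leP x 1.
  apply: (@le_trans _ _ (2 `^ p)).
    by apply: ge0_ler_powR; rewrite ?nnegrE ?(ltW p0)//; lra.
  by rewrite ler_peMr ?powR_ge0// lerDl powR_ge0.
apply: (@le_trans _ _ ((2 * x) `^ p)).
  by apply: ge0_ler_powR; rewrite ?nnegrE ?(ltW p0)//; lra.
by rewrite powRM// ler_wpM2l ?powR_ge0// lerDr.
Qed.

Lemma powR_invX (B : R) x m : 0 < B -> (B ^+ m)^-1 `^ x = (B `^ (- x)) ^+ m.
Proof.
move=> B0; rewrite -powR_mulrn ?(ltW B0)// -powRN -powRrM -powR_mulrn ?powR_ge0//.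
by rewrite -powRrM; congr (_ `^ _); ring.
Qed.

Lemma powRN_lt1 (B : R) x : 1 < B -> 0 < x -> 0 < B `^ (- x) < 1.
Proof.
move=> B1 x0; have B0 : 0 < B by exact: lt_trans B1.
rewrite powR_gt0//= powRN invf_lt1 ?powR_gt0// /powR (gt_eqF B0) -[ltLHS]expR0 ltr_expR.
by rewrite mulr_gt0// ln_gt0.
Qed.

Lemma measurable_norm_powR d (T : measurableType d) (f : T -> R) p :
  measurable_fun setT f -> measurable_fun setT (fun t => `|f t| `^ p).
Proof.
move=> mf; apply: (@measurableT_comp _ _ _ _ _ _ (fun x => x `^ p)); first exact: measurable_powR.
exact: measurableT_comp.
Qed.

End PowerFunction.

(** * Sums along b-adic grids *)

Section Sums.
Context {R : realType}.

Lemma sum_blocks (F : nat -> R) q N :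
  \sum_(k < q * N) F k = \sum_(h < q) \sum_(a < N) F (h * N + a)%N.
Proof.
elim: q => [|q IH]; first by rewrite mul0n !big_ord0.
rewrite big_ord_recr/= -IH -!(big_mkord xpredT F) mulSnr.
rewrite (big_cat_nat (n := (q * N)%N))//= ?leq_addr//; congr (_ + _).
rewrite -{1}[(q * N)%N]add0n big_addn addKn big_mkord.
by apply: eq_bigr => i _; rewrite addnC.
Qed.

Lemma sum_periodic (G : nat -> R) q N r : (r <= N)%N -> (0 < N)%N ->
  \sum_(k < q * N + r) G (k %% N)%N
  = q%:R * (\sum_(j < N) G j) + \sum_(j < r) G (j %% N)%N.
Proof.
move=> rN N0; rewrite -(big_mkord xpredT (fun k => G (k %% N)%N)).
rewrite (big_cat_nat (n := (q * N)%N))//= ?leq_addr//; congr (_ + _).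
  rewrite big_mkord (sum_blocks (fun k => G (k %% N)%N)).
  rewrite (eq_bigr (fun=> \sum_(j < N) G j)) => [|h _].
    by rewrite sumr_const card_ord mulr_natl.
  by apply: eq_bigr => a _; rewrite modnMDl modn_small.
rewrite -{1}[(q * N)%N]add0n big_addn addKn big_mkord.
by apply: eq_bigr => i _; rewrite addnC modnMDl.
Qed.

Lemma sum_mod_expn (G : nat -> R) b m n : (0 < b)%N -> (m <= n)%N ->
  \sum_(k < b ^ n) G (k %% b ^ m)%N = (b ^ (n - m))%:R * (\sum_(j < b ^ m) G j).
Proof.
move=> b0 mn; have := @sum_periodic G (b ^ (n - m)) (b ^ m) 0.
rewrite addn0 -expnD subnK// => ->//; last by rewrite expn_gt0 b0.
by rewrite big_ord0 addr0.
Qed.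

Lemma sum_geo_le (x : R) n : 0 <= x < 1 -> \sum_(i < n) x ^+ i <= (1 - x)^-1.
Proof.
move=> /andP[x0 x1].
have d : 0 < 1 - x by rewrite subr_gt0.
rewrite -(ler_pM2l d) divff ?gt_eqF// -opprB mulNr -subrX1 opprB.
by rewrite lerBlDr lerDl exprn_ge0.
Qed.

Lemma sum_geo_conv (a th : R) : 0 <= a < 1 -> 0 <= th < 1 ->
  exists rho C : R, [/\ 0 < rho < 1, 0 <= C &
    forall n, \sum_(i < n) a ^+ i * th ^+ (n - i) <= C * rho ^+ n].
Proof.
move=> /andP[a0 a1] /andP[th0 th1].
(* Strictly above [a], so that powers of a/rho are summable even when a = th, where the sum consists
   of n equal terms. *)
pose rho := Num.max th ((1 + a) / 2).
have ra : a < rho by rewrite lt_max; apply/orP; right; lra.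
have rth : th <= rho by rewrite le_max lexx.
have r1 : rho < 1 by rewrite gt_max th1/=; lra.
have r0 : 0 < rho by apply: le_lt_trans ra.
have ar : 0 <= a / rho < 1.
  by rewrite divr_ge0 ?(ltW r0)//= ltr_pdivrMr// mul1r.
exists rho, (1 - a / rho)^-1; split.
- by rewrite r0.
- by rewrite invr_ge0 subr_ge0; case/andP: ar => _ /ltW.
move=> n; apply: (@le_trans _ _ ((\sum_(i < n) (a / rho) ^+ i) * rho ^+ n)); last first.
  by rewrite ler_wpM2r ?exprn_ge0 ?(ltW r0)// sum_geo_le.
rewrite big_distrl/=; apply: ler_sum => i _.
rewrite expr_div_n -mulrA ler_wpM2l ?exprn_ge0//.
apply: (@le_trans _ _ (rho ^+ (n - i))).
  by rewrite lerXn2r// nnegrE ltW.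
rewrite [X in _ <= _ * X](_ : rho ^+ n = rho ^+ i * rho ^+ (n - i)); last first.
  by rewrite -exprD subnKC// ltnW.
by rewrite mulrA mulVf ?mul1r// gt_eqF// exprn_gt0.
Qed.

Lemma count_interval (c L N : nat) :
  (\sum_(a < N) (c <= a < c + L)%N%:R : R) <= L%:R.
Proof.
elim: L => [|L IH].
  rewrite big1 // => a _; rewrite addn0.
  by case: (leqP c a) => //= ca; rewrite ltnNge ca.
rewrite (@le_trans _ _ (\sum_(a < N) ((c <= a < c + L)%N%:R + (a == c + L :> nat)%:R)))//.
  apply: ler_sum => a _; rewrite addnS ltnS [(a <= c + L)%N]leq_eqVlt.
  case: (eqVneq (a : nat) (c + L)%N) => [->|_] /=; last by rewrite addr0.
  by rewrite leq_addr ltnn/= add0r.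
rewrite big_split/= -[L.+1]addn1 natrD lerD//.
have [cN|cN] := ltnP (c + L) N.
  rewrite (bigD1 (Ordinal cN))//= eqxx big1 ?addr0// => i ic.
  by rewrite (_ : (_ == _) = false)//; apply/negbTE; apply: contraNneq ic => h; apply/eqP/val_inj.
rewrite big1 // => i _; rewrite (_ : (_ == _) = false)//.
by apply/negbTE; rewrite neq_ltn (leq_trans (ltn_ord i)).
Qed.

(** The admissible [a] lie in an interval of length 2A/u <= 4A, and rounding at its two ends costs
    at most 2. *)
Lemma count_affine (u z A : R) N : 1 / 2 <= u -> 0 <= A ->
  \sum_(a < N) (`|u * a%:R - z| < A)%R%:R <= 4 * A + 2.
Proof.
move=> u2 A0; have u0 : 0 < u by lra.
set x := (z - A) / u; set c := Num.truncn x; set L := ((Num.truncn (4 * A)).+2)%N.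
apply: (@le_trans _ _ (\sum_(a < N) (c <= a < c + L)%N%:R)); last first.
  apply: le_trans (count_interval c L N) _.
  rewrite /L -addn2 natrD lerD2r.
  by have /truncn_itv/andP[] : 0 <= 4 * A by rewrite mulr_ge0.
apply: ler_sum => a _; rewrite ler_nat; case: ltrP => //=.
rewrite ltr_norml => /andP[h1 h2].
have xa : x < a%:R by rewrite /x ltr_pdivrMr// mulrC; lra.
have ax : a%:R < x + 4 * A.
  have : a%:R < (z + A) / u by rewrite ltr_pdivlMr// mulrC; lra.
  move/lt_le_trans; apply.
  rewrite /x -lerBlDl -mulrBl ler_pdivrMr//; nra.
have -> : (c <= a)%N.
  rewrite /c; have [x0|x0] := leP 0 x.
    have /truncn_itv/andP[cx _] := x0; rewrite -(ler_nat R); lra.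
  by rewrite truncn_floor leNgt x0.
have xc := truncnS_gt x; have Ac := truncnS_gt (4 * A).
rewrite /= lt0b -(ltr_nat R) /L !addnS -!addSn natrD -/c.
move: xc Ac; rewrite -/c => xc Ac; lra.
Qed.

(* [K a] will be a correlation: it is small unless the linear position [u * a] is near [z]. *)
Lemma mean_near_far (K : nat -> R) (u z A e : R) N : (0 < N)%N ->
  1 / 2 <= u -> 0 <= A -> 0 <= e ->
  (forall a, `|K a| <= 1) ->
  (forall a, (a < N)%N -> A <= `|u * a%:R - z| -> `|K a| <= e) ->
  \sum_(a < N) `|K a| <= (4 * A + 2) + N%:R * e.
Proof.
move=> N0 u2 A0 e0 K1 Ke.
apply: (@le_trans _ _ (\sum_(a < N) ((`|u * a%:R - z| < A)%R%:R + e))).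
  apply: ler_sum => a _; case: ltrP => [_|h] /=.
    by rewrite (le_trans (K1 _))// lerDl.
  by rewrite add0r; apply: Ke.
rewrite big_split/= sumr_const card_ord -[e *+ N]mulr_natl lerD2r.
exact: count_affine.
Qed.

Lemma cvg_le_geometric (u : nat -> R) l C rho : 0 <= rho < 1 ->
  (forall n, `|u n - l| <= C * rho ^+ n) -> u @ \oo --> l.
Proof.
move=> /andP[r0 r1] h.
apply/cvgrPdist_lt => /= e e0.
have : (fun n => C * rho ^+ n) @ \oo --> C * 0.
  by apply: cvgMr; apply: cvg_expr; rewrite ger0_norm.
rewrite mulr0 => /cvgr_lt/(_ _ e0) he.
by near=> n; rewrite distrC; apply: le_lt_trans (h n) _; near: n.
Unshelve. all: by end_near. Qed.

End Sums.

(** * Increments of the series on the b-adic grid *)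

Definition incr {R : realType} (b : nat) (f : R -> R) (m j : nat) : R :=
  f (j.+1%:R / b%:R ^+ m) - f (j%:R / b%:R ^+ m).

(** The function [f] is left general so that the same sum, linear in [f], can be applied to a bridge
    path, to a path of [W] and to [kappa] separately. *)
Definition wsum {R : realType} (b : nat) (alpha : R) (f : R -> R) (n k : nat) : R :=
  \sum_(i < n) alpha ^+ i * incr b f (n - i) (k %% b ^ (n - i)).

Section Adic.
Context {R : realType}.
Implicit Types (f : R -> R) (b : nat).

Lemma frac_adic b m k : (0 < b)%N ->
  Defs.frac (k%:R / b%:R ^+ m : R) = (k %% b ^ m)%:R / b%:R ^+ m.
Proof.
move=> b0; have B0 : (0 : R) < b%:R ^+ m by rewrite exprn_gt0// ltr0n.
have kE : k%:R = (k %/ b ^ m)%:R * b%:R ^+ m + (k %% b ^ m)%:R :> R.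
  by rewrite -natrX -natrM -natrD -divn_eq.
have bm : (0 < b ^ m)%N by rewrite expn_gt0 b0.
rewrite /Defs.frac (_ : Num.floor _ = (k %/ b ^ m)%:Z); last first.
  apply: floor_def; rewrite intrD ler_pdivlMr// ltr_pdivrMr//=; apply/andP; split.
    by rewrite kE lerDl.
  by rewrite kE mulrDl mul1r ltrD2l -natrX ltr_nat ltn_mod.
by rewrite kE mulrDl mulfK ?gt_eqF// addrAC subrr add0r.
Qed.

Lemma lim_finite_sum (u : nat -> R) n : (forall m, (n <= m)%N -> u m = 0) ->
  limn (fun N => \sum_(0 <= m < N) u m) = \sum_(m < n) u m.
Proof.
move=> u0; apply/cvg_lim => //; apply/cvgrPdist_lt => e e0.
near=> N; rewrite (_ : \sum_(0 <= m < N) u m = \sum_(m < n) u m) ?subrr ?normr0//.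
have nN : (n <= N)%N by near: N; exact: nbhs_infty_ge.
rewrite (big_cat_nat (n := n))//= big_mkord -[RHS]addr0; congr (_ + _).
by rewrite big_nat big1// => i /andP[ni _]; rewrite u0.
Unshelve. all: by end_near. Qed.

(** At k/b^n every term of index m >= n evaluates the bridge at the fractional part of an integer,
    that is at 0, where it vanishes; so the series stops at n. *)
Lemma wwbridge_adic T (W : R -> T -> R) kappa alpha b n k w : (0 < b)%N ->
  fbridge W kappa 0 w = 0 ->
  wwbridge W kappa alpha b (k%:R / b%:R ^+ n) w
  = \sum_(i < n) alpha ^+ i *
      fbridge W kappa ((k %% b ^ (n - i))%:R / b%:R ^+ (n - i)) w.
Proof.
move=> b0 f0; have B0 : (b%:R : R) != 0 by rewrite pnatr_eq0 -lt0n.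
rewrite /wwbridge (lim_finite_sum (n := n)).
  apply: eq_bigr => i _; congr (_ * fbridge _ _ _ _).
  rewrite -frac_adic//; congr Defs.frac.
  have -> : b%:R ^+ n = b%:R ^+ i * b%:R ^+ (n - i) :> R.
    by rewrite -exprD subnKC// ltnW.
  by rewrite invfM mulrCA [X in _ * X]mulrA divff ?mul1r// expf_neq0.
move=> m nm; rewrite -(subnKC nm).
rewrite [X in Defs.frac X](_ : _ = (b ^ (m - n) * k)%N%:R); last first.
  by rewrite natrM natrX exprD; field; rewrite expf_neq0.
rewrite (_ : Defs.frac _ = 0) ?f0 ?mulr0//.
have := @frac_adic b 0 (b ^ (m - n) * k) b0.
by rewrite expr0 divr1 => ->; rewrite expn0 modn1 mul0r.
Qed.

(** At the right end of the last cell the fractional part jumps back to 0 instead of reaching 1. The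
    bridge vanishes at both points, so increments of the series are sums of true bridge
    increments. *)
Lemma fbridge_mod T (W : R -> T -> R) kappa b m k w : (0 < b)%N ->
  fbridge W kappa 0 w = 0 -> fbridge W kappa 1 w = 0 ->
  fbridge W kappa ((k.+1 %% b ^ m)%:R / b%:R ^+ m) w
  = fbridge W kappa ((k %% b ^ m).+1%:R / b%:R ^+ m) w.
Proof.
move=> b0 f0 f1; have bm : (0 < b ^ m)%N by rewrite expn_gt0 b0.
have : ((k %% b ^ m).+1 <= b ^ m)%N by rewrite ltn_mod.
rewrite leq_eqVlt => /orP[/eqP h|h].
  rewrite h -natrX divff ?f1; last by rewrite pnatr_eq0 -lt0n.
  by rewrite -addn1 -modnDml addn1 h modnn mul0r.
by rewrite -addn1 -modnDml addn1 modn_small.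
Qed.

Lemma wwbridge_incr T (W : R -> T -> R) kappa alpha b n k w : (0 < b)%N ->
  fbridge W kappa 0 w = 0 -> fbridge W kappa 1 w = 0 ->
  wwbridge W kappa alpha b (k.+1%:R / b%:R ^+ n) w
    - wwbridge W kappa alpha b (k%:R / b%:R ^+ n) w
  = wsum b alpha (fun t => fbridge W kappa t w) n k.
Proof.
move=> b0 f0 f1; rewrite !wwbridge_adic// -sumrB; apply: eq_bigr => i _.
by rewrite -mulrBr fbridge_mod.
Qed.

Lemma pvar_sum_wwbridge T (W : R -> T -> R) kappa alpha b p t n w : (0 < b)%N ->
  fbridge W kappa 0 w = 0 -> fbridge W kappa 1 w = 0 ->
  pvar_sum b p (wwbridge W kappa alpha b ^~ w) t n
  = \sum_(k < Num.truncn (t * b%:R ^+ n))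
      `|wsum b alpha (fun t => fbridge W kappa t w) n k| `^ p.
Proof. by move=> b0 f0 f1; apply: eq_bigr => k _; rewrite wwbridge_incr. Qed.

Lemma wsum_mod b alpha f n k : wsum b alpha f n (k %% b ^ n) = wsum b alpha f n k.
Proof.
by apply: eq_bigr => i _; rewrite modn_dvdm// dvdn_exp2l// leq_subr.
Qed.

Lemma wsum_le b alpha f th C n k : (0 < b)%N -> 0 <= alpha ->
  (forall m j, (j < b ^ m)%N -> `|incr b f m j| <= C * th ^+ m) ->
  `|wsum b alpha f n k| <= C * \sum_(i < n) alpha ^+ i * th ^+ (n - i).
Proof.
move=> b0 a0 h; apply: le_trans (ler_norm_sum _ _ _) _.
rewrite big_distrr/=; apply: ler_sum => i _.
rewrite normrM ger0_norm ?exprn_ge0// mulrCA ler_wpM2l ?exprn_ge0//.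
by apply: h; rewrite ltn_mod expn_gt0 b0.
Qed.

Lemma cvg_truncn_div (B t : R) : 1 < B -> 0 <= t ->
  (fun n => (Num.truncn (t * B ^+ n))%:R / B ^+ n) @ \oo --> t.
Proof.
move=> B1 t0; have B0 : 0 < B by lra.
apply: (@cvg_le_geometric _ _ _ 1 B^-1).
  by rewrite invr_ge0 (ltW B0)/= invf_lt1.
move=> n; have Bn : 0 < B ^+ n by rewrite exprn_gt0.
have /truncn_itv/andP[h1 h2] : 0 <= t * B ^+ n by rewrite mulr_ge0// ltW.
rewrite mul1r exprVn -(ler_pM2r Bn) mulVf ?gt_eqF//.
rewrite -[X in _ * X <= _](ger0_norm (ltW Bn)) -normrM mulrBl divfK ?gt_eqF//.
move: h2; rewrite -natr1 => h2; rewrite ler_norml; lra.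
Qed.

(** * Averages along the grid of a converging periodic array *)

Section AdicMean.
Variables (b : nat) (Z : nat -> nat -> R) (p C rho : R).
Hypotheses (b2 : (2 <= b)%N) (p1 : 1 <= p) (rho01 : 0 <= rho < 1).
Hypothesis Z_cauchy : forall M n k, (M <= n)%N -> `|Z n k - Z M k| <= C * rho ^+ M.
Hypothesis Z_0 : forall k, Z 0 k = 0.
Hypothesis Z_mod : forall M k, Z M (k %% b ^ M) = Z M k.

Let V M := (b%:R ^+ M)^-1 * \sum_(j < b ^ M) `|Z M j| `^ p.
Let S (t : R) n := (b%:R ^+ n)^-1 * \sum_(k < Num.truncn (t * b%:R ^+ n)) `|Z n k| `^ p.

Let p0 : 0 < p. Proof. by apply: lt_le_trans p1. Qed.
Let b0 : (0 < b)%N. Proof. by apply: leq_trans b2. Qed.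
Let B1 : (1 : R) < b%:R. Proof. by rewrite ltr1n. Qed.
Let B0 n : (0 : R) < b%:R ^+ n. Proof. by rewrite exprn_gt0// ltr0n. Qed.
Let C0 : 0 <= C.
Proof. by have := @Z_cauchy 0 0 0 isT; rewrite subrr normr0 expr0 mulr1. Qed.
Let L := p * C `^ (p - 1) * C.
Let L0 : 0 <= L. Proof. by rewrite !mulr_ge0 ?powR_ge0// ltW. Qed.

Let Z_le n k : `|Z n k| <= C.
Proof. by have := @Z_cauchy 0 n k isT; rewrite Z_0 subr0 expr0 mulr1. Qed.

Let Zp_diff M n k : (M <= n)%N -> `| `|Z n k| `^ p - `|Z M k| `^ p| <= L * rho ^+ M.
Proof.
move=> Mn; apply: le_trans (@powR_lipschitz _ p C `|Z M k| `|Z n k| p1 _ _) _.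
- by rewrite normr_ge0 Z_le.
- by rewrite normr_ge0 Z_le.
- rewrite -[L * _]mulrA ler_wpM2l ?mulr_ge0 ?powR_ge0 ?(ltW p0)//.
  by apply: le_trans (ler_dist_dist _ _) _; exact: Z_cauchy.
Qed.

Let G M j := `|Z M j| `^ p.
Let G_le M j : 0 <= G M j <= C `^ p.
Proof.
by rewrite powR_ge0/=; apply: ge0_ler_powR; rewrite ?nnegrE ?(ltW p0)// (le_trans _ (Z_le 0 0)).
Qed.

Let V_ge0 M : 0 <= V M.
Proof. by rewrite mulr_ge0 ?invr_ge0 ?(ltW (B0 _))// sumr_ge0// => i _; rewrite powR_ge0. Qed.

Let V_le M : V M <= C `^ p.
Proof.
rewrite /V mulrC ler_pdivrMr//.
apply: le_trans (_ : _ <= \sum_(j < b ^ M) C `^ p) _.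
  by apply: ler_sum => j _; case/andP: (G_le M j).
by rewrite sumr_const card_ord -[_ *+ _]mulr_natr natrX.
Qed.

Let mean_freeze (t : R) M n : 0 <= t <= 1 -> (M <= n)%N ->
  `|S t n - t * V M| <= L * rho ^+ M + 3 * b%:R ^+ M * C `^ p * (b%:R ^+ n)^-1.
Proof.
move=> /andP[t0 t1] Mn; set k := Num.truncn (t * b%:R ^+ n).
have /truncn_itv/andP[k1 k2] : 0 <= t * b%:R ^+ n by rewrite mulr_ge0// ltW.
have kn : k%:R <= b%:R ^+ n :> R.
  by apply: le_trans k1 _; rewrite ler_piMl// ltW.
set S' := (b%:R ^+ n)^-1 * \sum_(i < k) G M i.
apply: (@le_trans _ _ (`|S t n - S'| + `|S' - t * V M|)).
  by rewrite -[X in `|X|](subrKA S') ler_normD.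
apply: lerD.
  rewrite -mulrBr -sumrB normrM ger0_norm ?invr_ge0 ?(ltW (B0 _))//.
  rewrite mulrC ler_pdivrMr//; apply: le_trans (ler_norm_sum _ _ _) _.
  apply: (@le_trans _ _ (\sum_(i < k) L * rho ^+ M)).
    by apply: ler_sum => i _; exact: Zp_diff.
  rewrite sumr_const card_ord -[_ *+ _]mulr_natr ler_wpM2l// mulr_ge0// exprn_ge0//.
  by case/andP: rho01.
pose N := (b ^ M)%N; have N0 : (0 < N)%N by rewrite expn_gt0 b0.
have NE : N%:R = b%:R ^+ M :> R by rewrite natrX.
have GE i : G M i = G M (i %% N)%N by rewrite /G Z_mod.
have : \sum_(i < k) G M i = (k %/ N)%:R * (b%:R ^+ M * V M) + \sum_(i < k %% N) G M i.
  rewrite (eq_bigr (fun i : 'I_k => G M (i %% N)%N)) => [|i _]; last exact: GE.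
  rewrite -(big_mkord xpredT (fun i => G M (i %% N)%N)) {1}(divn_eq k N) big_mkord.
  rewrite sum_periodic//; last by rewrite ltnW// ltn_mod.
  rewrite /V [b%:R ^+ M * _]mulrA divff ?mul1r ?gt_eqF//; congr (_ + _).
  by apply: eq_bigr => i _; rewrite -GE.
rewrite /S' => ->.
set r := \sum_(i < _) _; set q := (k %/ N)%N.
have r0 : 0 <= r by apply: sumr_ge0 => i _; rewrite powR_ge0.
have rN : r <= b%:R ^+ M * C `^ p.
  apply: le_trans (_ : \sum_(i < k %% N) C `^ p <= _).
    by apply: ler_sum => i _; case/andP: (G_le M i).
  rewrite sumr_const card_ord -[_ *+ (k %% N)]mulr_natl -NE ler_wpM2r ?powR_ge0// ler_nat.
  by rewrite ltnW// ltn_mod.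
have kE : k%:R = q%:R * b%:R ^+ M + (k %% N)%:R :> R.
  by rewrite -NE -natrM -natrD -divn_eq.
have kN : (k %% N)%:R <= b%:R ^+ M :> R by rewrite -NE ler_nat ltnW// ltn_mod.
have kN0 : 0 <= (k %% N)%:R :> R by [].
have BM1 : 1 <= b%:R ^+ M :> R by rewrite exprn_ege1// ler1n.
rewrite (_ : _ - _ = ((q%:R * b%:R ^+ M - t * b%:R ^+ n) * V M + r) / b%:R ^+ n); last first.
  by field; rewrite !gt_eqF//= ltr0n.
rewrite normrM [X in _ * X]ger0_norm ?invr_ge0 ?(ltW (B0 _))//.
rewrite ler_wpM2r ?invr_ge0 ?(ltW (B0 _))//.
apply: le_trans (ler_normD _ _) _; rewrite (ger0_norm r0) normrM (ger0_norm (V_ge0 _)).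
have : `|q%:R * b%:R ^+ M - t * b%:R ^+ n| <= 2 * b%:R ^+ M.
  move: k2; rewrite -natr1 -/k => k2; rewrite ler_norml; lra.
move=> /(ler_pM (normr_ge0 _) (V_ge0 M))/(_ (V_le M)); lra.
Qed.

(** [V] is Cauchy by periodicity and [Zp_diff]; in [mean_freeze] M is fixed first and n then grows,
    which treats all initial segments. Positivity comes from the index 0 alone, because its
    multiples of b^M recur with positive frequency. *)
Lemma adic_mean : exists v : R, [/\ V @ \oo --> v,
  forall t : R, 0 <= t <= 1 -> S t @ \oo --> v * t &
  forall z : R, (fun n => Z n 0) @ \oo --> z -> z != 0 -> 0 < v].
Proof.
have [r0 r1] := andP rho01.
have Lrho : (fun M => L * rho ^+ M) @ \oo --> (0 : R).
  by rewrite -[X in _ --> X](mulr0 L); apply: cvgMl_tmp; apply: cvg_expr; rewrite ger0_norm.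
have S1 n : S 1 n = V n.
  rewrite /S mul1r -natrX (_ : Num.truncn _ = b ^ n)%N ?natrX//.
  by rewrite -natrX; apply: truncn_def; rewrite lexx ltr_nat ltnSn.
have VV M n : (M <= n)%N -> `|V n - V M| <= L * rho ^+ M.
  move=> Mn; rewrite /V -[(b%:R ^+ M)^-1 * _](_ : (b%:R ^+ n)^-1 * \sum_(k < b ^ n) G M k = _).
    rewrite -mulrBr -sumrB normrM ger0_norm ?invr_ge0 ?(ltW (B0 _))//.
    rewrite mulrC ler_pdivrMr//; apply: le_trans (ler_norm_sum _ _ _) _.
    apply: (@le_trans _ _ (\sum_(i < b ^ n) L * rho ^+ M)).
      by apply: ler_sum => i _; exact: Zp_diff.
    by rewrite sumr_const card_ord -[_ *+ _]mulr_natr natrX.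
  rewrite (eq_bigr (fun i : 'I_(b ^ n) => G M (i %% b ^ M)%N)) => [|i _]; last by rewrite /G Z_mod.
  rewrite sum_mod_expn// natrX -{1}(subnKC Mn) exprD mulrA; congr (_ * _).
  by rewrite invfM -mulrA mulVf ?mulr1// gt_eqF.
have cV : cvg (V @ \oo).
  apply/cauchy_cvgP/cauchy_exP => e e0.
  have [N _ hN] := cvgr_lt _ Lrho e e0.
  exists (V N); exists N => // n /= Nn.
  by rewrite -ball_normE/= distrC; apply: le_lt_trans (VV _ _ Nn) _; apply: hN => /=.
exists (limn V); split => //.
- move=> t t01; have [t0 t1] := andP t01.
  have Vl M : `|V M - limn V| <= L * rho ^+ M.
    have : (fun n => `|V M - V n|) @ \oo --> `|V M - limn V|.
      by apply: cvg_norm; apply: cvgB => //; exact: cvg_cst.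
    move/cvg_lim => <-//; apply: limr_le.
      by apply: is_cvg_norm; apply: is_cvgB => //; exact: is_cvg_cst.
    by exists M => // n /= Mn; rewrite distrC; exact: VV.
  apply/cvgrPdist_lt => e e0.
  have [M _ /(_ M (leqnn _))/= hM] := cvgr_lt _ Lrho (e / 3) ltac:(lra).
  have hb : (fun n => 3 * b%:R ^+ M * C `^ p * (b%:R ^+ n)^-1) @ \oo --> (0 : R).
    rewrite -[X in _ --> X](mulr0 (3 * b%:R ^+ M * C `^ p)); apply: cvgMl_tmp.
    under eq_fun do rewrite -exprVn.
    apply: cvg_expr; rewrite ger0_norm ?invr_ge0// invf_lt1// ltr0n//.
  near=> n.
  have Mn : (M <= n)%N by near: n; exact: nbhs_infty_ge.
  have h1 := mean_freeze t01 Mn.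
  have h2 : 3 * b%:R ^+ M * C `^ p * (b%:R ^+ n)^-1 < e / 3.
    by near: n; apply: (cvgr_lt _ hb); lra.
  have h3 : `|t * V M - limn V * t| < e / 3.
    rewrite (mulrC _ t) -mulrBr normrM (ger0_norm t0).
    apply: (le_lt_trans _ hM); apply: le_trans (Vl M).
    by rewrite ler_piMl.
  rewrite distrC (_ : _ - _ = (S t n - t * V M) + (t * V M - limn V * t)); last by rewrite subrKA.
  apply: le_lt_trans (ler_normD _ _) _; lra.
- move=> z Zz z0; have zp : 0 < `|z| by rewrite normr_gt0.
  have C1rho : (fun M => C * rho ^+ M) @ \oo --> (0 : R).
    by rewrite -[X in _ --> X](mulr0 C); apply: cvgMl_tmp; apply: cvg_expr; rewrite ger0_norm.
  (* From order M on, every index divisible by b^M keeps |Z n k| >= |z|/4, and such indices form a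
     fraction b^(-M) of all. *)
  have [M [M1 M2]] : exists M, C * rho ^+ M < `|z| / 4 /\ `|Z M 0| > `|z| / 2.
    near \oo => M; exists M; split.
      by near: M; apply: (cvgr_lt _ C1rho); rewrite divr_gt0.
    near: M; apply: (cvgr_gt _ (cvg_norm Zz)); lra.
  have : (b%:R ^+ M)^-1 * (`|z| / 4) `^ p <= limn V.
    apply: limr_ge => //; exists M => // n /= Mn.
    rewrite /V.
    have -> : (b%:R ^+ M)^-1 = (b%:R ^+ n)^-1 * b%:R ^+ (n - M) :> R.
      have -> : b%:R ^+ n = b%:R ^+ M * b%:R ^+ (n - M) :> R by rewrite -exprD subnKC.
      by rewrite invfM -mulrA mulVf ?mulr1// gt_eqF.
    rewrite -mulrA ler_wpM2l ?invr_ge0 ?(ltW (B0 _))//.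
    rewrite -(big_mkord xpredT (fun j => `|Z n j| `^ p)).
    rewrite (_ : (b ^ n = b ^ (n - M) * b ^ M)%N); last by rewrite -expnD subnK.
    rewrite big_mkord (sum_blocks (fun j => `|Z n j| `^ p)).
    rewrite [leLHS](_ : _ = \sum_(h < b ^ (n - M)) (`|z| / 4) `^ p); last first.
      by rewrite sumr_const card_ord -[RHS]mulr_natl natrX.
    apply: ler_sum => h _.
    have bM : (0 < b ^ M)%N by rewrite expn_gt0 b0.
    rewrite (bigD1 (Ordinal bM))//= addn0 -[leLHS]addr0; apply: lerD; last first.
      by apply: sumr_ge0 => i _; rewrite powR_ge0.
    apply: ge0_ler_powR; rewrite ?nnegrE ?(ltW p0) ?divr_ge0//.
    have := @Z_cauchy M n (h * b ^ M) Mn.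
    rewrite -[Z M _]Z_mod modnMl => h1.
    have := lerB_dist (Z M 0) (Z n (h * b ^ M)%N); rewrite distrC; lra.
  apply: lt_le_trans; rewrite mulr_gt0 ?invr_gt0// powR_gt0//; lra.
Unshelve. all: by end_near. Qed.

End AdicMean.

(** The two sums differ termwise by the factor |D| to the power |p - q|, which is uniformly small
    because the largest increment is. *)
Lemma psum_other_exponent (D : nat -> nat -> R) (N : nat -> nat) (e : nat -> R) (p l : R) :
  0 < p -> 0 < l -> (forall n k, `|D n k| <= e n) -> e @ \oo --> 0 ->
  (fun n => \sum_(k < N n) `|D n k| `^ p) @ \oo --> l ->
  forall q : R,
  (0 < q < p -> (fun n => (\sum_(k < N n) `|D n k| `^ q)%:E) @ \oo --> +oo%E) /\
  (p < q -> (fun n => (\sum_(k < N n) `|D n k| `^ q)%:E) @ \oo --> 0%E).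
Proof.
move=> p0 l0 De e0 Dl q; split.
- move=> /andP[q0 qp]; apply/cvgeryP/cvgryPge => A.
  pose c := (2 * `|A| + 1) / l.
  have c0 : 0 < c by rewrite divr_gt0// ltr_wpDl// mulr_ge0.
  (* [c] makes c l/2 exceed [A], and [de] is the size at which x^(p-q) equals 1/c. *)
  pose de := (c^-1) `^ ((p - q)^-1).
  have de0 : 0 < de by rewrite powR_gt0// invr_gt0.
  near=> n.
  have h1 : l / 2 < \sum_(k < N n) `|D n k| `^ p.
    by near: n; apply: (cvgr_gt _ Dl); lra.
  have h2 : e n < de by near: n; exact: (cvgr_lt _ e0).
  apply: (@le_trans _ _ (c * \sum_(k < N n) `|D n k| `^ p)).
    apply: (@le_trans _ _ (c * (l / 2))); last by rewrite ler_wpM2l ?ltW.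
    have -> : c * (l / 2) = (2 * `|A| + 1) / 2 by rewrite /c; field; rewrite gt_eqF.
    have := ler_norm A; lra.
  rewrite big_distrr/=; apply: ler_sum => k _.
  have Dde : `|D n k| `^ (p - q) <= c^-1.
    apply: (@le_trans _ _ (de `^ (p - q))).
      apply: ge0_ler_powR; rewrite ?nnegrE ?subr_ge0 ?(ltW qp) ?(ltW de0)//.
      by apply: le_trans (De n k) _; rewrite ltW.
    by rewrite /de -powRrM mulVf ?powRr1 ?invr_ge0 ?(ltW c0)// gt_eqF// subr_gt0.
  have [->|Dn0] := eqVneq (D n k) 0.
    by rewrite normr0 !powR0 ?mulr0// gt_eqF.
  rewrite -{1}(subrK q p) powRD ?normr_eq0 ?Dn0 ?implybT// mulrA.
  rewrite -[leRHS]mul1r ler_wpM2r ?powR_ge0//.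
  by rewrite -(mulfV (lt0r_neq0 c0)) ler_wpM2l// ltW.
- move=> pq; apply: cvg_EFin; first exact: nearW.
  apply/cvgrPdist_le => eps eps0.
  pose c := eps / (l + 1).
  have c0 : 0 < c by rewrite divr_gt0//; lra.
  pose de := c `^ ((q - p)^-1).
  have de0 : 0 < de by rewrite powR_gt0.
  near=> n.
  have h1 : \sum_(k < N n) `|D n k| `^ p < l + 1.
    by near: n; apply: (cvgr_lt _ Dl); lra.
  have h2 : e n < de by near: n; exact: (cvgr_lt _ e0).
  have S0 : 0 <= \sum_(k < N n) `|D n k| `^ q by apply: sumr_ge0 => k _; rewrite powR_ge0.
  rewrite sub0r normrN /= ger0_norm//.
  apply: (@le_trans _ _ (c * \sum_(k < N n) `|D n k| `^ p)); last first.
    apply: (@le_trans _ _ (c * (l + 1))); first by rewrite ler_wpM2l ?ltW.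
    rewrite /c divfK// gt_eqF//; lra.
  rewrite big_distrr/=; apply: ler_sum => k _.
  have Dde : `|D n k| `^ (q - p) <= c.
    apply: (@le_trans _ _ (de `^ (q - p))).
      apply: ge0_ler_powR; rewrite ?nnegrE ?subr_ge0 ?(ltW pq) ?(ltW de0)//.
      by apply: le_trans (De n k) _; rewrite ltW.
    by rewrite /de -powRrM mulVf ?powRr1 ?(ltW c0)// gt_eqF// subr_gt0.
  have [->|Dn0] := eqVneq (D n k) 0.
    by rewrite normr0 !powR0 ?mulr0// gt_eqF// (lt_trans p0).
  rewrite -{1}(subrK p q) powRD ?normr_eq0 ?Dn0 ?implybT//.
  by rewrite ler_wpM2r ?powR_ge0.
Unshelve. all: by end_near. Qed.
End Adic.

(** * Absolute moments through characteristic functions *)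

Section Kernel.
Context {R : realType}.
Implicit Types (p u x y : R) (r : nat).
Notation mu := (@lebesgue_measure R).

Lemma norm_sin_le x : `|sin x| <= `|x|.
Proof.
wlog x0 : x / 0 <= x => [hw|].
  have [|/ltW x0] := leP 0 x; first exact: hw.
  by have := hw (- x); rewrite oppr_ge0 sinN !normrN => /(_ x0).
have := @mean_value_le _ sin cos 0 x 1 x0.
rewrite add0r sin0 subr0 mul1r => h; rewrite (ger0_norm x0) h// => y _.
exact: cos_max.
Qed.

Lemma oneBcos_le x : 0 <= 1 - cos x <= x ^+ 2.
Proof.
rewrite subr_ge0 cos_le1/=.
wlog x0 : x / 0 <= x => [hw|].
  have [|/ltW x0] := leP 0 x; first exact: hw.
  by have := hw (- x); rewrite oppr_ge0 cosN sqrrN => /(_ x0).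
have := @mean_value_le _ cos (fun y => - sin y) 0 x x x0.
rewrite add0r cos0 distrC -expr2 => h; apply: le_trans (ler_norm _) _; apply: h => y.
move=> /andP[y0 yx]; rewrite normrN (le_trans (norm_sin_le _))//.
by rewrite ger0_norm.
Qed.

Lemma oneBcosX_le2 r x : 0 <= (1 - cos x) ^+ r <= 2 ^+ r.
Proof.
have /andP[h0 _] := oneBcos_le x.
rewrite exprn_ge0//= lerXn2r ?nnegrE//.
have := cos_max x; rewrite ler_norml; lra.
Qed.

Lemma oneBcosX_leX r x : (1 - cos x) ^+ r <= x ^+ 2 ^+ r.
Proof.
have /andP[h0 h1] := oneBcos_le x.
by rewrite lerXn2r ?nnegrE ?sqr_ge0.
Qed.

Lemma cvg_powRN_pinfty (s : R) : 0 < s -> u `^ (- s) @[u --> +oo] --> 0.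
Proof.
move=> s0; apply/cvgrPdist_le => e e0.
near=> u; have u0 : 0 < u by near: u; exact: nbhs_pinfty_gt.
rewrite sub0r normrN ger0_norm ?powR_ge0// powRN.
rewrite -[leRHS]invrK lef_pV2 ?posrE ?powR_gt0 ?invr_gt0//.
rewrite -[leLHS](@powRr1 _ e^-1) ?invr_ge0 ?(ltW e0)// -(mulVf (lt0r_neq0 s0)) powRrM.
apply: ge0_ler_powR; rewrite ?nnegrE ?powR_ge0 ?(ltW s0) ?(ltW u0)//.
Unshelve. all: by end_near. Qed.

Lemma continuous_powR_within (a : R) (D : set R) : (forall x, D x -> 0 < x) ->
  {within D, continuous (fun u : R => u `^ a)}.
Proof.
move=> D0; apply: continuous_in_subspaceT => x /set_mem/D0 x0.
exact: powR_continuous_gt0.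
Qed.

Lemma integral_powRN_lty p : 1 < p ->
  (\int[mu]_(u in `[1%R, +oo[) (u `^ (- p))%:E < +oo)%E.
Proof.
move=> p1; have p0 : 0 < p - 1 by lra.
pose F := fun u : R => - (u `^ (1 - p) / (p - 1)).
have dF x : 0 < x -> is_derive x 1 F (x `^ (- p)).
  move=> x0; have h := @is_derive1_powR R (1 - p) x x0.
  have -> : x `^ (- p) = - ((1 - p) * x `^ (1 - p - 1) * (p - 1)^-1).
    rewrite (_ : 1 - p - 1 = - p); last by lra.
    by field; rewrite gt_eqF.
  rewrite /F; apply: is_deriveN.
  under eq_fun do rewrite mulrC.
  rewrite mulrC; exact: is_deriveZ.
rewrite (@ge0_continuous_FTC2y R _ F 1 0) ?ltry//.
- by move=> x x1; rewrite powR_ge0.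
- apply: continuous_powR_within => x; rewrite /= in_itv/= andbT; apply: lt_le_trans; exact: ltr01.
- rewrite -oppr0; apply: cvgN; rewrite -[X in _ --> X](mul0r (p - 1)^-1).
  apply: cvgM; last exact: cvg_cst.
  have -> : 1 - p = - (p - 1) by rewrite opprB.
  exact: cvg_powRN_pinfty.
- by move=> x x1; have [] := dF x (lt_trans ltr01 x1).
- apply: cvg_at_right_filter; have [+ _] := dF 1 ltr01.
  by move=> /derivable1_diffP/differentiable_continuous.
- by move=> x; rewrite in_itv/= andbT => x1; rewrite derive1E; have [_ ->] := dF x (lt_trans ltr01 x1).
Qed.

(** Integrand of the moment formula at x = 1. Near 0 it is of order u^(2r-1-p), so a large [r] makes
    it integrable for large [p] as well. *)
Definition hkernel r p u : R := (1 - cos u) ^+ r * u `^ (- (1 + p)).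

Lemma hkernel_ge0 r p u : 0 <= hkernel r p u.
Proof. by rewrite mulr_ge0 ?powR_ge0//; case/andP: (oneBcosX_le2 r u). Qed.

Lemma measurable_oneBcosX r : measurable_fun setT (fun u : R => (1 - cos u) ^+ r).
Proof.
apply: measurable_funX; apply: measurable_funB => //.
by apply: continuous_measurable_fun => x; exact: continuous_cos.
Qed.

Lemma measurable_hkernel r p : measurable_fun setT (hkernel r p).
Proof. by apply: measurable_funM; [exact: measurable_oneBcosX|exact: measurable_powR]. Qed.

Lemma hkernel_le_id r p u : p + 1 <= r%:R -> 0 < p -> 0 < u <= 1 -> hkernel r p u <= u.
Proof.
move=> pr p0 /andP[u0 u1].
apply: (@le_trans _ _ (u ^+ 2 ^+ r * u `^ (- (1 + p)))).
  by rewrite ler_wpM2r ?powR_ge0// oneBcosX_leX.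
rewrite -exprM -powR_mulrn ?(ltW u0)// -powRD; last by rewrite (gt_eqF u0) implybT.
rewrite -{2}(@powRr1 _ u (ltW u0)); apply: ger_powR; first by rewrite u0.
rewrite natrM; lra.
Qed.

Lemma hkernel_le_tail r p u : 1 <= u -> hkernel r p u <= 2 ^+ r * u `^ (- p).
Proof.
move=> u1; rewrite /hkernel; apply: ler_pM.
- by case/andP: (oneBcosX_le2 r u).
- by rewrite powR_ge0.
- by case/andP: (oneBcosX_le2 r u).
- apply: ler_powR => //; lra.
Qed.

Lemma hkernel_continuous r p : p + 1 <= r%:R -> 0 < p ->
  {within `[0, +oo[, continuous (hkernel r p)}.
Proof.
move=> pr p0; apply/continuous_within_itvcyP; split.
  move=> x; rewrite in_itv/= andbT => x0.
  apply: (@continuousM _ _ (fun u => (1 - cos u) ^+ r)); last exact: powR_continuous_gt0.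
  apply: (@continuous_comp _ _ _ (fun u => 1 - cos u) (fun y => y ^+ r)); last exact: exprn_continuous.
  by apply: cvgB; [exact: cvg_cst|exact: continuous_cos].
(* A nonzero power of 0 is 0 by convention, so the kernel takes the value 0 at 0; by [hkernel_le_id]
   this is also its limit there. *)
rewrite {2}/hkernel powR0 ?mulr0; last by rewrite lt_eqF// oppr_lt0; lra.
apply: (@squeeze_cvgr _ _ _ _ (fun=> 0) (fun u => u)); last 2 first.
- exact: cvg_cst.
- exact/cvg_at_right_filter/cvg_id.
near=> u; rewrite hkernel_ge0/= hkernel_le_id//.
by apply/andP; split; near: u; [exact: nbhs_right_gt|exact: nbhs_right_le].
Unshelve. all: by end_near. Qed.

Definition hmass r p : \bar R := (\int[mu]_(u in `]0%R, +oo[) (hkernel r p u)%:E)%E.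

(** Comparison with 1 on (0,1] and with 2^r u^(-p) beyond, which is integrable as p > 1. *)
Lemma hmass_lty r p : p + 1 <= r%:R -> 1 < p -> (hmass r p < +oo)%E.
Proof.
move=> pr p1.
have mD := measurable_hkernel r p.
apply: (@le_lt_trans _ _ (\int[mu]_(u in `]0%R, 1%R]) 1%:E +
   (\int[mu]_(u in `[1%R, +oo[) (2 ^+ r * u `^ (- p))%:E))%E); last first.
  rewrite lte_add_pinfty//.
    by rewrite integral_cst//= mul1e lebesgue_measure_itv/= lte01 oppr0 adde0 ltry.
  under eq_integral do rewrite EFinM.
  rewrite ge0_integralZl//; last 2 first.
  - by apply/measurable_EFinP/measurable_funTS; exact: measurable_powR.
  - by move=> x _; rewrite lee_fin powR_ge0.
  by rewrite lte_mul_pinfty ?lee_fin ?exprn_ge0// integral_powRN_lty.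
rewrite /hmass (_ : `]0, +oo[%classic = `]0, 1] `|` `]1, +oo[); last first.
  by apply/seteqP; split => x/=; rewrite !in_itv/= ?andbT;
    [case: (leP x 1) => h; [left|right]; rewrite ?h ?andbT|move=> [/andP[]//|/(lt_trans ltr01)]].
rewrite ge0_integral_setU//=; last 3 first.
- by apply/measurable_EFinP/measurable_funTS.
- by move=> x _; rewrite lee_fin hkernel_ge0.
- by apply/disj_setPS => x/= []; rewrite !in_itv/= andbT => /andP[_ /le_lt_trans h /h]; rewrite ltxx.
apply: leeD.
  apply: ge0_le_integral => //.
  - by move=> x _; rewrite lee_fin hkernel_ge0.
  - by apply/measurable_EFinP/measurable_funTS.
  - move=> x/=; rewrite in_itv/= lee_fin => /andP[x0 x1].
    by apply: (le_trans _ x1); apply: hkernel_le_id; rewrite ?x0//; lra.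
apply: (@le_trans _ _ (\int[mu]_(u in `]1%R, +oo[) (2 ^+ r * u `^ (- p))%:E)%E).
  apply: ge0_le_integral => //.
  - by move=> x _; rewrite lee_fin hkernel_ge0.
  - by apply/measurable_EFinP/measurable_funTS.
  - apply/measurable_EFinP/measurable_funTS/measurable_funM => //; exact: measurable_powR.
  - by move=> x/=; rewrite in_itv/= andbT lee_fin => /ltW; exact: hkernel_le_tail.
apply: ge0_subset_integral => //=.
- apply/measurable_EFinP/measurable_funTS/measurable_funM => //; exact: measurable_powR.
- by move=> x _; rewrite lee_fin mulr_ge0 ?powR_ge0.
- by move=> x/=; rewrite !in_itv/= !andbT => /ltW.
Qed.

(** On [pi/2, pi] the cosine is nonpositive, so the kernel is at least pi^(-1-p) there. *)
Lemma hmass_gt0 r p : 0 < p -> (0 < hmass r p)%E.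
Proof.
move=> p0.
have pi0 := pi_gt0 R.
have I0 : (0 < \int[mu]_(u in `[(pi / 2)%R, (pi : R)]) (pi `^ (- (1 + p)) : R)%:E)%E.
  rewrite integral_cst//= lebesgue_measure_itv/= lte_fin.
  rewrite ifT; last by lra.
  by rewrite -EFinB -EFinM lte_fin mulr_gt0 ?powR_gt0//; lra.
apply: (lt_le_trans I0).
apply: (@le_trans _ _ (\int[mu]_(u in `[(pi / 2)%R, (pi : R)]) (hkernel r p u)%:E)%E); last first.
  apply: ge0_subset_integral => //=.
  - by apply/measurable_EFinP/measurable_funTS; exact: measurable_hkernel.
  - by move=> x _; rewrite lee_fin hkernel_ge0.
  - by move=> x/=; rewrite !in_itv/= !andbT => /andP[+ _]; apply: lt_le_trans; lra.
apply: ge0_le_integral => //.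
- by move=> x _; rewrite lee_fin powR_ge0.
- by apply/measurable_EFinP/measurable_funTS; exact: measurable_hkernel.
move=> x/=; rewrite in_itv/= lee_fin => /andP[x1 x2].
have x0 : 0 < x by apply: lt_le_trans x1; lra.
rewrite -[leLHS]mul1r; apply: ler_pM => //; first exact: powR_ge0.
  rewrite exprn_ege1// lerDl oppr_ge0 -[x](subrK pi) cosDpi oppr_le0.
  apply: cos_ge0_pihalf; lra.
rewrite !powRN lef_pV2 ?posrE ?powR_gt0//.
by apply: ge0_ler_powR; rewrite ?nnegrE ?(ltW x0) ?(ltW pi0)//; lra.
Qed.

(* As (1 - cos)^r is a trigonometric polynomial, this expresses absolute moments through
   characteristic functions. *)
Lemma integral_hkernel_scale r p x : p + 1 <= r%:R -> 1 < p ->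
  (\int[mu]_(u in `]0%R, +oo[) ((1 - cos (u * x)) ^+ r * u `^ (- (1 + p)))%:E
   = (`|x| `^ p)%:E * hmass r p)%E.
Proof.
move=> pr p1; have p0 : 0 < p by lra.
wlog x0 : x / 0 < x => [hw|].
  have [/hw//|x0|<-] := ltgtP 0 x.
    rewrite -normrN -hw ?oppr_gt0//.
    by apply: eq_integral => u _; rewrite mulrN cosN.
  rewrite normr0 powR0 ?gt_eqF// mul0e.
  apply: integral0_eq => u _; rewrite mulr0 cos0 subrr expr0n.
  case: eqP => [r0|_]; last by rewrite mul0r.
  by move: pr; rewrite {1}r0 => pr; exfalso; lra.
rewrite gtr0_norm// /hmass.
rewrite !integral_itv_obnd_cbnd; [|apply/measurable_EFinP/measurable_funTS; exact: measurable_hkernel|]; last first.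
  apply/measurable_EFinP/measurable_funTS/measurable_funM; last exact: measurable_powR.
  apply: (@measurableT_comp _ _ _ _ _ _ (fun y => (1 - cos y) ^+ r)); first exact: measurable_oneBcosX.
  exact: measurable_funM.
have d1 : ((fun u : R => u * x)^`())%classic = cst x.
  by apply/funext => u; rewrite derive1E deriveM// derive_id derive_cst scaler0 add0r scaler1.
have := @increasing_ge0_integration_by_substitutiony R (fun u => u * x) (hkernel r p) 0.
rewrite mul0r d1 => ->.
- rewrite -ge0_integralZl//; last 3 first.
  + apply/measurable_EFinP/measurable_funTS; apply: measurable_funM => //.
    apply: (@measurableT_comp _ _ _ _ _ _ (hkernel r p)); first exact: measurable_hkernel.
    exact: measurable_funM.
  + by move=> u _; rewrite lee_fin/= mulr_ge0 ?(ltW x0)// hkernel_ge0.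
  + by rewrite lee_fin powR_ge0.
  apply: eq_integral => u; rewrite inE/= in_itv/= andbT => u0.
  rewrite -EFinM; congr EFin; rewrite /hkernel !fctE/= powRM ?(ltW x0)//.
  have xx : x `^ p * (x `^ (- (1 + p)) * x) = 1.
    rewrite -{3}(powRr1 (ltW x0)) -!powRD ?(gt_eqF x0) ?implybT//.
    by rewrite (_ : p + _ = 0) ?powRr0//; lra.
  move: ((1 - cos (u * x)) ^+ r) (u `^ (- (1 + p))) => a c.
  transitivity (a * c * (x `^ p * (x `^ (- (1 + p)) * x))); [by rewrite xx mulr1|ring].
- by move=> u v _ _ uv; rewrite ltr_pM2r.
- by move=> u _; exact: cvg_cst.
- exact: is_cvg_cst.
- exact: is_cvg_cst.
- split; first by move=> u _; exact: derivableM.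
  by apply: cvg_at_right_filter; apply: cvgM; [exact: cvg_id|exact: cvg_cst].
- by apply: gt0_cvgMly => //; exact: cvg_id.
- by apply: hkernel_continuous.
- by move=> u _; exact: hkernel_ge0.
Qed.

End Kernel.

(** * The standard normal density and its characteristic function *)

Section Gaussian.
Context {R : realType}.
Implicit Types (p u x y : R) (r : nat).
Notation mu := (@lebesgue_measure R).

(** Induction on [r] with 2 cos(zy) cos y = cos((z+1)y) + cos((z-1)y). A pair in [s] holds a
    coefficient and a frequency. *)
Lemma oneBcosX_trig r : exists s : seq (R * R), forall y,
  (1 - cos y) ^+ r = \sum_(z <- s) z.1 * cos (z.2 * y).
Proof.
elim: r => [|r [s IH]].
  by exists [:: (1, 0)] => y; rewrite big_seq1/= mul0r cos0 mulr1 expr0.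
exists (s ++ [seq (- z.1 / 2, z.2 + 1) | z <- s] ++ [seq (- z.1 / 2, z.2 - 1) | z <- s]) => y.
rewrite exprSr IH !big_cat/= !big_map/= -!big_split/= big_distrl/=.
apply: eq_bigr => z _; by rewrite mulrDl mulrBl !mul1r cosD cosB; field.
Qed.

Definition phi x : R := normal_pdf 0 1 x.

Lemma phiE x : phi x = (Num.sqrt (pi *+ 2))^-1 * expR (- (x ^+ 2 / 2)).
Proof.
rewrite /phi normal_pdfE ?oner_neq0// /normal_peak /normal_fun expr1n mul1r subr0.
by rewrite mulNr.
Qed.

Lemma phi_ge0 x : 0 <= phi x. Proof. exact: normal_pdf_ge0. Qed.

Lemma phiN x : phi (- x) = phi x. Proof. by rewrite !phiE sqrrN. Qed.

Lemma measurable_phi : measurable_fun setT phi. Proof. exact: measurable_normal_pdf. Qed.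

Lemma continuous_phi : continuous phi.
Proof. by apply: continuous_normal_pdf; rewrite oner_neq0. Qed.

Lemma Rintegral_phi : \int[mu]_x phi x = 1.
Proof. by rewrite /Rintegral integral_normal_pdf. Qed.

Lemma powR_le_exp_sqr p : 0 < p -> exists C : R, forall x, `|x| `^ p <= C * expR (x ^+ 2 / 4).
Proof.
(* From ln t <= t with t = x^2/(2p). The rate 1/4 leaves exp(-x^2/4) after multiplication by [phi],
   up to a factor the normal density of variance 2, hence still integrable. *)
move=> p0; exists (expR (p / 2 * ln (2 * p))) => x.
have [->|x0] := eqVneq x 0.
  by rewrite normr0 powR0 ?gt_eqF// mulr_ge0 ?expR_ge0.
have nx0 : 0 < `|x| by rewrite normr_gt0.
rewrite /powR gt_eqF// -expRD ler_expR.
have x2 : 0 < x ^+ 2 by rewrite exprn_even_gt0.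
have -> : p * ln `|x| = p / 2 * ln (x ^+ 2).
  by rewrite -real_normK ?num_real// lnXn// -[ln _ *+ 2]mulr_natl; field.
have := @le_ln1Dx _ (x ^+ 2 / (2 * p) - 1).
have q0 : 0 < x ^+ 2 / (2 * p) by rewrite divr_gt0// mulr_gt0.
rewrite (addrC 1) subrK => /(_ ltac:(lra)) h.
have -> : ln (x ^+ 2) = ln (x ^+ 2 / (2 * p)) + ln (2 * p).
  have E : x ^+ 2 = x ^+ 2 / (2 * p) * (2 * p) by rewrite divfK// gt_eqF// mulr_gt0.
  by rewrite {1}E lnM// posrE mulr_gt0.
have -> : p / 2 * ln (2 * p) + x ^+ 2 / 4 = p / 2 * (x ^+ 2 / (2 * p) + ln (2 * p)).
  by field; rewrite gt_eqF.
rewrite ler_wpM2l ?divr_ge0 ?(ltW p0)// lerD2r; lra.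
Qed.

Lemma integrable_powR_phi p : 0 < p -> mu.-integrable setT (EFin \o (fun x => `|x| `^ p * phi x)).
Proof.
move=> p0; have [C hC] := powR_le_exp_sqr p0.
have C0 : 0 <= C by have := hC 0; rewrite expr0n mul0r expR0 mulr1; apply: le_trans; exact: powR_ge0.
pose s : R := Num.sqrt 2.
have s0 : 0 < s by rewrite sqrtr_gt0.
pose k := (Num.sqrt (pi *+ 2))^-1 / (normal_peak s : R).
have k0 : 0 <= k by rewrite divr_ge0 ?invr_ge0// normal_peak_ge0.
have np : 0 < normal_peak s by rewrite normal_peak_gt0// gt_eqF.
have key (x : R) : `|x| `^ p * phi x <= C * k * normal_pdf 0 s x.
  apply: (@le_trans _ _ (C * expR (x ^+ 2 / 4) * phi x)); first by rewrite ler_wpM2r ?phi_ge0.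
  rewrite -!mulrA ler_wpM2l// phiE normal_pdfE ?gt_eqF// /normal_fun subr0.
  rewrite /k -!mulrA mulKf ?(gt_eqF np)//.
  rewrite mulrCA ler_wpM2l ?invr_ge0// -expRD ler_expR sqr_sqrtr//.
  have -> : 2 *+ 2 = 4 :> R by rewrite -mulr_natr; lra.
  by lra.
apply: (@le_integrable _ _ _ mu setT measurableT _ (EFin \o (fun x => C * k * normal_pdf 0 s x))).
- apply/measurable_EFinP/measurable_funM; last exact: measurable_phi.
  exact: measurable_norm_powR.
- move=> /= x _; rewrite lee_fin.
  rewrite [leLHS]ger0_norm ?mulr_ge0 ?powR_ge0 ?phi_ge0//.
  by rewrite (le_trans (key x))// ler_norm.
- exact: (integrableZl measurableT _ (integrable_normal_pdf _ _)).
Qed.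

Lemma measurable_cosZ (u : R) : measurable_fun setT (fun x : R => cos (u * x)).
Proof.
apply: continuous_measurable_fun => x; apply: continuous_comp; last exact: continuous_cos.
by apply: cvgM; [exact: cvg_cst|exact: cvg_id].
Qed.

Lemma measurable_sinZ (u : R) : measurable_fun setT (fun x : R => sin (u * x)).
Proof.
apply: continuous_measurable_fun => x; apply: continuous_comp; last exact: continuous_sin.
by apply: cvgM; [exact: cvg_cst|exact: cvg_id].
Qed.

Lemma integrable_bounded_phi (f : R -> R) (M : R) : measurable_fun setT f ->
  (forall x, `|f x| <= M) -> mu.-integrable setT (EFin \o (fun x => f x * phi x)).
Proof.
move=> mf fM.
apply: (@le_integrable _ _ _ mu setT measurableT _ (EFin \o (fun x => M * phi x))).
- by apply/measurable_EFinP/measurable_funM => //; exact: measurable_phi.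
- move=> /= x _; rewrite lee_fin !normrM ler_wpM2r// (le_trans (fM x))//.
  exact: ler_norm.
- exact: (integrableZl measurableT _ (integrable_normal_pdf _ _)).
Qed.

Lemma integrable_id_phi (f : R -> R) : measurable_fun setT f ->
  (forall x, `|f x| <= 1) -> mu.-integrable setT (EFin \o (fun x => x * f x * phi x)).
Proof.
move=> mf f1.
apply: (@le_integrable _ _ _ mu setT measurableT _ (EFin \o (fun x => `|x| `^ 1 * phi x))).
- apply/measurable_EFinP/measurable_funM; last exact: measurable_phi.
  exact: measurable_funM.
- move=> /= x _; rewrite lee_fin !normrM ler_wpM2r// powRr1// normr_id.
  by rewrite ler_piMr.
- exact: integrable_powR_phi.
Qed.

Lemma is_derive_cosZ (u x : R) : is_derive x 1 (fun y : R => cos (u * y)) (- (u * sin (u * x))).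
Proof.
have -> : - (u * sin (u * x)) = - sin (u * x) * u by rewrite mulNr mulrC.
apply: (@is_derive1_comp _ cos (fun y => u * y)).
by rewrite -[X in is_derive _ _ _ X]mulr1; apply: is_deriveZ.
Qed.

Lemma is_derive_sinZ (u x : R) : is_derive x 1 (fun y : R => sin (u * y)) (u * cos (u * x)).
Proof.
rewrite mulrC; apply: (@is_derive1_comp _ sin (fun y => u * y)).
by rewrite -[X in is_derive _ _ _ X]mulr1; apply: is_deriveZ.
Qed.

Lemma is_derive_phi x : is_derive x 1 phi (- x * phi x).
Proof.
have -> : phi = (fun x => (Num.sqrt (pi *+ 2))^-1 * expR (- (x ^+ 2 / 2))).
  by apply/funext => y; rewrite phiE.
rewrite mulrCA; apply: is_deriveZ.
rewrite mulrC; apply: (@is_derive1_comp _ expR (fun x => - (x ^+ 2 / 2))).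
apply: is_deriveN.
under eq_fun do rewrite mulrC.
rewrite [X in is_derive _ _ _ X](_ : x = 2^-1 * (2 * x)); last by field.
apply: is_deriveZ.
have := @is_deriveX _ _ (fun y : R => y) 2 x 1 1 (is_derive_id _ _).
by rewrite expr1 /GRing.scale/= mulr1.
Qed.


(** A crude decay from exp y >= 1 + y, enough to remove boundary terms along the integers. *)
Lemma phi_le (n : nat) x : n%:R <= `|x| -> phi x <= 2 * harmonic n.
Proof.
move=> nx; rewrite phiE /harmonic/=.
have p1 : 1 <= Num.sqrt (pi *+ 2 : R).
  rewrite -[leLHS]sqrtr1 ler_sqrt; have := pi_ge2 R; rewrite -mulr_natr; lra.
have x2 : n%:R <= x ^+ 2 / 2 *+ 2.
  rewrite -[_ *+ 2]mulr_natr divfK//; case: n nx => [|n] nx; first exact: sqr_ge0.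
  rewrite -real_normK ?num_real//; apply: (le_trans nx).
  by rewrite expr2 ler_peMr//; apply: (le_trans _ nx); rewrite ler1n.
have e1 := expR_ge1Dx (x ^+ 2 / 2).
rewrite expRN -invfM ler_pdivlMr// mulrC ler_pdivrMr; last first.
  by rewrite mulr_gt0 ?expR_gt0//; lra.
apply: (@le_trans _ _ (2 * expR (x ^+ 2 / 2))); last first.
  by rewrite ler_wpM2l// ler_peMl// expR_ge0.
have -> : n.+1%:R = n%:R + 1 :> R by rewrite natr1.
move: x2; rewrite -[_ *+ 2]mulr_natr; lra.
Qed.

(** Fundamental theorem of calculus on symmetric intervals, then dominated convergence; the boundary
    terms are at most [phi] and disappear in the limit. *)
Lemma integral_derivative_eq0 (h h' : R -> R) :
  (forall x, is_derive x 1 h (h' x)) -> continuous h' ->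
  mu.-integrable setT (EFin \o h') -> (forall x, `|h x| <= phi x) ->
  \int[mu]_x h' x = 0.
Proof.
move=> dh ch ih hphi.
pose f_ (n : nat) := fun x => ((\1_`[- n.+1%:R, n.+1%:R] x * h' x)%:E : \bar R).
have mh : measurable_fun setT h' by exact: continuous_measurable_fun.
have : (\int[mu]_x f_ n x)%E @[n --> \oo] --> (\int[mu]_x (h' x)%:E)%E.
  apply: (@dominated_cvg _ _ _ mu setT measurableT f_ _ (fun x => `|h' x|%:E)) => //.
  - move=> n; apply/measurable_EFinP/measurable_funM => //.
  - move=> x _; apply: cvg_EFin; first exact: nearW.
    apply: cvg_near_cst; near=> n; rewrite /f_/= indicE mem_set ?mul1r//=.
    rewrite in_itv/= -ler_norml; apply: ltW; apply: (lt_trans (truncnS_gt _)).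
    by rewrite ltr_nat ltnS; near: n; exact: nbhs_infty_gt.
  - exact: integrable_norm.
  - move=> n x _; rewrite /f_ abse_EFin lee_fin normrM ler_piMl//.
    by rewrite indicE; case: (_ \in _); rewrite ?normr1 ?normr0.
have f_E n : (\int[mu]_x f_ n x)%E = (h n.+1%:R - h (- n.+1%:R))%:E.
  rewrite EFinB -(@continuous_FTC2 R h' h (- n.+1%:R) n.+1%:R).
  - rewrite [RHS]integral_mkcond; apply: eq_integral => x _.
    rewrite /f_ patchE indicE; case: ifPn => _; by rewrite ?mul1r ?mul0r.
  - by rewrite ltrNl (lt_trans _ (_ : 0 < n.+1%:R))// oppr_lt0.
  - exact: continuous_subspaceT.
  - have hc x : h y @[y --> x] --> h x.
      by apply: differentiable_continuous; apply/derivable1_diffP; case: (dh x).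
    split; [by move=> x _; case: (dh x)|exact/cvg_at_right_filter|exact/cvg_at_left_filter].
  - by move=> x _; rewrite derive1E; case: (dh x).
under eq_fun do rewrite f_E.
have h0 : (h n.+1%:R - h (- n.+1%:R))%:E @[n --> \oo] --> 0%:E.
  apply: cvg_EFin; first exact: nearW.
  apply: norm_cvg0.
  apply: (@squeeze_cvgr _ _ _ _ (fun=> 0) (fun n => 4 * harmonic n)).
  - near=> n; rewrite normr_ge0/=; apply: le_trans (ler_normB _ _) _.
    have b1 (y : R) : `|y| = n.+1%:R -> `|h y| <= 2 * harmonic n.
      by move=> yn; apply: le_trans (hphi y) _; apply: phi_le; rewrite yn ler_nat.
    have := b1 n.+1%:R; have := b1 (- n.+1%:R).
    rewrite normrN ger0_norm// => /(_ erefl) h1 /(_ erefl) h2.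
    rewrite (_ : 4 = 2 + 2 :> R); last by rewrite -natrD.
    by rewrite mulrDl; exact: lerD.
  - exact: cvg_cst.
  - by rewrite -[X in _ --> X](mulr0 4); apply: cvgMl_tmp; exact: cvg_harmonic.
by move=> hh; rewrite /Rintegral -(cvg_unique _ h0 hh).
Unshelve. all: by end_near. Qed.

(** The difference of the two integrands is, up to sign, the derivative of sin(ux) phi(x). *)
Lemma phi_by_parts u : \int[mu]_x (x * sin (u * x) * phi x) = u * \int[mu]_x (cos (u * x) * phi x).
Proof.
have i1 := integrable_id_phi (measurable_sinZ u) (fun x => sin_max _).
have i2 := integrable_bounded_phi (measurable_cosZ u) (fun x => cos_max _).
rewrite -RintegralZl//.
apply/eqP; rewrite eq_sym -subr_eq0 -RintegralB//; last exact: (integrableZl measurableT _ i2).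
apply/eqP; apply: (@integral_derivative_eq0 (fun x => sin (u * x) * phi x)).
- move=> x.
  have -> : u * (cos (u * x) * phi x) - x * sin (u * x) * phi x =
    sin (u * x) *: (- x * phi x) + phi x *: (u * cos (u * x)).
    by rewrite /GRing.scale/=; ring.
  apply: is_deriveM; [exact: is_derive_sinZ|exact: is_derive_phi].
- move=> x; apply: cvgB.
    apply: cvgMl_tmp; apply: cvgM; last exact: continuous_phi.
    by have [/derivable1_diffP/differentiable_continuous] := is_derive_cosZ u x.
  apply: cvgM; last exact: continuous_phi.
  apply: cvgM; first exact: cvg_id.
  by have [/derivable1_diffP/differentiable_continuous] := is_derive_sinZ u x.
- exact: (integrableB measurableT (integrableZl measurableT _ i2) i1).
- by move=> x; rewrite normrM (ger0_norm (phi_ge0 _)) ler_piMl ?phi_ge0// sin_max.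
Qed.

(** Differentiating under the integral and integrating by parts gives F' = -uF, so F(u) exp(u^2/2)
    is constant and equals F(0) = 1. *)
Lemma phi_char u : \int[mu]_x (cos (u * x) * phi x) = expR (- (u ^+ 2 / 2)).
Proof.
pose F u := \int[mu]_x (cos (u * x) * phi x).
have dF (v : R) : is_derive v (1 : R) F (- v * F v).
  pose f (v x : R) := cos (v * x) * phi x.
  have df w x : is_derive w (1 : R) (f^~ x) (- (x * sin (w * x) * phi x)).
    have -> : - (x * sin (w * x) * phi x) = phi x * (- (x * sin (w * x))) by ring.
    rewrite /f; under eq_fun do rewrite mulrC (mulrC _ x).
    by rewrite (mulrC w); apply: is_deriveZ; exact: is_derive_cosZ.
  have I : `]v - 1, v + 1[%classic v by rewrite /= in_itv/=; apply/andP; split; lra.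
  have h1 (x : R) : `]v - 1, v + 1[%classic x -> mu.-integrable setT (EFin \o f x).
    by move=> _; exact: integrable_bounded_phi (measurable_cosZ x) (fun x => cos_max _).
  have h2 (x y : R) : `]v - 1, v + 1[%classic x -> setT y -> derivable (f^~ y) x 1.
    by move=> _ _; case: (df x y).
  have iG := integrable_powR_phi ltr01.
  have G0 (y : R) : 0 <= `|y| `^ 1 * phi y by rewrite mulr_ge0 ?powR_ge0 ?phi_ge0.
  have h3 (x y : R) : `]v - 1, v + 1[%classic x -> setT y ->
      `|partial1of2 f x y| <= `|y| `^ 1 * phi y.
    move=> _ _; rewrite partial1of2E; have [_ ->] := df x y.
    rewrite normrN !normrM (ger0_norm (phi_ge0 y)) ler_wpM2r ?phi_ge0// powRr1//.
    by rewrite ler_piMr// sin_max.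
  split; first exact: (derivable_under_integral measurableT I h1 h2 G0 iG h3).
  rewrite -derive1E (differentiation_under_integral measurableT I h1 h2 G0 iG h3).
  rewrite /F mulNr -phi_by_parts.
  rewrite -[RHS]mulN1r -RintegralZl//; last first.
    exact: integrable_id_phi (measurable_sinZ v) (fun x => sin_max _).
  apply: eq_Rintegral => x _; rewrite partial1of2E mulN1r.
  by case: (df v x).
pose E u := F u * expR (u ^+ 2 / 2).
have dE (v : R) : is_derive v (1 : R) E 0.
  have -> : 0 = F v *: (v * expR (v ^+ 2 / 2)) + expR (v ^+ 2 / 2) *: (- v * F v) :> R.
    by rewrite /GRing.scale/=; ring.
  apply: is_deriveM.
  rewrite mulrC; apply: (@is_derive1_comp _ expR (fun x => x ^+ 2 / 2)).
  under eq_fun do rewrite mulrC.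
  rewrite [X in is_derive _ _ _ X](_ : v = 2^-1 * (2 * v)); last by field.
  apply: is_deriveZ.
  have := @is_deriveX _ _ (fun y : R => y) 2 v 1 1 (is_derive_id _ _).
  by rewrite expr1 /GRing.scale/= mulr1.
have := is_derive_0_is_cst u 0 dE.
rewrite /E expr0n mul0r expR0 mulr1 {2}/F.
under [in X in _ = X -> _]eq_Rintegral => x _ do rewrite mul0r cos0 mul1r.
rewrite Rintegral_phi => /(congr1 (fun z => z * expR (- (u ^+ 2 / 2)))).
by rewrite -mulrA -expRD subrr expR0 mulr1 mul1r.
Qed.

End Gaussian.

(** * Gaussian absolute moments and the Gamma function *)

Section GammaMoment.
Context {R : realType}.
Implicit Types (p u x y : R) (r : nat).
Notation mu := (@lebesgue_measure R).

Lemma continuous_norm_powR (a : R) : 0 < a -> continuous (fun x : R => `|x| `^ a).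
Proof.
move=> a0 x; have [->|x0] := eqVneq x 0; last first.
  apply: (@continuous_comp _ _ _ (fun x : R => `|x|) (fun x => x `^ a)).
    exact: norm_continuous.
  by apply: powR_continuous_gt0; rewrite normr_gt0.
rewrite /continuous_at normr0 powR0 ?gt_eqF//; apply/cvgrPdist_le => e e0.
near=> y; rewrite sub0r normrN ger0_norm ?powR_ge0//.
rewrite -[leRHS](powRr1 (ltW e0)) -(mulVf (lt0r_neq0 a0)) powRrM.
apply: ge0_ler_powR; rewrite ?nnegrE ?powR_ge0 ?(ltW a0)//.
near: y; apply: (cvgr0_norm_le (fun y : R => y)); first exact: cvg_id.
by rewrite powR_gt0.
Unshelve. all: by end_near. Qed.

Definition gaussM p : R := \int[mu]_x (`|x| `^ p * phi x).

Lemma integral_gaussM p : 0 < p -> (\int[mu]_x (`|x| `^ p * phi x)%:E)%E = (gaussM p)%:E.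
Proof.
move=> p0; rewrite /gaussM /Rintegral fineK//.
exact: (integrable_fin_num measurableT (integrable_powR_phi p0)).
Qed.

Lemma gaussM_ge0 p : 0 <= gaussM p.
Proof.
by apply: Rintegral_ge0 => x _; rewrite mulr_ge0 ?powR_ge0 ?phi_ge0.
Qed.

Lemma gaussM_gt0 p : 0 < p -> 0 < gaussM p.
Proof.
move=> p0; rewrite -lte_fin -integral_gaussM//.
have phi2 : 0 < phi 2 :> R.
  by rewrite phiE mulr_gt0 ?expR_gt0// invr_gt0 sqrtr_gt0 mulrn_wgt0// pi_gt0.
have phiM (x : R) : 0 <= x -> x <= 2 -> phi 2 <= phi x.
  move=> x0 x2; rewrite !phiE; apply: ler_wpM2l; first by rewrite invr_ge0 sqrtr_ge0.
  by rewrite ler_expR lerN2 ler_wpM2r// lerXn2r// nnegrE.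
have I0 : (0 < \int[mu]_(x in `[1%R, 2%R]) (phi (2 : R))%:E)%E.
  rewrite integral_cst//= lebesgue_measure_itv/= lte_fin.
  rewrite ifT; last by lra.
  by rewrite -EFinB -EFinM lte_fin mulr_gt0//; lra.
have mf : measurable_fun setT (fun x : R => `|x| `^ p * phi x).
  apply: measurable_funM; last exact: measurable_phi.
  exact: measurable_norm_powR.
apply: (lt_le_trans I0).
apply: (@le_trans _ _ (\int[mu]_(x in `[1%R, 2%R]) (`|x| `^ p * phi x)%:E)%E); last first.
  apply: ge0_subset_integral => //=; first exact/measurable_EFinP.
  by move=> x _; rewrite lee_fin mulr_ge0 ?powR_ge0 ?phi_ge0.
apply: ge0_le_integral => //.
- by move=> x _; rewrite lee_fin phi_ge0.
- by apply/measurable_EFinP/measurable_funTS.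
move=> x/=; rewrite in_itv/= lee_fin => /andP[x1 x2].
have x0 : 0 <= x by lra.
rewrite -[leLHS]mul1r; apply: ler_pM => //; [exact: phi_ge0| |exact: phiM].
by rewrite ger0_norm// -(powRr0 x); apply: ler_powR => //; exact: ltW.
Qed.

Let itv_n_cvg (f : R -> R) (N : nat -> R) : (forall x, 0 <= f x) -> continuous f ->
  {homo N : n m / (n <= m)%N >-> n <= m} -> (forall n, n%:R <= N n + 1) ->
  (\int[mu]_(x in `[0%R, N n]) (f x)%:E)%E @[n --> \oo] -->
  (\int[mu]_(x in `[0%R, +oo[) (f x)%:E)%E.
Proof.
move=> f0 cf hN Nn.
have -> : `[0, +oo[%classic = \bigcup_n `[0, N n]%classic.
  apply/seteqP; split => x /=.
    rewrite in_itv/= andbT => x0; exists (Num.truncn x).+2 => //=.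
    rewrite in_itv/= x0/=; have := Nn (Num.truncn x).+2; have := truncnS_gt x.
    by rewrite -[X in X%:R <= _ -> _]addn1 natrD; lra.
  by move=> [n _ /=]; rewrite !in_itv/= andbT => /andP[].
apply: ge0_nondecreasing_set_cvg_integral => //.
- move=> n m nm; apply/subsetPset => x /=; rewrite !in_itv/= => /andP[-> /= h].
  by apply: le_trans h _; exact: hN.
- by move=> i; apply/measurable_EFinP/measurable_funTS; exact: continuous_measurable_fun.
- by move=> i x _; rewrite lee_fin.
Qed.

(** Evenness and the substitution s = x^2/2, which turns x^p phi(x) dx into a multiple of
    s^((p-1)/2) exp(-s) ds; p > 1 makes this integrand continuous at 0. *)
Lemma gaussME p : 1 < p ->
  gaussM p = 2 `^ (p / 2) * Gamma ((p + 1) / 2) / Num.sqrt pi.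
Proof.
move=> p1; have p0 : 0 < p by lra.
pose a := (p - 1) / 2; have a0 : 0 < a by rewrite divr_gt0// subr_gt0.
pose c : R := (Num.sqrt (pi *+ 2))^-1.
have c0 : 0 < c by rewrite invr_gt0 sqrtr_gt0 mulrn_wgt0// pi_gt0.
pose f x := `|x| `^ p * phi x.
pose G (s : R) := c * 2 `^ a * (`|s| `^ a * expR (- s)).
pose F (x : R) := x ^+ 2 / 2.
have f0 x : 0 <= f x by rewrite mulr_ge0 ?powR_ge0 ?phi_ge0.
have G0 x : 0 <= G x by rewrite !mulr_ge0 ?powR_ge0 ?expR_ge0// ltW.
have cf : continuous f.
  by move=> x; apply: cvgM; [exact: continuous_norm_powR|exact: continuous_phi].
have cG : continuous G.
  move=> x; apply: cvgMl_tmp; apply: cvgM; first exact: continuous_norm_powR.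
  by apply: continuous_comp; [exact: continuousN|exact: continuous_expR].
have dF (x : R) : is_derive x (1 : R) F x.
  rewrite [X in is_derive _ _ _ X](_ : x = 2^-1 * (2 * x)); last by field.
  rewrite /F; under eq_fun do rewrite mulrC.
  apply: is_deriveZ.
  have := @is_deriveX _ _ (fun y : R => y) 2 x 1 1 (is_derive_id _ _).
  by rewrite expr1 /GRing.scale/= mulr1.
have F'E : F^`()%classic = id by apply/funext => x; rewrite derive1E; case: (dF x).
have Fc x : F y @[y --> x] --> F x.
  by apply: differentiable_continuous; apply/derivable1_diffP; case: (dF x).
have pw (x : R) : 0 <= x -> G (F x) * x = f x.
  move=> x0; rewrite /G /f phiE.
  have F0 : 0 <= F x by rewrite divr_ge0// sqr_ge0.
  have -> : `|x| `^ p = 2 `^ a * `|F x| `^ a * x.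
    rewrite (ger0_norm F0) -powRM// (ger0_norm x0) /F mulrCA divff// mulr1.
    rewrite -powR_mulrn// -powRrM /a.
    have -> : 2%:R * ((p - 1) / 2) = p - 1 by rewrite mulrC divfK.
    by rewrite mulrC mulr_powRB1.
  by rewrite -/c /F; ring.
have sub (n : nat) : (\int[mu]_(x in `[0%R, F n%:R]) (G x)%:E =
    \int[mu]_(x in `[0%R, n%:R]) (f x)%:E)%E.
  have {1}-> : 0 = F 0 by rewrite /F expr0n mul0r.
  rewrite integration_by_substitution_increasing//.
  - apply: eq_integral => x; rewrite inE/= in_itv/= => /andP[x0 _].
    by congr EFin; rewrite F'E; exact: pw.
  - move=> x y; rewrite !in_itv/= => /andP[x0 _] /andP[y0 _] xy.
    by rewrite /F ltr_pM2r// ltrXn2r.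
  - by rewrite F'E => x _; exact: cvg_id.
  - by rewrite F'E; apply/cvg_ex; exists 0; apply/cvg_at_right_filter/cvg_id.
  - by rewrite F'E; apply/cvg_ex; exists n%:R; apply/cvg_at_left_filter/cvg_id.
  - by split; [move=> x _; case: (dF x)|exact/cvg_at_right_filter|exact/cvg_at_left_filter].
  - exact: continuous_subspaceT.
have l1 := itv_n_cvg f0 cf (N := fun n => n%:R) _ _.
have l2 := itv_n_cvg G0 cG (N := fun n => F n%:R) _ _.
have lG : (\int[mu]_(x in `[0%R, n%:R]) (f x)%:E)%E @[n --> \oo] -->
    (\int[mu]_(x in `[0%R, +oo[) (G x)%:E)%E.
  have -> : (fun n => \int[mu]_(x in `[0%R, n%:R]) (f x)%:E)%E =
      (fun n => \int[mu]_(x in `[0%R, F n%:R]) (G x)%:E)%E.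
    by apply/funext => n; rewrite sub.
  apply: l2.
  - by move=> n m nm; rewrite /F ler_wpM2r// lerXn2r ?nnegrE// ler_nat.
  - by move=> n; rewrite /F; have := sqr_ge0 (n%:R - 1 : R); rewrite sqrrB1; lra.
have E : (\int[mu]_(x in `[0%R, +oo[) (f x)%:E = \int[mu]_(x in `[0%R, +oo[) (G x)%:E)%E.
  apply: (cvg_unique _ (l1 _ _) lG) => //.
  - by move=> n m nm; rewrite ler_nat.
  - by move=> n; rewrite lerDl.
have E2 := ge0_symfun_integralT f0 cf.
rewrite /gaussM /Rintegral -/f E2; last by move=> x; rewrite /= /f normrN phiN.
have -> : [set x : R | 0 <= x] = `[0, +oo[%classic by rewrite set_itvcy.
rewrite E -integral_itv_obnd_cbnd; last first.
  by apply/measurable_EFinP/measurable_funTS; exact: continuous_measurable_fun.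
have -> : (\int[mu]_(x in `]0%R, +oo[) (G x)%:E = (c * 2 `^ a)%:E *
   \int[mu]_(x in `]0%R, +oo[) (x `^ ((p + 1) / 2 - 1) * expR (- x))%:E)%E.
  rewrite -ge0_integralZl_EFin.
  - apply: eq_integral => x; rewrite inE/= in_itv/= andbT => x0.
    by rewrite -EFinM /G gtr0_norm// (_ : (p + 1) / 2 - 1 = a)// /a; lra.
  - exact: measurable_itv.
  - by move=> x _; rewrite lee_fin mulr_ge0 ?powR_ge0 ?expR_ge0.
  - apply/measurable_EFinP/measurable_funTS; apply: measurable_funM; first exact: measurable_powR.
    by apply: measurableT_comp => //; exact: measurable_expR.
  - by rewrite mulr_ge0 ?powR_ge0// ltW.
rewrite /Gamma /Rintegral.
set I := (\int[mu]_(x in _) _)%E.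
have I0 : (0 <= I)%E.
  by apply: integral_ge0 => x _; rewrite lee_fin mulr_ge0 ?powR_ge0 ?expR_ge0.
have k0 : 0 < 2 * (c * 2 `^ a) by rewrite !mulr_gt0 ?powR_gt0.
have -> : 2 `^ (p / 2) * fine I / Num.sqrt pi = 2 * (c * 2 `^ a) * fine I.
  rewrite mulrAC; congr (_ * _); rewrite /c -[pi *+ 2]mulr_natr sqrtrM ?pi_ge0// invfM.
  rewrite (_ : p / 2 = a + 2^-1); last by rewrite /a; lra.
  rewrite powRD ?pnatr_eq0 ?implybT// powR12_sqrt//.
  have s2 : Num.sqrt 2 * Num.sqrt 2 = 2 :> R by rewrite -expr2 sqr_sqrtr.
  have n2 : Num.sqrt 2 != 0 :> R by rewrite gt_eqF// sqrtr_gt0.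
  have npi : Num.sqrt pi != 0 :> R by rewrite gt_eqF// sqrtr_gt0 pi_gt0.
  rewrite -{3}s2; field; rewrite n2 npi//.
rewrite muleA -EFinM.
(* [fine] sends an infinite value to 0 on both sides, so that case agrees too. *)
move: I0; case: I => [i| |] //= _.
by rewrite mulry gtr0_sg// mul1e mulr0.
Qed.

End GammaMoment.

(** * Integration on a probability space *)

Section Helpers.
Context {R : realType} {d : measure_display} {T : measurableType d}.
Variable P : probability T R.

Lemma integrable_boundedP (f : T -> R) (M : R) : measurable_fun setT f ->
  (forall w, `|f w| <= M) -> P.-integrable setT (EFin \o f).
Proof.
move=> mf fM.
apply: (@le_integrable _ _ _ P setT measurableT _ (EFin \o (fun=> M))).
- exact/measurable_EFinP.
- by move=> w _; rewrite /= lee_fin (le_trans (fM w))// ler_norm.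
- exact: finite_measure_integrable_cst.
Qed.

Lemma integrable_sumR d' (U : measurableType d') (m : {measure set U -> \bar R})
    (I : Type) (s : seq I) (F : I -> U -> R) :
  (forall i, m.-integrable setT (EFin \o F i)) ->
  m.-integrable setT (EFin \o (fun w => \sum_(i <- s) F i w)).
Proof.
move=> iF; have -> : EFin \o (fun w => \sum_(i <- s) F i w) = (fun w => (\sum_(i <- s) (EFin \o F i) w)%E).
  by apply/funext => w /=; rewrite -sumEFin.
exact: integrable_sum.
Qed.

Lemma integrableZlR d' (U : measurableType d') (m : {measure set U -> \bar R}) (k : R) (f : U -> R) :
  m.-integrable setT (EFin \o f) -> m.-integrable setT (EFin \o (fun w => k * f w)).
Proof. by move=> jf; exact: (integrableZl measurableT _ jf). Qed.

Lemma Rintegral_sum d' (U : measurableType d') (m : {measure set U -> \bar R})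
    (I : Type) (s : seq I) (F : I -> U -> R) :
  (forall i, m.-integrable setT (EFin \o F i)) ->
  \int[m]_w (\sum_(i <- s) F i w) = \sum_(i <- s) \int[m]_w F i w.
Proof.
move=> iF; elim: s => [|i s IH].
  by rewrite big_nil; under eq_Rintegral do rewrite big_nil; rewrite Rintegral_cst// mul0r.
under eq_Rintegral do rewrite big_cons.
rewrite RintegralD//; first by rewrite IH big_cons.
exact: integrable_sumR.
Qed.

Lemma EFin_Rintegral d' (U : measurableType d') (m : {measure set U -> \bar R}) (f : U -> R) :
  m.-integrable setT (EFin \o f) -> (\int[m]_w f w)%:E = (\int[m]_w (f w)%:E)%E.
Proof. by move=> jf; rewrite /Rintegral fineK//; exact: (integrable_fin_num measurableT jf). Qed.

Lemma Rintegral_cstP (c : R) : \int[P]_w c = c.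
Proof.
rewrite /Rintegral.
rewrite (integral_cst P measurableT) -[RHS]/(fine c%:E) -[c%:E in RHS]mule1.
by congr (fine (_ * _)); exact: probability_setT.
Qed.

(** Cauchy-Schwarz in the pointwise form |f| <= s/2 + f^2/(2s), integrated. *)
Lemma Rintegral_norm_le_sqr (f : T -> R) (M s : R) : measurable_fun setT f ->
  (forall w, `|f w| <= M) -> 0 < s -> \int[P]_w (f w ^+ 2) <= s ^+ 2 ->
  \int[P]_w `|f w| <= s.
Proof.
move=> mf fM s0 f2.
have i1 : P.-integrable setT (EFin \o (fun w => `|f w|)).
  apply: (@integrable_boundedP _ M); first exact: measurableT_comp.
  by move=> w; rewrite normr_id.
have i2 : P.-integrable setT (EFin \o (fun w => f w ^+ 2)).
  apply: (@integrable_boundedP _ (M ^+ 2)); first exact: measurable_funX.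
  by move=> w; rewrite normrX lerXn2r// nnegrE (le_trans _ (fM w)).
have i3 : P.-integrable setT (EFin \o (fun w => (2 * s)^-1 * f w ^+ 2)).
  exact: (integrableZl measurableT _ i2).
have i0 : P.-integrable setT (EFin \o (fun=> s / 2)).
  exact: finite_measure_integrable_cst.
have i4 : P.-integrable setT (EFin \o (fun w => s / 2 + (2 * s)^-1 * f w ^+ 2)).
  exact: (integrableD measurableT i0 i3).
apply: (@le_trans _ _ (\int[P]_w (s / 2 + (2 * s)^-1 * f w ^+ 2))).
  apply: le_Rintegral => // w _.
  have h : 0 <= (2 * s)^-1 * (`|f w| - s) ^+ 2.
    by rewrite mulr_ge0 ?sqr_ge0// invr_ge0 mulr_ge0// ltW.
  rewrite -subr_ge0 -(real_normK (num_real (f w))).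
  apply: le_trans h _; rewrite le_eqVlt; apply/orP; left; apply/eqP.
  by field; rewrite gt_eqF.
rewrite RintegralD//.
rewrite Rintegral_cstP RintegralZl//.
apply: (@le_trans _ _ (s / 2 + (2 * s)^-1 * s ^+ 2)).
  by rewrite lerD2l ler_wpM2l// invr_ge0 mulr_ge0// ltW.
by rewrite le_eqVlt; apply/orP; left; apply/eqP; field; rewrite gt_eqF.
Qed.

Lemma expR_lip (x y : R) : 0 <= x -> 0 <= y -> `|expR (- x) - expR (- y)| <= `|x - y|.
Proof.
wlog xy : x y / x <= y => [hw x0 y0|x0 y0].
  have [/hw->//|/ltW/hw] := leP x y.
  by rewrite distrC (distrC y) => ->.
rewrite ger0_norm ?subr_ge0 ?ler_expR ?lerN2// distrC ger0_norm ?subr_ge0//.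
have e1 := expR_ge1Dx (x - y).
have -> : expR (- y) = expR (- x) * expR (x - y).
  by rewrite -expRD; congr expR; lra.
rewrite -[X in X - _]mulr1 -mulrBr -[leRHS]mul1r; apply: ler_pM => //.
- by rewrite subr_ge0 -expR0 ler_expR; lra.
- by rewrite -expR0 ler_expR; lra.
- lra.
Qed.

End Helpers.

Section Weight.
Context {R : realType}.
Notation mu := (@lebesgue_measure R).

(** The weight of the moment formula, extended by 0 so that all integrals in u run over the whole
    line. *)
Definition hwt (p u : R) : R := if 0 < u then u `^ (- (1 + p)) else 0.

Lemma hwt_ge0 p u : 0 <= hwt p u.
Proof. by rewrite /hwt; case: ifP => // _; rewrite powR_ge0. Qed.

Lemma measurable_hwt p : measurable_fun setT (hwt p).
Proof.
have -> : hwt p = (fun u => \1_`]0, +oo[ u * u `^ (- (1 + p))).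
  apply/funext => u; rewrite /hwt indicE; case: ifPn => u0.
    by rewrite mem_set ?mul1r//= in_itv/= u0.
  by rewrite memNset ?mul0r//= in_itv/= andbT; exact/negP.
by apply: measurable_funM; [exact: measurable_indic|exact: measurable_powR].
Qed.

Lemma integral_hwt p (F : R -> R) :
  (\int[mu]_(u in `]0%R, +oo[) (F u * u `^ (- (1 + p)))%:E
   = \int[mu]_u (F u * hwt p u)%:E)%E.
Proof.
rewrite integral_mkcond; apply: eq_integral => u _.
rewrite patchE /hwt; case: ifPn.
  by rewrite inE/= in_itv/= andbT => ->.
by rewrite notin_setE/= in_itv/= andbT => /negP/negbTE ->; rewrite mulr0.
Qed.

Lemma integral_oneBcos_hwt r p x : p + 1 <= r%:R -> 1 < p ->
  (\int[mu]_u ((1 - cos (u * x)) ^+ r * hwt p u)%:E = (`|x| `^ p)%:E * hmass r p)%E.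
Proof. by move=> pr p1; rewrite -integral_hkernel_scale// integral_hwt. Qed.

End Weight.

(** * Absolute moments of centred Gaussian variables *)

Section GaussianVariable.
Context {R : realType} {d : measure_display} {T : measurableType d}.
Variable P : probability T R.
Notation mu := (@lebesgue_measure R).

(* The real part of the characteristic function suffices, since only even functions of [xi] are
   integrated. *)
Definition gaussian_var (xi : T -> R) (v : R) := [/\ measurable_fun setT xi, 0 <= v &
  forall l : R, \int[P]_w cos (l * xi w) = expR (- (l ^+ 2 * v / 2))].

Lemma measurable_cos_comp d' (U : measurableType d') (f : U -> R) :
  measurable_fun setT f -> measurable_fun setT (fun w => cos (f w)).
Proof.
move=> mf; apply: measurableT_comp => //.
by apply: continuous_measurable_fun => x; exact: continuous_cos.
Qed.

Lemma measurable_oneBcosX_comp d' (U : measurableType d') r (f : U -> R) :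
  measurable_fun setT f -> measurable_fun setT (fun w => (1 - cos (f w)) ^+ r).
Proof.
move=> mf; apply: measurable_funX; apply: measurable_funB => //.
exact: measurable_cos_comp.
Qed.

(* The expectation of (1 - cos (u xi))^r for a centred Gaussian [xi] of variance [v]. *)
Definition phiM (v : R) r (u : R) : R :=
  \int[mu]_x ((1 - cos (u * (Num.sqrt v * x))) ^+ r * phi x).

Lemma integrable_phiM v r u :
  mu.-integrable setT (EFin \o (fun x => (1 - cos (u * (Num.sqrt v * x))) ^+ r * phi x)).
Proof.
apply: (@integrable_bounded_phi _ _ (2 ^+ r)).
  by apply: measurable_oneBcosX_comp; do 2 apply: measurable_funM => //.
by move=> x; rewrite ger0_norm; case/andP: (oneBcosX_le2 r (u * (Num.sqrt v * x))).
Qed.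

Lemma integrable_oneBcosX xi r (u : R) : measurable_fun setT xi ->
  P.-integrable setT (EFin \o (fun w => (1 - cos (u * xi w)) ^+ r)).
Proof.
move=> mxi; apply: (@integrable_boundedP _ _ _ P _ (2 ^+ r)).
  by apply: measurable_oneBcosX_comp; exact: measurable_funM.
by move=> w; rewrite ger0_norm; case/andP: (oneBcosX_le2 r (u * xi w)).
Qed.

Lemma phiM_trig (s : seq (R * R)) v r u :
  (forall y, (1 - cos y) ^+ r = \sum_(z <- s) z.1 * cos (z.2 * y)) -> 0 <= v ->
  phiM v r u = \sum_(z <- s) z.1 * expR (- ((z.2 * u) ^+ 2 * v / 2)).
Proof.
move=> hs v0; rewrite /phiM.
have -> : (fun x => (1 - cos (u * (Num.sqrt v * x))) ^+ r * phi x) =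
    (fun x => \sum_(z <- s) z.1 * (cos (z.2 * u * Num.sqrt v * x) * phi x)).
  apply/funext => x; rewrite hs big_distrl/=; apply: eq_bigr => z _.
  by rewrite -mulrA !mulrA.
have jc z : mu.-integrable setT (EFin \o (fun x => cos (z * u * Num.sqrt v * x) * phi x)).
  apply: integrable_bounded_phi (measurable_cosZ _) _ => x; exact: cos_max.
rewrite Rintegral_sum; last by move=> z; exact: integrableZlR.
apply: eq_bigr => z _; rewrite !RintegralZl//; congr (_ * _).
by rewrite phi_char !exprMn sqr_sqrtr// !mulrA.
Qed.

(** Both sides are one trigonometric polynomial evaluated through characteristic functions, that of
    [xi] and that of the density [phi]; the law of [xi] itself is never identified. *)
Lemma gaussian_oneBcosX xi v r (u : R) : gaussian_var xi v ->
  \int[P]_w ((1 - cos (u * xi w)) ^+ r) = phiM v r u.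
Proof.
move=> [mxi v0 cxi]; have [s hs] := oneBcosX_trig (R := R) r.
rewrite (phiM_trig _ hs v0).
under eq_Rintegral => w _ do rewrite hs.
have ic z : P.-integrable setT (EFin \o (fun w => cos (z * (u * xi w)))).
  apply: (@integrable_boundedP _ _ _ P _ 1); last by move=> w; exact: cos_max.
  by apply: measurable_cos_comp; do 2 apply: measurable_funM => //.
rewrite Rintegral_sum; last by move=> z; exact: integrableZlR.
apply: eq_bigr => z _; rewrite !RintegralZl//; congr (_ * _).
under eq_Rintegral do rewrite mulrA.
exact: cxi.
Qed.

Lemma phiM_ge0 v r u : 0 <= phiM v r u.
Proof.
apply: Rintegral_ge0 => // x _; apply: mulr_ge0; last exact: phi_ge0.
by case/andP: (oneBcosX_le2 r (u * (Num.sqrt v * x))).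
Qed.

Lemma phiM_le v r u : 0 <= v -> (0 < r)%N ->
  phiM v r u <= u ^+ 2 ^+ r * (v ^+ r * gaussM (2 * r)%:R).
Proof.
move=> v0 r0.
have p0 : 0 < (2 * r)%:R :> R by rewrite ltr0n muln_gt0.
rewrite /gaussM mulrA -RintegralZl//; last exact: integrable_powR_phi.
apply: le_Rintegral => //; [exact: integrable_phiM|exact: integrableZlR (integrable_powR_phi p0)|].
have key (x : R) : (u * (Num.sqrt v * x)) ^+ 2 ^+ r = u ^+ 2 ^+ r * v ^+ r * `|x| `^ (2 * r)%:R.
  rewrite powR_mulrn// exprM real_normK ?num_real// -!exprMn; congr (_ ^+ r).
  by rewrite exprMn exprMn sqr_sqrtr// mulrA.
move=> x _; rewrite mulrA ler_wpM2r ?phi_ge0// -key; exact: oneBcosX_leX.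
Qed.

Lemma oneBcosX_hwt_ge0 r (p x u : R) : 0 <= (1 - cos (u * x)) ^+ r * hwt p u.
Proof. by rewrite mulr_ge0 ?hwt_ge0//; case/andP: (oneBcosX_le2 r (u * x)). Qed.

Lemma measurable_oneBcosX_hwt d' (U : measurableType d') r p (f : U -> R) : measurable_fun setT f ->
  measurable_fun setT (fun z : U * R => ((1 - cos (z.2 * f z.1)) ^+ r * hwt p z.2)%:E).
Proof.
move=> mf; apply/measurable_EFinP; apply: measurable_funM.
  apply: measurable_oneBcosX_comp; apply: measurable_funM => //.
  exact: measurableT_comp.
by apply: measurableT_comp; [exact: measurable_hwt|].
Qed.

(** Tonelli: integrating in u first gives |sqrt(v) x|^p times [hmass r p], and the integral in x is
    then a Gaussian moment. *)
Lemma integral_phiM_hwt v r p : 0 <= v -> 1 < p -> p + 1 <= r%:R ->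
  (\int[mu]_u (phiM v r u * hwt p u)%:E = (v `^ (p / 2) * gaussM p)%:E * hmass r p)%E.
Proof.
move=> v0 p1 pr; have p0 : 0 < p by lra.
have hfin : hmass r p \is a fin_num.
  by rewrite ge0_fin_numE ?hmass_lty// ltW// hmass_gt0.
transitivity (\int[mu]_u \int[mu]_x ((1 - cos (u * (Num.sqrt v * x))) ^+ r * hwt p u * phi x)%:E)%E.
  apply: eq_integral => u _.
  have -> : (\int[mu]_x ((1 - cos (u * (Num.sqrt v * x))) ^+ r * hwt p u * phi x)%:E =
      (hwt p u)%:E * \int[mu]_x ((1 - cos (u * (Num.sqrt v * x))) ^+ r * phi x)%:E)%E.
    rewrite -integralZl//; last exact: integrable_phiM.
    by apply: eq_integral => x _; rewrite -EFinM mulrAC [in RHS]mulrC.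
  by rewrite -EFin_Rintegral; [rewrite -EFinM mulrC|exact: integrable_phiM].
have := fubini_tonelli (m1 := mu) (m2 := mu) (fun z : R * R => ((1 - cos (z.2 * (Num.sqrt v * z.1))) ^+ r * hwt p z.2 * phi z.1)%:E).
move=> /= <-; last 2 first.
- apply/measurable_EFinP; apply: measurable_funM; last first.
    by apply: measurableT_comp; [exact: measurable_phi|].
  have /measurable_EFinP := @measurable_oneBcosX_hwt _ _ r p (fun x : R => Num.sqrt v * x) (measurable_funM (measurable_cst _) (@measurable_id _ _ _)).
  exact.
- by move=> z; rewrite lee_fin mulr_ge0 ?oneBcosX_hwt_ge0 ?phi_ge0.
transitivity (\int[mu]_x ((v `^ (p / 2))%:E * hmass r p * (`|x| `^ p * phi x)%:E))%E.
  apply: eq_integral => x _.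
  transitivity (\int[mu]_u ((1 - cos (u * (Num.sqrt v * x))) ^+ r * hwt p u)%:E * (phi x)%:E)%E.
    rewrite -ge0_integralZr//.
    - by apply/measurable_EFinP/measurable_funM; [apply: measurable_oneBcosX_comp; exact: measurable_funM|exact: measurable_hwt].
    - by move=> u _; rewrite lee_fin oneBcosX_hwt_ge0.
    - by rewrite lee_fin phi_ge0.
  rewrite integral_oneBcos_hwt// normrM powRM// ger0_norm ?sqrtr_ge0//.
  rewrite -powR12_sqrt// -powRrM (mulrC _ p) EFinM EFinM.
  by rewrite [RHS]muleA -!muleA; congr (_ * _)%E; rewrite muleA [RHS]muleA [(_ * hmass _ _)%E]muleC.
rewrite -[hmass r p]fineK// -EFinM.
rewrite integralZl//; last exact: integrable_powR_phi.
by rewrite integral_gaussM// -!EFinM mulrAC.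
Qed.

(** After multiplication by [hmass r p] both sides are the integral over u of E(1 - cos(u xi))^r
    against the weight. This factor is positive and finite, so it cancels. *)
Lemma gaussian_moment xi v p : gaussian_var xi v -> 1 < p ->
  (\int[P]_w (`|xi w| `^ p)%:E = (v `^ (p / 2) * gaussM p)%:E)%E.
Proof.
move=> g p1; have [mxi v0 cxi] := g; have p0 : 0 < p by lra.
pose r := (Num.truncn (p + 1)).+1.
have pr : p + 1 <= r%:R by apply: ltW; exact: truncnS_gt.
have h0 : (0 < hmass r p)%E by apply: hmass_gt0.
have hfin : hmass r p \is a fin_num.
  by rewrite ge0_fin_numE ?ltW// hmass_lty.
suff : (\int[P]_w (`|xi w| `^ p)%:E * hmass r p = (v `^ (p / 2) * gaussM p)%:E * hmass r p)%E.
  move=> /(congr1 (fun z => z * (fine (hmass r p))^-1%:E)%E).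
  rewrite -!muleA -{1 3}(fineK hfin) -EFinM divff ?mule1//.
  by rewrite gt_eqF// fine_gt0// h0 ltey_eq hfin.
rewrite -ge0_integralZr//; last 2 first.
- apply/measurable_EFinP.
  exact: measurable_norm_powR.
- exact: ltW.
under eq_integral do rewrite -integral_oneBcos_hwt//.
have := fubini_tonelli (m1 := P) (m2 := mu) (fun z : T * R => ((1 - cos (z.2 * xi z.1)) ^+ r * hwt p z.2)%:E).
move=> /= ->; last 2 first.
- exact: measurable_oneBcosX_hwt.
- by move=> z; rewrite lee_fin oneBcosX_hwt_ge0.
rewrite -integral_phiM_hwt//; apply: eq_integral => u _.
have i1 := integrable_oneBcosX r u mxi.
have -> : (\int[P]_w ((1 - cos (u * xi w)) ^+ r * hwt p u)%:E =
    (hwt p u)%:E * \int[P]_w ((1 - cos (u * xi w)) ^+ r)%:E)%E.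
  by rewrite -integralZl//; apply: eq_integral => w _; rewrite -EFinM mulrC.
by rewrite -EFin_Rintegral// (gaussian_oneBcosX r u g) -EFinM mulrC.
Qed.

End GaussianVariable.

(** * A law of large numbers for weakly correlated Gaussian families *)

Section LLN.
Context {R : realType} {d : measure_display} {T : measurableType d}.
Variable P : probability T R.
Notation mu := (@lebesgue_measure R).

(** Only sums and differences of two members are recorded: by 2 cos x cos y = cos(x+y) + cos(x-y)
    they give all covariances of cosines. [c] plays the role of the covariance. *)
Definition gaussian_family (xi : nat -> T -> R) (c : nat -> nat -> R) :=
  (forall k, measurable_fun setT (xi k)) /\
  (forall k l, 0 <= c k k + 2 * c k l + c l l /\ 0 <= c k k - 2 * c k l + c l l) /\
  (forall k l (a : R),
    \int[P]_w cos (a * (xi k w + xi l w)) = expR (- (a ^+ 2 * (c k k + 2 * c k l + c l l) / 2)) /\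
    \int[P]_w cos (a * (xi k w - xi l w)) = expR (- (a ^+ 2 * (c k k - 2 * c k l + c l l) / 2))).

Variables (xi : nat -> T -> R) (c : nat -> nat -> R).
Hypothesis xi_g : gaussian_family xi c.
Hypothesis cxi : forall k, gaussian_var P (xi k) (c k k).

(** Let E1, E2 be the characteristic values of sum and difference, E3, E4 those of the two
    variables. The expectation is (E1 - e^2)/2 + (E2 - e^2)/2 - e(E3 - e) - e(E4 - e), and each
    bracket is small because exp(-x) is 1-Lipschitz on x >= 0. *)
Lemma lln_cov k l (a v e : R) : 0 <= v -> e = expR (- (a ^+ 2 * v / 2)) ->
  \int[P]_w ((cos (a * xi k w) - e) * (cos (a * xi l w) - e))
  <= a ^+ 2 * (`|c k l| + `|c k k - v| + `|c l l - v|).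
Proof.
move=> v0 eE; have [mxi [cpos cc]] := xi_g.
have [p1 p2] := cpos k l; have [c1 c2] := cc k l a.
have mk j : measurable_fun setT (fun w => a * xi j w) by exact: measurable_funM.
have ic (f : T -> R) : measurable_fun setT f -> P.-integrable setT (EFin \o (fun w => cos (f w))).
  move=> mf; apply: (@integrable_boundedP _ _ _ P _ 1); last by move=> w; exact: cos_max.
  exact: measurable_cos_comp.
have i1 := ic _ (measurable_funM (measurable_cst a) (measurable_funD (mxi k) (mxi l))).
have i2 := ic _ (measurable_funM (measurable_cst a) (measurable_funB (mxi k) (mxi l))).
have i3 := ic _ (mk k); have i4 := ic _ (mk l).
pose F (i : nat) w := if i is 0 then 2^-1 * cos (a * (xi k w + xi l w)) else
  if i is 1 then 2^-1 * cos (a * (xi k w - xi l w)) else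
  if i is 2 then - e * cos (a * xi k w) else
  if i is 3 then - e * cos (a * xi l w) else e ^+ 2.
have -> : (fun w => (cos (a * xi k w) - e) * (cos (a * xi l w) - e)) =
   (fun w => \sum_(i <- [:: 0; 1; 2; 3; 4]%N) F i w).
  apply/funext => w; rewrite !big_cons big_nil /F/=.
  by rewrite (mulrDr a) (mulrBr a) cosD cosB; field.
rewrite Rintegral_sum; last first.
  move=> [|[|[|[|i]]]]; rewrite /F/=; try exact: integrableZlR.
  exact: finite_measure_integrable_cst.
rewrite !big_cons big_nil /F/= (Rintegral_cstP P) !RintegralZl// c1 c2 addr0.
have [_ _ ->] := cxi k; have [_ _ ->] := cxi l.
have a2 : 0 <= a ^+ 2 / 2 by rewrite divr_ge0// sqr_ge0.
have [_ vk _] := cxi k; have [_ vl _] := cxi l.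
have e0 : 0 <= e by rewrite eE expR_ge0.
have e1 : e <= 1 by rewrite eE -[leRHS]expR0 ler_expR oppr_le0 mulrAC; exact: mulr_ge0.
(* e^2 belongs to variance 2v, that of the sum of two independent variables of variance v; sum and
   difference are compared with it. *)
have e2 : e ^+ 2 = expR (- (a ^+ 2 / 2 * (2 * v))).
  by rewrite eE expr2 -expRD; congr expR; field.
have H X Y : 0 <= X -> 0 <= Y ->
    `|expR (- (a ^+ 2 * X / 2)) - expR (- (a ^+ 2 * Y / 2))| <= a ^+ 2 * `|X - Y| / 2.
  move=> X0 Y0; apply: le_trans (expR_lip _ _) _.
  - by rewrite mulrAC mulr_ge0.
  - by rewrite mulrAC mulr_ge0.
  rewrite -mulrBl -mulrBr 2!normrM (ger0_norm (sqr_ge0 a)) [`|2^-1|]ger0_norm//.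
have v2 : 0 <= 2 * v by rewrite mulr_ge0.
move: (H _ _ p1 v2) (H _ _ p2 v2) (H _ _ vk v0) (H _ _ vl v0).
have -> : expR (- (a ^+ 2 * (2 * v) / 2)) = e ^+ 2.
  by rewrite e2; congr expR; field.
rewrite -eE.
set E1 := expR _; set E2 := expR _; set E3 := expR _; set E4 := expR _.
set A := a ^+ 2.
have n1 : `|c k k + 2 * c k l + c l l - 2 * v| <= `|c k k - v| + `|c l l - v| + 2 * `|c k l|.
  have := ler_normD (c k k - v + (c l l - v)) (2 * c k l).
  have := ler_normD (c k k - v) (c l l - v).
  rewrite normrM (ger0_norm (_ : 0 <= 2))//.
  by rewrite (_ : c k k - v + (c l l - v) + 2 * c k l = c k k + 2 * c k l + c l l - 2 * v); lra.
have n2 : `|c k k - 2 * c k l + c l l - 2 * v| <= `|c k k - v| + `|c l l - v| + 2 * `|c k l|.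
  have := ler_normB (c k k - v + (c l l - v)) (2 * c k l).
  have := ler_normD (c k k - v) (c l l - v).
  rewrite normrM (ger0_norm (_ : 0 <= 2))//.
  by rewrite (_ : c k k - v + (c l l - v) - 2 * c k l = c k k - 2 * c k l + c l l - 2 * v); lra.
move=> H1 H2 H3 H4.
have A0 : 0 <= A by exact: sqr_ge0.
have M1 := le_trans H1 (ler_wpM2r (_ : 0 <= 2^-1) (ler_wpM2l A0 n1)).
have M2 := le_trans H2 (ler_wpM2r (_ : 0 <= 2^-1) (ler_wpM2l A0 n2)).
have X1 : E1 - e ^+ 2 <= A * (`|c k k - v| + `|c l l - v| + 2 * `|c k l|) / 2.
  by apply: le_trans (ler_norm _) _; apply: M1; rewrite invr_ge0.
have X2 : E2 - e ^+ 2 <= A * (`|c k k - v| + `|c l l - v| + 2 * `|c k l|) / 2.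
  by apply: le_trans (ler_norm _) _; apply: M2; rewrite invr_ge0.
have X3 : - e * (E3 - e) <= A * `|c k k - v| / 2.
  rewrite mulNr; apply: le_trans (ler_norm _) _; rewrite normrN normrM (ger0_norm e0).
  by apply: le_trans H3; rewrite ler_piMl.
have X4 : - e * (E4 - e) <= A * `|c l l - v| / 2.
  rewrite mulNr; apply: le_trans (ler_norm _) _; rewrite normrN normrM (ger0_norm e0).
  by apply: le_trans H4; rewrite ler_piMl.
lra.
Qed.

Variables (N k0 : nat) (v Vm y : R).
Hypotheses (N0 : (0 < N)%N) (k0N : (k0 <= N)%N) (v0 : 0 <= v <= Vm) (y01 : 0 < y <= 1).
Hypothesis cV : forall k, c k k <= Vm.
Hypothesis avg : \sum_(k < N) \sum_(l < N) (`|c k l| + `|c k k - v| + `|c l l - v|)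
  <= N%:R ^+ 2 * y ^+ 4.

Let NR : 0 < N%:R :> R. Proof. by rewrite ltr0n. Qed.

(** Expanding the square and averaging [lln_cov] over pairs bounds the second moment by a^2 y^4;
    [Rintegral_norm_le_sqr] takes the root. The bound [s] is separate from |a| y^2 because it has to
    be positive also for a = 0. *)
Lemma lln_cos (a s : R) : `|a| * y ^+ 2 <= s -> 0 < s ->
  \int[P]_w `|N%:R^-1 * \sum_(k < k0) (cos (a * xi k w) - expR (- (a ^+ 2 * v / 2)))| <= s.
Proof.
move=> as_ s0; have [mxi _] := xi_g; set e := expR _.
have [v00 _] := andP v0.
have mc k : measurable_fun setT (fun w => cos (a * xi k w) - e).
  by apply: measurable_funB => //; apply: measurable_cos_comp; exact: measurable_funM.
have e0 : 0 <= e by exact: expR_ge0.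
have e1 : e <= 1 by rewrite -expR0 ler_expR oppr_le0 mulr_ge0// mulr_ge0 ?sqr_ge0.
have bc k w : `|cos (a * xi k w) - e| <= 2.
  have := cos_max (a * xi k w); rewrite !ler_norml; lra.
apply: (@Rintegral_norm_le_sqr _ _ _ P _ (N%:R^-1 * \sum_(k < k0) 2)) => //.
- by apply: measurable_funM => //; exact: measurable_sum.
- move=> w; rewrite normrM [`|_^-1|]ger0_norm ?invr_ge0// ler_wpM2l ?invr_ge0//.
  by apply: le_trans (ler_norm_sum _ _ _) _; apply: ler_sum.
have ikl k l : P.-integrable setT (EFin \o (fun w => (cos (a * xi k w) - e) * (cos (a * xi l w) - e))).
  apply: (@integrable_boundedP _ _ _ P _ (2 * 2)); first exact: measurable_funM.
  by move=> w; rewrite normrM ler_pM.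
have ik k : P.-integrable setT (EFin \o (fun w => \sum_(l < k0) (cos (a * xi k w) - e) * (cos (a * xi l w) - e))).
  exact: integrable_sumR.
have -> : (fun w => (N%:R^-1 * \sum_(k < k0) (cos (a * xi k w) - e)) ^+ 2) =
  (fun w => N%:R^-1 ^+ 2 * \sum_(k < k0) \sum_(l < k0) (cos (a * xi k w) - e) * (cos (a * xi l w) - e)).
  apply/funext => w; rewrite exprMn; congr (_ * _); rewrite expr2 big_distrl/=.
  by apply: eq_bigr => k _; rewrite big_distrr.
rewrite RintegralZl//; last exact: integrable_sumR.
rewrite Rintegral_sum//.
under eq_bigr do rewrite Rintegral_sum//.
apply: (@le_trans _ _ (N%:R^-1 ^+ 2 * (a ^+ 2 * (N%:R ^+ 2 * y ^+ 4)))).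
  rewrite ler_wpM2l ?sqr_ge0//.
  apply: (@le_trans _ _ (\sum_(k < k0) \sum_(l < k0) a ^+ 2 * (`|c k l| + `|c k k - v| + `|c l l - v|))).
    by apply: ler_sum => k _; apply: ler_sum => l _; exact: lln_cov.
  apply: (@le_trans _ _ (\sum_(k < N) \sum_(l < N) a ^+ 2 * (`|c k l| + `|c k k - v| + `|c l l - v|))).
    (* The terms are nonnegative, so the sum over an initial segment is at most the full sum, to
       which [avg] applies. *)
    have ge0 k l : 0 <= a ^+ 2 * (`|c k l| + `|c k k - v| + `|c l l - v|).
      by rewrite mulr_ge0 ?sqr_ge0// !addr_ge0.
    rewrite (big_ord_widen _ (fun k => \sum_(l < k0) a ^+ 2 * (`|c k l| + `|c k k - v| + `|c l l - v|)) k0N).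
    rewrite big_mkcond/=; apply: ler_sum => k _; case: ifP => _; last by apply: sumr_ge0.
    rewrite (big_ord_widen _ (fun l => a ^+ 2 * (`|c k l| + `|c k k - v| + `|c l l - v|)) k0N).
    by rewrite big_mkcond/=; apply: ler_sum => l _; case: ifP.
  under eq_bigr do rewrite -big_distrr/=.
  by rewrite -big_distrr/= ler_wpM2l ?sqr_ge0.
rewrite (_ : _ * _ = (`|a| * y ^+ 2) ^+ 2); last first.
  by rewrite exprMn real_normK ?num_real//; field; rewrite gt_eqF.
by apply: lerXn2r; rewrite // nnegrE; [rewrite mulr_ge0 ?sqr_ge0|exact: ltW].
Qed.


Let phi_err r u w := N%:R^-1 * \sum_(k < k0) ((1 - cos (u * xi k w)) ^+ r - phiM v r u).

Let mxi k : measurable_fun setT (xi k). Proof. by have [] := xi_g. Qed.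

Let N_mean (f : nat -> R) (M : R) : 0 <= M -> (forall k, f k <= M) ->
  N%:R^-1 * \sum_(k < k0) f k <= M.
Proof.
move=> M0 fM; rewrite ler_pdivrMl//; apply: (@le_trans _ _ (\sum_(k < k0) M)).
  exact: ler_sum.
by rewrite sumr_const card_ord -[leLHS]mulr_natl ler_wpM2r// ler_nat.
Qed.

Let integrable_err r u : P.-integrable setT (EFin \o phi_err r u).
Proof.
apply: integrableZlR; apply: integrable_sumR => k.
have i1 := integrable_oneBcosX P r u (mxi k).
have i2 : P.-integrable setT (EFin \o (fun=> phiM v r u)) by exact: finite_measure_integrable_cst.
exact: (integrableB measurableT i1 i2).
Qed.

(* The error [phi_err] is bounded in two ways: by a power of [u], which is integrable against
   u^(-1-p) at 0, and by a term that is linear in [u] but small with the correlations. *)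
Let err_le_power r u : (0 < r)%N ->
  \int[P]_w `|phi_err r u w| <= u ^+ 2 ^+ r * (2 * (Vm ^+ r * gaussM (2 * r)%:R)).
Proof.
move=> r0; have [v00 vV] := andP v0.
have Vm0 : 0 <= Vm by exact: le_trans vV.
have g0 := gaussM_ge0 (2 * r)%:R : 0 <= gaussM _ :> R.
pose K := u ^+ 2 ^+ r * (Vm ^+ r * gaussM (2 * r)%:R).
have K0 : 0 <= K.
  by apply: mulr_ge0; [exact: exprn_ge0 (sqr_ge0 _)|apply: mulr_ge0 => //; exact: exprn_ge0].
have KV x : 0 <= x <= Vm -> phiM x r u <= K.
  move=> /andP[x0 xV]; apply: le_trans (phiM_le _ x0 r0) _.
  apply: ler_wpM2l; first exact: exprn_ge0 (sqr_ge0 _).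
  by apply: ler_wpM2r => //; apply: lerXn2r; rewrite ?nnegrE.
have i1 k := integrable_oneBcosX P r u (mxi k).
have i2 : P.-integrable setT (EFin \o (fun=> phiM v r u)) by exact: finite_measure_integrable_cst.
have i3 k : P.-integrable setT (EFin \o (fun w => (1 - cos (u * xi k w)) ^+ r + phiM v r u)).
  exact: (integrableD measurableT (i1 k) i2).
apply: (@le_trans _ _ (\int[P]_w (N%:R^-1 * \sum_(k < k0) ((1 - cos (u * xi k w)) ^+ r + phiM v r u)))).
  apply: le_Rintegral => //.
  - exact: (integrable_norm (integrable_err r u)).
  - by apply: integrableZlR; exact: integrable_sumR.
  move=> w _; rewrite normrM [`|_^-1|]ger0_norm ?invr_ge0// ler_wpM2l ?invr_ge0//.
  apply: le_trans (ler_norm_sum _ _ _) _; apply: ler_sum => k _.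
  apply: le_trans (ler_normB _ _) _; rewrite (ger0_norm (phiM_ge0 _ _ _)) [leLHS]addrC.
  by rewrite ger0_norm 1?addrC//; case/andP: (oneBcosX_le2 r (u * xi k w)).
rewrite RintegralZl//; last exact: integrable_sumR.
rewrite Rintegral_sum// (_ : _ * (2 * _) = 2 * K); last by rewrite /K; ring.
apply: (N_mean (f := fun k => \int[P]_w ((1 - cos (u * xi k w)) ^+ r + phiM v r u))).
  by rewrite mulr_ge0.
move=> k; rewrite RintegralD// (Rintegral_cstP P) (gaussian_oneBcosX r u (cxi k)).
rewrite mulr2n mulrDl !mul1r; apply: lerD; apply: KV => //.
by have [_ ck0 _] := cxi k; rewrite ck0 cV.
Qed.

Let err_le_lin (s : seq (R * R)) r (u : R) :
  (forall x, (1 - cos x) ^+ r = \sum_(z <- s) z.1 * cos (z.2 * x)) -> 0 < u ->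
  \int[P]_w `|phi_err r u w| <= u * y ^+ 2 * \sum_(z <- s) `|z.1| * (`|z.2| + 1).
Proof.
move=> hs u0; have [v00 _] := andP v0; have [y0 y1] := andP y01.
pose h (z : R * R) w := N%:R^-1 * \sum_(k < k0) (cos (z.2 * u * xi k w) - expR (- ((z.2 * u) ^+ 2 * v / 2))).
have hE w : phi_err r u w = \sum_(z <- s) z.1 * h z w.
  rewrite /phi_err (phiM_trig _ hs v00).
  under eq_bigr do rewrite hs -sumrB.
  rewrite exchange_big/= big_distrr/=; apply: eq_bigr => z _.
  rewrite /h mulrCA; congr (_ * _); rewrite big_distrr/=; apply: eq_bigr => k _.
  by rewrite mulrBr mulrA.
have ih z : P.-integrable setT (EFin \o h z).
  apply: integrableZlR; apply: integrable_sumR => k.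
  apply: (@integrable_boundedP _ _ _ P _ (1 + expR (- ((z.2 * u) ^+ 2 * v / 2)))).
    by apply: measurable_funB => //; apply: measurable_cos_comp; exact: measurable_funM.
  move=> w; apply: le_trans (ler_normB _ _) _.
  by rewrite [`|expR _|]ger0_norm ?expR_ge0// lerD2r cos_max.
have ihn z : P.-integrable setT (EFin \o (fun w => `|h z w|)).
  exact: (integrable_norm (ih z)).
apply: (@le_trans _ _ (\int[P]_w (\sum_(z <- s) `|z.1| * `|h z w|))).
  apply: le_Rintegral => //.
  - exact: (integrable_norm (integrable_err r u)).
  - by apply: integrable_sumR => z; exact: integrableZlR.
  move=> w _; rewrite hE; apply: le_trans (ler_norm_sum _ _ _) _.
  by apply: ler_sum => z _; rewrite normrM.
rewrite Rintegral_sum; last by move=> z; exact: integrableZlR.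
rewrite big_distrr/=; apply: ler_sum => z _; rewrite RintegralZl//.
(* The 1 in |z.2| + 1 keeps the bound positive at frequency 0, as [lln_cos] demands. *)
rewrite mulrCA ler_wpM2l//; apply: lln_cos.
  rewrite normrM (gtr0_norm u0).
  have -> : u * y ^+ 2 * (`|z.2| + 1) = `|z.2| * u * y ^+ 2 + u * y ^+ 2 by ring.
  by rewrite lerDl mulr_ge0 ?sqr_ge0// ltW.
by rewrite !mulr_gt0 ?exprn_gt0// ltr_wpDl.
Qed.

(** The moment formula is applied pathwise to each [xi k w] and, for the centring constant, to
    [phiM]; after subtraction the absolute value moves under the integral. *)
Let err_repr r p w : 1 < p -> p + 1 <= r%:R ->
  ((fine (hmass r p) * `|N%:R^-1 * (\sum_(k < k0) `|xi k w| `^ p) - k0%:R / N%:R * (v `^ (p / 2) * gaussM p)|)%:E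
  <= \int[mu]_u (`|phi_err r u w| * hwt p u)%:E)%E.
Proof.
move=> p1 pr; have p0 : 0 < p by lra.
have [v00 _] := andP v0.
have hfin : hmass r p \is a fin_num.
  by rewrite ge0_fin_numE ?hmass_lty// ltW// hmass_gt0.
set H := fine (hmass r p).
have H0 : 0 <= H by rewrite fine_ge0// ltW// hmass_gt0.
have mE := integral_phiM_hwt v00 p1 pr.
have mint (f : R -> R) (l : R) : measurable_fun setT f -> (forall u, 0 <= f u) ->
    (\int[mu]_u (f u)%:E = l%:E)%E -> mu.-integrable setT (EFin \o f) /\ \int[mu]_u f u = l.
  move=> mf f0 fl; split; last by rewrite /Rintegral fl.
  apply/integrableP; split; first exact/measurable_EFinP.
  by under eq_integral do rewrite /= ger0_norm//; rewrite fl ltry.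
have [s hs] := oneBcosX_trig (R := R) r.
have mphi : measurable_fun setT (phiM v r).
  have -> : phiM v r = (fun u => \sum_(z <- s) z.1 * expR (- ((z.2 * u) ^+ 2 * v / 2))).
    by apply/funext => u; rewrite (phiM_trig _ hs v00).
  apply: measurable_sum => z; apply: measurable_funM => //; apply: measurableT_comp; first exact: measurable_expR.
  apply: measurableT_comp => //; apply: measurable_funM => //; apply: measurable_funM => //.
  by apply: measurable_funX; exact: measurable_funM.
have [i1 e1] : mu.-integrable setT (EFin \o (fun u => phiM v r u * hwt p u)) /\
    \int[mu]_u (phiM v r u * hwt p u) = v `^ (p / 2) * gaussM p * H.
  apply: mint.
  - by apply: measurable_funM => //; exact: measurable_hwt.
  - by move=> u; rewrite mulr_ge0 ?phiM_ge0 ?hwt_ge0.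
  - by rewrite mE [RHS]EFinM /H fineK.
have {}i2 k : mu.-integrable setT (EFin \o (fun u => (1 - cos (u * xi k w)) ^+ r * hwt p u)) /\
    \int[mu]_u ((1 - cos (u * xi k w)) ^+ r * hwt p u) = `|xi k w| `^ p * H.
  apply: mint.
  - apply: measurable_funM; last exact: measurable_hwt.
    by apply: measurable_oneBcosX_comp; exact: measurable_funM.
  - by move=> u; exact: oneBcosX_hwt_ge0.
  - by rewrite integral_oneBcos_hwt// [RHS]EFinM /H fineK.
have i3 k : mu.-integrable setT (EFin \o (fun u => (1 - cos (u * xi k w)) ^+ r * hwt p u - phiM v r u * hwt p u)).
  exact: (integrableB measurableT (i2 k).1 i1).
have fE : (fun u => phi_err r u w * hwt p u) = (fun u => N%:R^-1 *
    \sum_(k < k0) ((1 - cos (u * xi k w)) ^+ r * hwt p u - phiM v r u * hwt p u)).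
  apply/funext => u; rewrite /phi_err -mulrA; congr (_ * _).
  by rewrite big_distrl/=; apply: eq_bigr => k _; rewrite mulrBl.
have i4 : mu.-integrable setT (EFin \o (fun u => phi_err r u w * hwt p u)).
  by rewrite fE; apply: integrableZlR; exact: integrable_sumR.
have -> : H * `|N%:R^-1 * (\sum_(k < k0) `|xi k w| `^ p) - k0%:R / N%:R * (v `^ (p / 2) * gaussM p)|
   = `| \int[mu]_u (phi_err r u w * hwt p u)|.
  rewrite fE RintegralZl//; last exact: integrable_sumR.
  rewrite Rintegral_sum//.
  under [in RHS]eq_bigr => k _ do rewrite RintegralB ?(i2 k).2 ?e1 ?(i2 k).1//.
  rewrite sumrB sumr_const card_ord -[X in `|_ * (_ - X)|]mulr_natl -big_distrl/=.
  rewrite -[H in LHS](ger0_norm H0) -normrM; congr `|_|; ring.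
apply: (@le_trans _ _ (\int[mu]_u `|phi_err r u w * hwt p u|)%:E).
  by rewrite lee_fin; exact: le_normr_Rintegral.
rewrite EFin_Rintegral; last exact: (integrable_norm i4).
apply: ge0_le_integral => //.
- by apply/measurable_EFinP/measurableT_comp => //; apply/measurable_EFinP; exact: (measurable_int _ i4).
- apply/measurable_EFinP; apply: measurable_funM; last exact: measurable_hwt.
  apply: measurableT_comp => //; apply: measurable_funM => //; apply: measurable_sum => k.
  by apply: measurable_funB => //; apply: measurable_oneBcosX_comp; exact: measurable_funM.
- by move=> u _; rewrite lee_fin normrM [`|hwt _ _|]ger0_norm ?hwt_ge0.
Qed.


(** By Tonelli it suffices to bound the expected error at each u, times the weight, by y times a
    constant and the integrable function [W]. *)
Lemma lln_moment_aux p r (s : seq (R * R)) : 1 < p -> p + 1 <= r%:R ->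
  (forall x, (1 - cos x) ^+ r = \sum_(z <- s) z.1 * cos (z.2 * x)) ->
  (\int[P]_w (fine (hmass r p) *
     `|N%:R^-1 * (\sum_(k < k0) `|xi k w| `^ p) - k0%:R / N%:R * (v `^ (p / 2) * gaussM p)|)%:E
  <= (y * (2 * (Vm ^+ r * gaussM (2 * r)%:R) + \sum_(z <- s) `|z.1| * (`|z.2| + 1)))%:E *
     (1 + \int[mu]_(u in `[1%R, +oo[) (u `^ (- p))%:E))%E.
Proof.
move=> p1 pr hs; have p0 : 0 < p by lra.
have [y0 y1] := andP y01; have [v00 vV] := andP v0.
have r0 : (0 < r)%N by rewrite -(ltr_nat R); lra.
set K := 2 * _; set S := \sum_(z <- s) _.
have S0 : 0 <= S by apply: sumr_ge0 => z _; rewrite mulr_ge0// addr_ge0.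
have K0 : 0 <= K.
  by rewrite mulr_ge0// mulr_ge0 ?gaussM_ge0// exprn_ge0// (le_trans v00).
pose W (u : R) := if 0 < u then (if u <= 1 then 1 else u `^ (- p)) else 0 : R.
have W0 u : 0 <= W u by rewrite /W; case: ifP => // _; case: ifP => // _; exact: powR_ge0.
have key u : \int[P]_w `|phi_err r u w| * hwt p u <= y * (K + S) * W u.
  rewrite /W /hwt; case: (ltrP 0 u) => u0; last by rewrite !mulr0.
  have l1 := err_le_power u r0; have l2 := err_le_lin hs u0.
  rewrite -/K -/S in l1 l2.
  case: (lerP u 1) => u1; last first.
    apply: (@le_trans _ _ (u * y ^+ 2 * S * u `^ (- (1 + p)))).
      by rewrite ler_wpM2r ?powR_ge0.
    rewrite opprD powRD; last by rewrite (gt_eqF u0) implybT.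
    rewrite powRN powRr1 ?(ltW u0)//.
    have -> : u * y ^+ 2 * S * (u^-1 * u `^ (- p)) = y ^+ 2 * S * u `^ (- p).
      by field; rewrite gt_eqF.
    rewrite ler_wpM2r ?powR_ge0// expr2 -mulrA ler_wpM2l ?(ltW y0)//.
    by apply: (@le_trans _ _ S); [rewrite ler_piMl|rewrite lerDr].
  rewrite mulr1.
  have ur : u ^+ r * u `^ (- (1 + p)) <= 1.
    rewrite -powR_mulrn ?(ltW u0)// -powRD; last by rewrite (gt_eqF u0) implybT.
    rewrite -[leRHS](powRr0 u); apply: ger_powR; first by rewrite u0.
    lra.
  have ur0 : 0 <= u ^+ r by rewrite exprn_ge0// ltW.
  have wt0 : 0 <= u `^ (- (1 + p)) by exact: powR_ge0.
  apply: (@le_trans _ _ (y * (K + S) * (u ^+ r * u `^ (- (1 + p))))); last first.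
    by rewrite ler_piMr// mulr_ge0 ?(ltW y0)// addr_ge0.
  rewrite mulrA ler_wpM2r//.
  (* For u <= 1 the two bounds are balanced at u^r = y: below it u^(2r) <= y u^r, above it u y^2 <=
     y u^r. Either way one factor y comes out, and u^r tames the weight since r >= p + 1. *)
  have [ury|ury] := leP (u ^+ r) y.
    apply: (le_trans l1); rewrite -exprM mulnC exprM expr2.
    rewrite mulrDr mulrDl; apply: (@le_trans _ _ (y * K * u ^+ r)); last first.
      by rewrite lerDl !mulr_ge0// ltW.
    have -> : y * K * u ^+ r = y * (u ^+ r * K) by ring.
    by rewrite -mulrA ler_wpM2r// mulr_ge0.
  apply: (le_trans l2).
  rewrite mulrDr mulrDl; apply: (@le_trans _ _ (y * S * u ^+ r)); last first.
    rewrite lerDr; apply: mulr_ge0 => //; apply: mulr_ge0 => //; exact: ltW.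
  have -> : u * y ^+ 2 * S = y * S * (u * y) by ring.
  rewrite ler_wpM2l ?mulr_ge0 ?(ltW y0)//.
  by apply: le_trans (ltW ury); rewrite ler_piMl// ltW.
have merr : measurable_fun setT (fun z : T * R => (`|phi_err r z.2 z.1| * hwt p z.2)%:E).
  apply/measurable_EFinP; apply: measurable_funM.
    apply: measurableT_comp => //; apply: measurable_funM => //; apply: measurable_sum => k.
    apply: measurable_funB.
      by apply: measurable_oneBcosX_comp; apply: measurable_funM => //; exact: measurableT_comp.
    have -> : (fun z : T * R => phiM v r z.2) = (fun z => \sum_(t <- s) t.1 * expR (- ((t.2 * z.2) ^+ 2 * v / 2))).
      by apply/funext => z; rewrite (phiM_trig _ hs v00).
    apply: measurable_sum => t; apply: measurable_funM => //; apply: measurableT_comp; first exact: measurable_expR.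
    apply: measurableT_comp => //; apply: measurable_funM => //; apply: measurable_funM => //.
    by apply: measurable_funX; exact: measurable_funM.
  by apply: measurableT_comp; [exact: measurable_hwt|].
have err0 (z : T * R) : (0 <= (`|phi_err r z.2 z.1| * hwt p z.2)%:E)%E.
  by rewrite lee_fin mulr_ge0 ?hwt_ge0.
apply: (@le_trans _ _ (\int[P]_w \int[mu]_u (`|phi_err r u w| * hwt p u)%:E)%E).
  apply: ge0_le_integral => //.
  - by move=> w _; rewrite lee_fin mulr_ge0// fine_ge0// ltW// hmass_gt0.
  - apply/measurable_EFinP; apply: measurable_funM => //; apply: measurableT_comp => //.
    apply: measurable_funB => //; apply: measurable_funM => //; apply: measurable_sum => k.
    exact: measurable_norm_powR.
  - exact: (measurable_fun_fubini_tonelli_F (m2 := mu) _ merr err0).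
  - by move=> w _; exact: err_repr.
have := fubini_tonelli (m1 := P) (m2 := mu) _ merr err0; move=> /= ->.
have hE u : (\int[P]_w (`|phi_err r u w| * hwt p u)%:E = (\int[P]_w `|phi_err r u w| * hwt p u)%:E)%E.
  have i1 : P.-integrable setT (EFin \o (fun w => `|phi_err r u w|)).
    exact: (integrable_norm (integrable_err r u)).
  rewrite EFinM EFin_Rintegral// -integralZr//.
have mW : measurable_fun setT (fun u : R => \1_`]0, 1] u + \1_`[1, +oo[ u * u `^ (- p)).
  apply: measurable_funD; first exact: measurable_indic.
  by apply: measurable_funM; [exact: measurable_indic|exact: measurable_powR].
have I0 (A : set R) u : 0 <= \1_A u :> R by rewrite indicE.
apply: (@le_trans _ _ (\int[mu]_u ((y * (K + S))%:E * (\1_`]0%R, 1%R] u + \1_`[1%R, +oo[ u * u `^ (- p))%:E))%E).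
  apply: ge0_le_integral => //.
  - by move=> u _; apply: integral_ge0 => w _; exact: (err0 (w, u)).
  - exact: (measurable_fun_fubini_tonelli_G (m1 := P) _ merr err0).
  - by apply: emeasurable_funM => //; exact/measurable_EFinP.
  move=> u _; rewrite hE -EFinM lee_fin; apply: le_trans (key u) _.
  rewrite ler_wpM2l ?mulr_ge0 ?addr_ge0 ?(ltW y0)// /W.
  case: (ltrP 0 u) => u0; last by rewrite addr_ge0 ?mulr_ge0 ?powR_ge0.
  case: (lerP u 1) => u1.
    rewrite [X in X + _]indicE mem_set /=; last by rewrite in_itv/= u0.
    by rewrite lerDl mulr_ge0 ?powR_ge0.
  rewrite [X in X * _]indicE mem_set /=; last by rewrite in_itv/= andbT ltW.
  by rewrite mul1r lerDr.
rewrite ge0_integralZl//; last 3 first.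
- exact/measurable_EFinP.
- by move=> u _; rewrite lee_fin addr_ge0 ?mulr_ge0 ?powR_ge0.
- by rewrite lee_fin mulr_ge0 ?addr_ge0// ltW.
rewrite lee_pmul//.
- by rewrite lee_fin mulr_ge0 ?addr_ge0// ltW.
- by apply: integral_ge0 => u _; rewrite lee_fin addr_ge0 ?mulr_ge0 ?powR_ge0.
under eq_integral do rewrite EFinD.
rewrite ge0_integralD//; last 3 first.
- by apply/measurable_EFinP; exact: measurable_indic.
- by move=> u _; rewrite lee_fin mulr_ge0 ?powR_ge0.
- by apply/measurable_EFinP/measurable_funM; [exact: measurable_indic|exact: measurable_powR].
apply: leeD.
  by rewrite integral_indic//= setIT lebesgue_measure_itv/= lte01 oppr0 adde0.
rewrite [leRHS]integral_mkcond le_eqVlt; apply/orP; left; apply/eqP; apply: eq_integral => u _.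
by rewrite patchE indicE; case: ifPn => _; rewrite ?mul1r ?mul0r.
Qed.

End LLN.

Section LLNMoment.
Context {R : realType} {d : measure_display} {T : measurableType d}.
Variable P : probability T R.

(** The point is uniformity: the constant depends on [p] and [Vm] alone, so one [C] serves the
    families of all orders n. *)
Lemma lln_moment (p Vm : R) : 1 < p -> 0 <= Vm -> exists2 C : R, 0 <= C &
  forall (xi : nat -> T -> R) (c : nat -> nat -> R) (N k0 : nat) (v y : R),
  gaussian_family P xi c -> (forall k, gaussian_var P (xi k) (c k k)) ->
  (0 < N)%N -> (k0 <= N)%N -> 0 <= v <= Vm -> 0 < y <= 1 -> (forall k, c k k <= Vm) ->
  \sum_(k < N) \sum_(l < N) (`|c k l| + `|c k k - v| + `|c l l - v|) <= N%:R ^+ 2 * y ^+ 4 ->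
  (\int[P]_w (`|N%:R^-1 * (\sum_(k < k0) `|xi k w| `^ p)
      - k0%:R / N%:R * (v `^ (p / 2) * gaussM p)|)%:E <= (C * y)%:E)%E.
Proof.
move=> p1 Vm0; have p0 : 0 < p by lra.
pose r := (Num.truncn (p + 1)).+1.
have pr : p + 1 <= r%:R by apply: ltW; exact: truncnS_gt.
have h0 : (0 < hmass r p)%E by apply: hmass_gt0.
have hfin : hmass r p \is a fin_num.
  by rewrite ge0_fin_numE ?ltW// hmass_lty.
have H0 : 0 < fine (hmass r p) by rewrite fine_gt0// h0 ltey_eq hfin.
have [s hs] := oneBcosX_trig (R := R) r.
set I := (\int[@lebesgue_measure R]_(u in `[1%R, +oo[) (u `^ (- p))%:E)%E.
have I0 : (0 <= I)%E by apply: integral_ge0 => u _; rewrite lee_fin powR_ge0.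
have Ifin : I \is a fin_num by rewrite ge0_fin_numE// integral_powRN_lty.
set D := 2 * (Vm ^+ r * gaussM (2 * r)%:R) + \sum_(z <- s) `|z.1| * (`|z.2| + 1).
have D0 : 0 <= D.
  apply: addr_ge0; last by apply: sumr_ge0 => z _; rewrite mulr_ge0// addr_ge0.
  by rewrite mulr_ge0// mulr_ge0 ?gaussM_ge0// exprn_ge0.
exists (D * (1 + fine I) / fine (hmass r p)).
  by rewrite divr_ge0 ?(ltW H0)// mulr_ge0// addr_ge0// fine_ge0.
move=> xi c N k0 v y g cxi N0 k0N v0 y01 cV avg.
have [mxi _] := g.
have h := lln_moment_aux g cxi N0 k0N v0 y01 cV avg p1 pr hs.
rewrite -/I -/D -(fineK Ifin) -EFinD -EFinM in h.
pose f w := `|N%:R^-1 * (\sum_(k < k0) `|xi k w| `^ p) - k0%:R / N%:R * (v `^ (p / 2) * gaussM p)|.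
rewrite -[X in (X <= _)%E]/(\int[P]_w (f w)%:E)%E.
have mf : measurable_fun setT f.
  apply: measurableT_comp => //.
  apply: measurable_funB => //; apply: measurable_funM => //; apply: measurable_sum => k.
  exact: measurable_norm_powR.
have -> : (\int[P]_w (f w)%:E = (fine (hmass r p))^-1%:E * \int[P]_w (fine (hmass r p) * f w)%:E)%E.
  rewrite -ge0_integralZl//.
  - by apply: eq_integral => w _; rewrite -EFinM mulrA mulVf ?mul1r// gt_eqF.
  - by apply/measurable_EFinP; exact: measurable_funM.
  - by move=> w _; rewrite lee_fin mulr_ge0// ?normr_ge0// ltW.
  - by rewrite lee_fin invr_ge0 ltW.
apply: le_trans (lee_pmul _ _ (lexx _) h) _.
- by rewrite lee_fin invr_ge0 ltW.
- by apply: integral_ge0 => w _; rewrite lee_fin mulr_ge0// ?normr_ge0// ltW.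
by rewrite -EFinM lee_fin le_eqVlt; apply/orP; left; apply/eqP; field; rewrite gt_eqF.
Qed.

(* Summability of the integrals makes the sum of the series finite almost everywhere. *)
Lemma ae_cvg0_geometric (f : nat -> T -> R) (C rho : R) :
  (forall n, measurable_fun setT (f n)) -> (forall n w, 0 <= f n w) ->
  0 <= rho < 1 -> (forall n, (\int[P]_w (f n w)%:E <= (C * rho ^+ n)%:E)%E) ->
  {ae P, forall w, (fun n => f n w) @ \oo --> (0 : R)}.
Proof.
move=> mf f0 /andP[rho0 rho1] fC.
have mEf n : measurable_fun setT (EFin \o f n) by exact/measurable_EFinP.
have ef0 n w : (0 <= (f n w)%:E)%E by rewrite lee_fin.
pose F w := (\sum_(0 <= n <oo) (f n w)%:E)%E.
have C0 : 0 <= C.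
  have : (0 <= \int[P]_w (f 0 w)%:E)%E by exact: integral_ge0.
  by move=> /le_trans /(_ (fC 0%N)); rewrite lee_fin expr0 mulr1.
have iF : P.-integrable setT F.
  apply/integrableP; split.
    exact: (@ge0_emeasurable_sum _ _ _ setT (fun n w => (f n w)%:E) xpredT (fun k w _ _ => ef0 k w) (fun k _ => mEf k)).
  under eq_integral => w _ do rewrite gee0_abs ?nneseries_ge0//.
  rewrite integral_nneseries//.
  apply: (@le_lt_trans _ _ (C / (1 - rho))%:E); last by rewrite ltry.
  apply: lime_le.
    by apply: is_cvg_nneseries => n _ _; apply: integral_ge0.
  near=> n.
  apply: (@le_trans _ _ (\sum_(0 <= i < n) (C * rho ^+ i)%:E)%E).
    exact: lee_sum.
  rewrite sumEFin lee_fin -big_distrr/= ler_wpM2l// big_mkord.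
  by apply: sum_geo_le; rewrite rho0.
have := integrable_ae measurableT iF; apply: filterS => w /(_ I) Fw.
have cF : cvgn (fun n => \sum_(0 <= i < n) f i w).
  apply: nondecreasing_is_cvgn.
    by apply/nondecreasing_seqP => n; rewrite big_nat_recr//= lerDl.
  exists (fine (F w)) => _ [n _ <-].
  rewrite -lee_fin fineK// -sumEFin.
  by apply: nneseries_lim_ge.
exact: (cvg_series_cvg_0 cF).
Unshelve. all: by end_near. Qed.

End LLNMoment.

(** * Linear forms of a fractional Brownian motion *)

Section LinearForms.
Context {R : realType}.
Implicit Types l : seq (R * R).

(* A list of pairs (coefficient, time) stands for a finite linear combination of values of the
   process. *)
Definition lscale (a : R) l : seq (R * R) := [seq (a * x.1, x.2) | x <- l].

Definition lform T (W : R -> T -> R) l (w : T) : R := \sum_(x <- l) x.1 * W x.2 w.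

Definition lcov (H : R) l l' : R :=
  \sum_(x <- l) \sum_(y <- l') x.1 * y.1 * fcov H x.2 y.2.

Lemma fcovC (H s t : R) : fcov H s t = fcov H t s.
Proof. by rewrite /fcov distrC (addrC (s `^ _)). Qed.

Lemma lformZ T (W : R -> T -> R) a l w : lform W (lscale a l) w = a * lform W l w.
Proof.
by rewrite /lform /lscale big_map big_distrr/=; apply: eq_bigr => x _; rewrite mulrA.
Qed.

Lemma lform_cat T (W : R -> T -> R) l l' w :
  lform W (l ++ l') w = lform W l w + lform W l' w.
Proof. by rewrite /lform big_cat. Qed.

Lemma lform_flatten T (W : R -> T -> R) I (s : seq I) (F : I -> seq (R * R)) w :
  lform W (flatten [seq F i | i <- s]) w = \sum_(i <- s) lform W (F i) w.
Proof.
by elim: s => [|i s IH]; rewrite ?big_nil ?big_cons /= /lform ?big_nil// big_cat/= -IH.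
Qed.

Lemma lcovC H l l' : lcov H l l' = lcov H l' l.
Proof.
rewrite /lcov exchange_big/=; apply: eq_bigr => x _; apply: eq_bigr => y _.
by rewrite fcovC (mulrC y.1).
Qed.

Lemma lcov_catl H l1 l2 l : lcov H (l1 ++ l2) l = lcov H l1 l + lcov H l2 l.
Proof. by rewrite /lcov big_cat. Qed.

Lemma lcov_catr H l1 l2 l : lcov H l (l1 ++ l2) = lcov H l l1 + lcov H l l2.
Proof. by rewrite lcovC lcov_catl !(lcovC _ l). Qed.

Lemma lcovZl H a l l' : lcov H (lscale a l) l' = a * lcov H l l'.
Proof.
rewrite /lcov /lscale big_map big_distrr/=; apply: eq_bigr => x _.
by rewrite big_distrr/=; apply: eq_bigr => y _; rewrite !mulrA.
Qed.

Lemma lcovZr H a l l' : lcov H l (lscale a l') = a * lcov H l l'.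
Proof. by rewrite lcovC lcovZl lcovC. Qed.

Lemma lcov_flattenl H I (s : seq I) (F : I -> seq (R * R)) l :
  lcov H (flatten [seq F i | i <- s]) l = \sum_(i <- s) lcov H (F i) l.
Proof.
elim: s => [|i s IH]; rewrite ?big_nil ?big_cons /=; first by rewrite /lcov big_nil.
by rewrite lcov_catl IH.
Qed.

Lemma lcov_flattenr H I (s : seq I) (F : I -> seq (R * R)) l :
  lcov H l (flatten [seq F i | i <- s]) = \sum_(i <- s) lcov H l (F i).
Proof. by rewrite lcovC lcov_flattenl; apply: eq_bigr => i _; rewrite lcovC. Qed.

Definition nonneg_times l := all (fun x => 0 <= x.2) l.

Lemma nonneg_times_cat l l' :
  nonneg_times (l ++ l') = nonneg_times l && nonneg_times l'.
Proof. exact: all_cat. Qed.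

Lemma nonneg_timesZ a l : nonneg_times (lscale a l) = nonneg_times l.
Proof. by rewrite /nonneg_times /lscale all_map. Qed.

Lemma nonneg_times_flatten I (s : seq I) (F : I -> seq (R * R)) :
  (forall i, nonneg_times (F i)) -> nonneg_times (flatten [seq F i | i <- s]).
Proof. by move=> h; elim: s => //= i s IH; rewrite nonneg_times_cat h. Qed.

(** The quadratic is evaluated at its minimiser -y/z. If z = 0 it is affine in a, and for y != 0 the
    chosen a gives it the value -1. *)
Lemma discriminant_le (x y z : R) : 0 <= x -> 0 <= z ->
  (forall a, 0 <= x + 2 * a * y + a ^+ 2 * z) -> y ^+ 2 <= x * z.
Proof.
move=> x0 z0 h; have [z_eq0|zn0] := eqVneq z 0.
  have [->|yn0] := eqVneq y 0; first by rewrite expr0n/= z_eq0 mulr0.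
  have := h (- (x + 1) / (2 * y)).
  rewrite z_eq0 mulr0 addr0 (_ : 2 * _ * y = - (x + 1)); last by field.
  by lra.
have zp : 0 < z by rewrite lt_neqAle eq_sym zn0.
have := h (- y / z); rewrite -(pmulr_lge0 _ zp).
have -> : (x + 2 * (- y / z) * y + (- y / z) ^+ 2 * z) * z = x * z - y ^+ 2 by field.
by rewrite subr_ge0.
Qed.

End LinearForms.

Arguments lscale : simpl never.

Section FBM.
Context {R : realType} {d : measure_display} {T : measurableType d}.
Variables (P : probability T R) (H : R) (W : R -> T -> R).
Hypothesis fbmW : is_fBm P H W.
Implicit Types l : seq (R * R).

Lemma measurable_lform l : measurable_fun setT (lform W l).
Proof.
have [mW _] := fbmW; rewrite /lform; apply: measurable_sum => x.
exact: measurable_funM.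
Qed.

Lemma lform_char l (a : R) : nonneg_times l ->
  \int[P]_w cos (a * lform W l w) = expR (- (a ^+ 2 * lcov H l l / 2)).
Proof.
move=> l0; have [_ [_ hW]] := fbmW.
pose s i := (nth (0, 0) l i).2; pose c i := a * (nth (0, 0) l i).1.
have s0 (i : 'I_(size l)) : 0 <= s i.
  by have /allP := l0; apply; exact: mem_nth.
have [hc _] := hW (size l) (fun i => c i) (fun i => s i) s0.
have -> : (fun w => cos (a * lform W l w)) =
    (fun w => cos (\sum_(i < size l) c i * W (s i) w)).
  apply/funext => w; congr cos; rewrite /lform (big_nth (0, 0)) big_mkord big_distrr/=.
  by apply: eq_bigr => i _; rewrite mulrA.
move: hc; rewrite unlock => hc; rewrite /Rintegral hc/=; congr expR.
rewrite -mulNr; congr (- _ / 2).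
rewrite /lcov (big_nth (0, 0)) big_mkord big_distrr/=; apply: eq_bigr => i _.
rewrite (big_nth (0, 0)) big_mkord big_distrr/=; apply: eq_bigr => j _.
rewrite /c /s; ring.
Qed.

(** As cos <= 1, the characteristic value exp(-Var/2) is at most 1. Positive semidefiniteness of
    [fcov] is thus read off from the existence of the process instead of being proved
    analytically. *)
Lemma lcov_ge0 l : nonneg_times l -> 0 <= lcov H l l.
Proof.
move=> l0; have := lform_char 1 l0; rewrite expr1n mul1r => h.
have : expR (- (lcov H l l / 2)) <= 1.
  rewrite -h -(Rintegral_cstP P 1); apply: le_Rintegral => //.
  - apply: (@integrable_boundedP _ _ _ P _ 1); last by move=> w; exact: cos_max.
    by apply: measurable_cos_comp; apply: measurable_funM => //; exact: measurable_lform.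
  - exact: finite_measure_integrable_cst.
rewrite -[leRHS]expR0 ler_expR; lra.
Qed.

Lemma gaussian_lform l : nonneg_times l -> gaussian_var P (lform W l) (lcov H l l).
Proof.
by move=> l0; split; [exact: measurable_lform|exact: lcov_ge0|move=> a; exact: lform_char].
Qed.

Lemma gaussian_family_lform (ls : nat -> seq (R * R)) :
  (forall k, nonneg_times (ls k)) ->
  gaussian_family P (fun k => lform W (ls k)) (fun k j => lcov H (ls k) (ls j)).
Proof.
move=> l0; split; first by move=> k; exact: measurable_lform.
have p0 k j e : nonneg_times (ls k ++ lscale e (ls j)).
  by rewrite nonneg_times_cat nonneg_timesZ !l0.
have pE k j e : e ^+ 2 = 1 -> lcov H (ls k ++ lscale e (ls j)) (ls k ++ lscale e (ls j))
    = lcov H (ls k) (ls k) + 2 * e * lcov H (ls k) (ls j) + lcov H (ls j) (ls j).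
  move=> e1; rewrite lcov_catl !lcov_catr !lcovZl !lcovZr (lcovC _ (ls j) (ls k)).
  rewrite [e * (e * _)]mulrA -expr2 e1; ring.
have e1 : (1 : R) ^+ 2 = 1 by rewrite expr1n.
have eN1 : (-1 : R) ^+ 2 = 1 by rewrite sqrrN expr1n.
split=> k j.
  have := lcov_ge0 (p0 k j 1); have := lcov_ge0 (p0 k j (-1)).
  by rewrite !pE// !mulr1 mulrN1 mulNr.
move=> a; split.
  have := lform_char a (p0 k j 1); rewrite pE// mulr1 => <-; congr (Rintegral _ _ _).
  by apply/funext => w; rewrite lform_cat lformZ mul1r.
have := lform_char a (p0 k j (-1)); rewrite pE// mulrN1 mulNr => <-; congr (Rintegral _ _ _).
by apply/funext => w; rewrite lform_cat lformZ mulN1r.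
Qed.

Lemma lcov_CauchySchwarz l l' : nonneg_times l -> nonneg_times l' ->
  lcov H l l' ^+ 2 <= lcov H l l * lcov H l' l'.
Proof.
move=> l0 l0'; apply: discriminant_le; try exact: lcov_ge0.
move=> a; have := @lcov_ge0 (l ++ lscale a l'); rewrite nonneg_times_cat nonneg_timesZ l0 l0'.
move=> /(_ isT); rewrite lcov_catl !lcov_catr !lcovZl !lcovZr (lcovC _ l' l).
by congr (0 <= _); ring.
Qed.

(** The variance at time 0 is 0, hence so is the second moment; [ae_cvg0_geometric], applied to a
    constant sequence, turns this into almost sure vanishing. *)
Lemma fbm0_ae : 0 < H -> {ae P, forall w, W 0 w = 0}.
Proof.
move=> H0; pose l := [:: (1 : R, 0 : R)].
have l0 : nonneg_times l by rewrite /nonneg_times/= lexx.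
have v0 : lcov H l l = 0.
  rewrite /lcov !big_cons !big_nil /fcov/= subrr normr0 powR0 ?mulf_neq0 ?gt_eqF//.
  by rewrite !addr0 subrr mul0r mulr0.
have lE w : lform W l w = W 0 w by rewrite /lform big_cons big_nil mul1r addr0.
have [mW _] := fbmW.
have := @ae_cvg0_geometric _ _ _ P (fun _ w => `|W 0 w| `^ 2) 0 0.
have pm : measurable_fun setT (fun w => `|W 0 w| `^ 2).
  exact: measurable_norm_powR.
move=> /(_ (fun=> pm) (fun _ w => powR_ge0 _ _)).
rewrite lexx ltr01 => /(_ isT) h.
have {}h := h _.
have : {ae P, forall w, (fun n : nat => `|W 0 w| `^ 2) @ \oo --> (0 : R)}.
  apply: h => n; have := gaussian_moment (gaussian_lform l0) (ltac:(lra) : (1 : R) < 2).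
  rewrite v0 powR0 ?mul0r; last by rewrite mulf_neq0.
  by under eq_integral do rewrite lE; move=> ->; rewrite ?mul0r.
apply: filterS => w /(cvg_unique (@norm_hausdorff _ _) (cvg_cst _)) /eqP.
by rewrite powR_eq0 normr_eq0 => /andP[/eqP].
Qed.

End FBM.

(** * Correlations of b-adic increments *)

Section Increments.
Context {R : realType}.
Variable H : R.
Hypothesis H01 : 0 < H < 1.

Definition linc (s t : R) : seq (R * R) := [:: (1, t); (-1, s)].

Lemma lform_linc T (W : R -> T -> R) s t w : lform W (linc s t) w = W t w - W s w.
Proof. by rewrite /lform !big_cons big_nil/= addr0 mul1r mulN1r. Qed.

Lemma nonneg_times_linc s t : 0 <= s -> 0 <= t -> nonneg_times (linc s t).
Proof. by rewrite /nonneg_times/= => -> ->. Qed.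

Lemma lcov_linc a b c e : lcov H (linc a b) (linc c e) =
  (`|e - a| `^ (2 * H) + `|c - b| `^ (2 * H)
   - `|e - b| `^ (2 * H) - `|c - a| `^ (2 * H)) / 2.
Proof. by rewrite /lcov !big_cons !big_nil /fcov/=; field. Qed.

Lemma lcov_linc_self a b : a <= b -> lcov H (linc a b) (linc a b) = (b - a) `^ (2 * H).
Proof.
have [H0 _] := andP H01 => ab; rewrite lcov_linc (distrC a) !subrr normr0 powR0.
  by rewrite !subr0 ger0_norm ?subr_ge0//; field.
by rewrite mulf_neq0// gt_eqF.
Qed.

(** The covariance is half a second difference of x^(2H), and |2H(2H - 1)|/2 <= 1 removes the
    constant. *)
Lemma lcov_linc_gap (x s u l : R) : 0 <= s -> 0 <= l -> 0 < u ->
  `|lcov H (linc x (x + s)) (linc (x + s + u) (x + s + u + l))| <= s * l * u `^ (2 * H - 2).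
Proof.
have [H0 H1] := andP H01 => s0 l0 u0; rewrite lcov_linc.
have -> : x + s + u + l - x = u + s + l by ring.
have -> : x + s + u - (x + s) = u by ring.
have -> : x + s + u + l - (x + s) = u + l by ring.
have -> : x + s + u - x = u + s by ring.
have ul := addr_ge0 (ltW u0) l0; have us := addr_ge0 (ltW u0) s0.
rewrite (ger0_norm (addr_ge0 us l0)) (ger0_norm (ltW u0)) (ger0_norm ul) (ger0_norm us).
have h : `|(u + s + l) `^ (2 * H) - (u + s) `^ (2 * H) - (u + l) `^ (2 * H) + u `^ (2 * H)| <=
   `|2 * H * (2 * H - 1)| * s * l * u `^ (2 * H - 2) by apply: powR_diff2_le => //; lra.
have -> : (u + s + l) `^ (2 * H) + u `^ (2 * H) - (u + l) `^ (2 * H) - (u + s) `^ (2 * H) =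
  (u + s + l) `^ (2 * H) - (u + s) `^ (2 * H) - (u + l) `^ (2 * H) + u `^ (2 * H) by ring.
rewrite normrM [`|2^-1|]ger0_norm// ler_pdivrMr//; apply: (le_trans h).
have HH : `|2 * H * (2 * H - 1)| <= 2 by rewrite ler_norml; apply/andP; split; nra.
have K0 : 0 <= s * l * u `^ (2 * H - 2) by rewrite !mulr_ge0 ?powR_ge0.
have := ler_wpM2r K0 HH; rewrite !mulrA; lra.
Qed.

(** Left ends at distance (A + 1) l leave a gap of at least A l, both lengths being at most l. Then
    s l (A l)^(2H-2) <= A^(2H-2) s^H l^H because s^(1-H) <= l^(1-H); after normalisation the bound
    no longer depends on the lengths. *)
Lemma lcov_linc_far (x y s l A : R) : 0 < s <= l -> 0 < A -> (A + 1) * l <= `|x - y| ->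
  `|lcov H (linc x (x + s)) (linc y (y + l))| <= A `^ (2 * H - 2) * (s `^ H * l `^ H).
Proof.
have [H0 H1] := andP H01 => /andP[s0 sl] A0 far.
have l0 : 0 < l by exact: lt_le_trans sl.
have key u : A * l <= u -> s * l * u `^ (2 * H - 2) <= A `^ (2 * H - 2) * (s `^ H * l `^ H).
  move=> uA; have Al0 : 0 < A * l by exact: mulr_gt0.
  apply: (@le_trans _ _ (s * l * (A * l) `^ (2 * H - 2))).
    apply: ler_wpM2l; first by rewrite mulr_ge0 ?ltW.
    have -> : 2 * H - 2 = - (2 - 2 * H) by ring.
    rewrite !powRN lef_pV2 ?posrE ?powR_gt0 ?(lt_le_trans Al0)//.
    have e0 : 0 <= 2 - 2 * H by lra.
    by apply: (ge0_ler_powR e0); rewrite // nnegrE ltW// (lt_le_trans Al0).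
  rewrite powRM ?(ltW A0) ?(ltW l0)// mulrCA ler_wpM2l ?powR_ge0//.
  have -> : s * l * l `^ (2 * H - 2) = s `^ H * s `^ (1 - H) * l `^ (2 * H - 1).
    rewrite -powRD; last by rewrite (gt_eqF s0) implybT.
    rewrite (_ : H + (1 - H) = 1); last by ring.
    rewrite powRr1 ?(ltW s0)// -mulrA; congr (_ * _).
    rewrite -{1}(powRr1 (ltW l0)) -powRD; last by rewrite (gt_eqF l0) implybT.
    by congr (_ `^ _); ring.
  have -> : l `^ H = l `^ (1 - H) * l `^ (2 * H - 1).
    rewrite -powRD; last by rewrite (gt_eqF l0) implybT.
    by congr (_ `^ _); ring.
  rewrite !mulrA ler_wpM2r ?powR_ge0// ler_wpM2l ?powR_ge0//.
  apply: ge0_ler_powR; rewrite ?nnegrE ?(ltW s0) ?(ltW l0)//; lra.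
case: (lerP 0 (x - y)) => xy.
  rewrite (ger0_norm xy) in far.
  have u0 : A * l <= x - (y + l) by lra.
  have Al0 : 0 < A * l by exact: mulr_gt0.
  have := lcov_linc_gap y (ltW l0) (ltW s0) (lt_le_trans Al0 u0).
  rewrite (_ : y + l + (x - (y + l)) = x); last by ring.
  rewrite lcovC => h; apply: (le_trans h); rewrite (mulrC l); exact: key.
rewrite (ltr0_norm xy) in far; have u0 : A * l <= y - (x + s) by lra.
have Al0 : 0 < A * l by exact: mulr_gt0.
have := lcov_linc_gap x (ltW s0) (ltW l0) (lt_le_trans Al0 u0).
rewrite (_ : x + s + (y - (x + s)) = y); last by ring.
by move=> h; apply: (le_trans h); exact: key.
Qed.

(* Normalised to variance 1. *)
Definition ladic (b m j : nat) : seq (R * R) :=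
  lscale ((b%:R `^ H) ^+ m) (linc (j%:R / b%:R ^+ m) (j.+1%:R / b%:R ^+ m)).

Lemma nonneg_times_ladic b m j : nonneg_times (ladic b m j).
Proof. by rewrite nonneg_timesZ nonneg_times_linc// divr_ge0// exprn_ge0. Qed.

Lemma lform_ladic T (W : R -> T -> R) b m j w :
  lform W (ladic b m j) w = (b%:R `^ H) ^+ m * incr b (fun t => W t w) m j.
Proof. by rewrite lformZ lform_linc. Qed.

End Increments.

Section IncrementsFBM.
Context {R : realType} {d : measure_display} {T : measurableType d}.
Variables (P : probability T R) (H : R) (W : R -> T -> R) (b : nat).
Hypotheses (fbmW : is_fBm P H W) (H01 : 0 < H < 1) (b2 : (2 <= b)%N).
Notation B := (b%:R : R).
Notation ladic := (ladic H b).

Let b0 : (0 < b)%N. Proof. exact: leq_trans b2. Qed.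
Let B1 : 1 < B. Proof. by rewrite ltr1n. Qed.
Let B0 : 0 < B. Proof. by rewrite ltr0n. Qed.
Let Bn n : 0 < B ^+ n. Proof. by rewrite exprn_gt0. Qed.
Let H0 : 0 < H. Proof. by case/andP: H01. Qed.
Let BHn n : 0 < (B `^ H) ^+ n. Proof. by rewrite exprn_gt0// powR_gt0. Qed.

Let invBH m : (B ^+ m)^-1 `^ H = ((B `^ H) ^+ m)^-1.
Proof. by rewrite powR_invX// powRN exprVn. Qed.

Let adicS m j : j.+1%:R / B ^+ m = j%:R / B ^+ m + (B ^+ m)^-1.
Proof. by rewrite -natr1 mulrDl mul1r. Qed.

Lemma lcov_ladic_self m j : lcov H (ladic m j) (ladic m j) = 1.
Proof.
rewrite lcovZl lcovZr lcov_linc_self//; last by rewrite adicS lerDl invr_ge0 ltW.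
rewrite adicS addrAC subrr add0r mulrC mulr2n mulrDl !mul1r.
rewrite powRD; last by rewrite (gt_eqF (_ : 0 < (B ^+ m)^-1)) ?implybT ?invr_gt0.
by rewrite invBH; field; rewrite !gt_eqF.
Qed.

Lemma lcov_ladic_le1 m j m' j' : `|lcov H (ladic m j) (ladic m' j')| <= 1.
Proof.
have := lcov_CauchySchwarz fbmW (nonneg_times_ladic H b m j) (nonneg_times_ladic H b m' j').
by rewrite !lcov_ladic_self mulr1 -real_normK ?num_real// expr_le1.
Qed.

Lemma lcov_ladic_far m m' j j' A : (m' <= m)%N -> 0 < A ->
  (A + 1) / B ^+ m' <= `|j%:R / B ^+ m - j'%:R / B ^+ m'| ->
  `|lcov H (ladic m j) (ladic m' j')| <= A `^ (2 * H - 2).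
Proof.
move=> mm A0 far; rewrite lcovZl lcovZr !adicS.
have s0 : 0 < (B ^+ m)^-1 <= (B ^+ m')^-1.
  by rewrite invr_gt0 Bn lef_pV2 ?posrE// ler_weXn2l// ltW.
have := lcov_linc_far H01 s0 A0 far; rewrite !invBH.
rewrite [X in _ -> `|X| <= _]mulrA [X in _ -> X <= _]normrM (gtr0_norm (mulr_gt0 (BHn _) (BHn _))).
move=> h; apply: le_trans (ler_wpM2l _ h) _; first by rewrite ltW// mulr_gt0.
by rewrite le_eqVlt; apply/orP; left; apply/eqP; field; rewrite !gt_eqF.
Qed.

Variable g : R.
Hypotheses (g2 : g <= 1 / 2) (gH : g <= 1 - H).
Notation r := (B `^ (- g)).

(** The cut is at distance b^(m'/2), measured in cells of order m'. Near cells number about b^(m'/2)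
    and have correlation at most 1; far ones have correlation at most b^(-(1-H)m'). The conditions g
    <= 1/2 and g <= 1 - H serve these two parts. *)
Lemma lcov_ladic_sum m m' (J : nat -> nat) (u z : R) : (m' <= m)%N -> 1 / 2 <= u ->
  (forall a, `|(J a)%:R / B ^+ m - a%:R / B ^+ m'| = `|u * a%:R - z| / B ^+ m') ->
  \sum_(a < b ^ m') `|lcov H (ladic m (J a)) (ladic m' a)| <= 11 * (B ^+ m' * r ^+ m').
Proof.
move=> mm u2 hJ; pose A := B `^ (m'%:R / 2).
have A0 : 0 < A by rewrite powR_gt0.
have rE : r ^+ m' = B `^ (- g * m'%:R) by rewrite -powR_mulrn ?powR_ge0// -powRrM.
have BE : B ^+ m' = B `^ m'%:R by rewrite powR_mulrn// ltW.
have m0 : 0 <= m'%:R :> R by [].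
have e1 : A `^ (2 * H - 2) <= r ^+ m'.
  rewrite rE /A -powRrM; apply: ler_powR; first exact: ltW.
  have -> : m'%:R / 2 * (2 * H - 2) = (H - 1) * m'%:R by field.
  by apply: ler_wpM2r => //; rewrite lerNr opprB.
have A1 : 1 <= A.
  by rewrite -(powRr0 B) /A; apply: ler_powR; [exact: ltW|rewrite divr_ge0].
have AE : A <= B ^+ m' * r ^+ m'.
  rewrite BE rE /A -powRD; last by rewrite (gt_eqF B0) implybT.
  apply: ler_powR; first exact: ltW.
  have -> : m'%:R + - g * m'%:R = (1 - g) * m'%:R by ring.
  by rewrite mulrC; apply: ler_wpM2r => //; move: g2; rewrite div1r; lra.
(* With threshold A + 1 the count 4(A + 1) + 2 is at most 10 A, and the far part adds 1 more, whence
   the 11. *)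
have := @mean_near_far _ (fun a => lcov H (ladic m (J a)) (ladic m' a)) u z (A + 1)
  (A `^ (2 * H - 2)) (b ^ m') _ u2.
rewrite expn_gt0 b0 => /(_ isT) h; apply: le_trans (h _ _ _ _) _.
- by rewrite addr_ge0// ltW.
- exact: powR_ge0.
- by move=> a; exact: lcov_ladic_le1.
- move=> a _ far; apply: lcov_ladic_far => //; rewrite hJ ler_wpM2r// invr_ge0 ltW//.
- have := ler_wpM2l (ltW (Bn m')) e1; rewrite natrX; lra.
Qed.

End IncrementsFBM.

(** * Deterministic limit arguments *)

Section Deterministic.
Context {R : realType}.

(** Monotonicity squeezes a real [t] between two neighbouring fractions. It lets almost sure
    convergence at countably many [t] hold for all [t] simultaneously. *)
Lemma cvg_monotone_dense (F : nat -> R -> R) (c : R) :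
  (forall n s t, s <= t -> F n s <= F n t) ->
  (forall m i, (i <= m.+1)%N -> F n (i%:R / m.+1%:R) @[n --> \oo] --> c * (i%:R / m.+1%:R)) ->
  forall t : R, 0 <= t <= 1 -> F n t @[n --> \oo] --> c * t.
Proof.
move=> Fmono Fc t /andP[t0 t1].
have [->|tn1] := eqVneq t 1.
  by have := Fc 0%N 1%N isT; rewrite divr1.
have {}t1 : t < 1 by rewrite lt_neqAle tn1.
apply/cvgrPdist_lt => e e0.
(* The mesh is so fine that the limit varies by less than e/2 between neighbouring fractions. *)
pose m := Num.truncn (2 * `|c| / e); have mE := truncnS_gt (2 * `|c| / e).
rewrite -/m in mE; have m0 : 0 < m.+1%:R :> R by rewrite ltr0n.
have cm : `|c| / m.+1%:R < e / 2.
  rewrite ltr_pdivrMr// mulrC -ltr_pdivrMr ?divr_gt0//.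
  by apply: le_lt_trans mE; rewrite invf_div mulrA (mulrC `|c|).
pose i := Num.truncn (t * m.+1%:R).
have /truncn_itv/andP[i1 i2] : 0 <= t * m.+1%:R by rewrite mulr_ge0.
rewrite -/i in i1 i2.
have im : (i < m.+1)%N by rewrite -(ltr_nat R); apply: le_lt_trans i1 _; rewrite gtr_pMl.
have ti1 : i%:R / m.+1%:R <= t by rewrite ler_pdivrMr.
have ti2 : t <= i.+1%:R / m.+1%:R by rewrite ler_pdivlMr// ltW.
have di : i.+1%:R / m.+1%:R = i%:R / m.+1%:R + (m.+1%:R)^-1 :> R.
  by rewrite -[in LHS]natr1 mulrDl mul1r.
have /= := Fc m i (ltnW im); have /= := Fc m i.+1 im.
move: ti1 ti2 di cm; set a := i%:R / _; set a' := i.+1%:R / _; set q := _^-1 => ti1 ti2 di cm.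
have d1 : `|c * a - c * t| < e / 2.
  rewrite -mulrBr normrM; apply: le_lt_trans cm; rewrite ler_wpM2l// ler_norml; lra.
have d2 : `|c * a' - c * t| < e / 2.
  rewrite -mulrBr normrM; apply: le_lt_trans cm; rewrite ler_wpM2l// ler_norml; lra.
have e2 : 0 < e / 2 by rewrite divr_gt0.
move=> /cvgrPdist_lt/(_ _ e2) h2 /cvgrPdist_lt/(_ _ e2) h1.
near=> n.
have a1 : `|c * a - F n a| < e / 2 by near: n; exact: h1.
have a2 : `|c * a' - F n a'| < e / 2 by near: n; exact: h2.
have b1 := Fmono n _ _ ti1; have b2 := Fmono n _ _ ti2.
move: d1 d2 a1 a2; rewrite !ltr_norml; lra.
Unshelve. all: by end_near. Qed.

(** By [powR_perturb] the change is at most a constant times [e n] times one plus the average of the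
    |x|^p, which is bounded because it converges. It carries the limit over from [W] to the
    bridge. *)
Lemma mean_powR_perturb (x y : nat -> nat -> R) (N : nat -> nat) (M e : nat -> R) (p l : R) :
  1 <= p -> (forall n, 0 < M n) -> (forall n, (N n)%:R <= M n) ->
  (forall n k, `|y n k - x n k| <= e n) -> e @ \oo --> 0 ->
  (M n)^-1 * (\sum_(k < N n) `|x n k| `^ p) @[n --> \oo] --> l ->
  (M n)^-1 * (\sum_(k < N n) `|y n k| `^ p) @[n --> \oo] --> l.
Proof.
move=> p1 M0 NM xy e0 xl.
have p0 : 0 < p by lra.
pose E n := p * 2 `^ p * e n * (1 + (M n)^-1 * (\sum_(k < N n) `|x n k| `^ p)).
have E0 : E @ \oo --> 0.
  rewrite (_ : 0 = p * 2 `^ p * 0 * (1 + l)); last by rewrite mulr0 mul0r.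
  by apply: cvgM; [exact: cvgMl_tmp|apply: cvgD => //; exact: cvg_cst].
rewrite -[l]addr0; set s := fun n => (M n)^-1 * _.
have -> : s = (fun n => (M n)^-1 * (\sum_(k < N n) `|x n k| `^ p) +
   (s n - (M n)^-1 * (\sum_(k < N n) `|x n k| `^ p))).
  by apply/funext => n; rewrite addrC subrK.
apply: cvgD => //.
apply: (@squeeze_cvgr _ _ _ _ (- E) E) => //; last by rewrite -oppr0; exact: cvgN.
near=> n.
have en1 : e n <= 1 by apply: ltW; near: n; exact: (cvgr_lt _ e0).
rewrite -ler_norml /s -mulrBr -sumrB normrM ger0_norm ?invr_ge0 ?(ltW (M0 n))//.
apply: (@le_trans _ _ ((M n)^-1 * \sum_(k < N n) p * 2 `^ p * e n * (1 + `|x n k| `^ p))).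
  rewrite ler_wpM2l ?invr_ge0 ?(ltW (M0 n))//.
  apply: le_trans (ler_norm_sum _ _ _) _; apply: ler_sum => k _.
  apply: powR_perturb => //; first by rewrite en1 andbT (le_trans _ (xy n 0%N)).
  by apply: le_trans (ler_dist_dist _ _) _; exact: xy.
have ee0 : 0 <= e n by rewrite (le_trans _ (xy n 0%N)).
rewrite -big_distrr/= big_split/= sumr_const card_ord /E mulrCA ler_wpM2l//.
  by rewrite !mulr_ge0 ?powR_ge0// ltW.
by rewrite mulrDr lerD2r mulrC ler_pdivrMr// mul1r.
Unshelve. all: by end_near. Qed.

Lemma incr_holder (kappa : R -> R) tau b : (0 < b)%N -> holder01 kappa tau ->
  exists C : R, forall m j, (j < b ^ m)%N ->
    `|incr b kappa m j| <= C * (b%:R `^ (- tau)) ^+ m.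
Proof.
move=> b0 [C hC]; exists C => m j jm.
have Bm : 0 < b%:R ^+ m :> R by rewrite exprn_gt0// ltr0n.
have h01 i : (i <= b ^ m)%N -> 0 <= (i%:R / b%:R ^+ m : R) <= 1.
  by move=> im; rewrite divr_ge0 ?(ltW Bm)//= ler_pdivrMr// mul1r -natrX ler_nat.
apply: le_trans (hC _ _ (h01 _ jm) (h01 _ (ltnW jm))) _.
rewrite -mulrBl -natr1 addrAC subrr add0r mul1r gtr0_norm ?invr_gt0//.
by rewrite powR_invX// ltr0n.
Qed.

End Deterministic.

(** * Hoelder bounds on the b-adic grid *)

Section Holder.
Context {R : realType} {d : measure_display} {T : measurableType d}.
Variables (P : probability T R) (H : R) (W : R -> T -> R) (b : nat).
Hypotheses (fbmW : is_fBm P H W) (H01 : 0 < H < 1) (b2 : (2 <= b)%N).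
Notation B := (b%:R : R).

Let b0 : (0 < b)%N. Proof. exact: leq_trans b2. Qed.
Let B1 : 1 < B. Proof. by rewrite ltr1n. Qed.
Let B0 : 0 < B. Proof. by rewrite ltr0n. Qed.
Let H0 : 0 < H. Proof. by case/andP: H01. Qed.

(* The p-th moments of all b-adic increments of order m sum up to a geometric sequence once p (H - gam) > 1. *)
Lemma fbm_adic_holder (gam : R) : gam < H -> {ae P, forall w, exists C : R,
  forall m j, (j < b ^ m)%N -> `|incr b (fun t => W t w) m j| <= C * (B `^ (- gam)) ^+ m}.
Proof.
move=> gH; have hg : 0 < H - gam by rewrite subr_gt0.
pose p := 1 + (H - gam)^-1.
have p1 : 1 < p by rewrite ltrDl invr_gt0.
have p0 : 0 < p by apply: lt_trans p1.
pose x := B `^ (gam - H); pose rho := B * x `^ p.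
have x0 : 0 < x by rewrite powR_gt0.
have rhoE : rho = B `^ (- (H - gam)).
  rewrite /rho /x -powRrM -{1}(powRr1 (ltW B0)) -powRD ?(gt_eqF B0) ?implybT//.
  by congr (_ `^ _); rewrite /p; field; rewrite gt_eqF.
have rho01 : 0 <= rho < 1 by rewrite rhoE; have /andP[/ltW -> ->] := powRN_lt1 B1 hg.
pose f m w := (x ^+ m) `^ p * \sum_(j < b ^ m) `|lform W (ladic H b m j) w| `^ p.
have mpow m j : measurable_fun setT (fun w => `|lform W (ladic H b m j) w| `^ p).
  by apply: measurable_norm_powR; exact: (measurable_lform fbmW).
have mf m : measurable_fun setT (f m).
  by apply: measurable_funM => //; exact: measurable_sum.
have f0 m w : 0 <= f m w by rewrite mulr_ge0 ?powR_ge0// sumr_ge0// => j _; rewrite powR_ge0.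
have fC m : (\int[P]_w (f m w)%:E <= (gaussM p * rho ^+ m)%:E)%E.
  rewrite /f; under eq_integral do rewrite EFinM.
  rewrite ge0_integralZl//; last 3 first.
  - by apply/measurable_EFinP; exact: measurable_sum.
  - by move=> w _; rewrite lee_fin sumr_ge0// => j _; rewrite powR_ge0.
  - by rewrite lee_fin powR_ge0.
  under eq_integral do rewrite -sumEFin.
  rewrite ge0_integral_sum//; last by move=> j; exact/measurable_EFinP.
  under eq_bigr do rewrite (gaussian_moment (gaussian_lform fbmW (nonneg_times_ladic H b _ _)) p1)
    (lcov_ladic_self H01 b2) powR1 mul1r.
  rewrite sumEFin sumr_const card_ord -EFinM lee_fin -[gaussM p *+ _]mulr_natl natrX.
  rewrite /rho exprMn -(powR_mulrn _ (ltW x0)) -powRrM mulrC (mulrC _ p) powRrM.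
  by rewrite powR_mulrn ?powR_ge0// mulrAC mulrC.
have := ae_cvg0_geometric mf f0 rho01 fC; apply: filterS => w fw.
have [M [_ hM]] := cvg_seq_bounded (cvgP _ fw).
pose M1 := `|M| + 1.
have M1M : M < M1 by rewrite (le_lt_trans (ler_norm M))// ltrDl.
have fM m : f m w <= M1 by apply: le_trans (ler_norm _) _; exact: hM.
exists (1 + M1) => m j jm.
have M10 : 0 <= M1 by rewrite addr_ge0.
pose y := x ^+ m * `|lform W (ladic H b m j) w|.
have y0 : 0 <= y by rewrite mulr_ge0// exprn_ge0// ltW.
have yp : y `^ p <= M1.
  apply: le_trans (fM m); rewrite /f /y powRM// ?exprn_ge0 ?(ltW x0)//.
  apply: ler_wpM2l; first exact: powR_ge0.
  rewrite (bigD1 (Ordinal jm))//= lerDl; apply: sumr_ge0 => i _; exact: powR_ge0.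
have yM : y <= 1 + M1.
  have [y1|y1] := leP y 1; first by rewrite (le_trans y1)// lerDl.
  apply: (@le_trans _ _ (y `^ p)); last by rewrite (le_trans yp)// lerDr.
  by rewrite -{1}(powRr1 y0); apply: ler_powR; exact: ltW.
have yE : y = (B `^ gam) ^+ m * `|incr b (fun t => W t w) m j|.
  rewrite /y lform_ladic normrM ger0_norm ?exprn_ge0 ?powR_ge0// mulrA -exprMn /x -powRD.
    by rewrite subrK.
  by rewrite (gt_eqF B0) implybT.
rewrite -ler_pdivrMr ?exprn_gt0 ?powR_gt0// powRN exprVn invrK mulrC -yE.
exact: yM.
Qed.

Variables (kappa : R -> R) (tau : R).
Hypothesis kappa_tau : holder01 kappa tau.

Lemma incr_fbridge w m j : incr b (fun t => fbridge W kappa t w) m j =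
  incr b (fun t => W t w) m j - W 1 w * incr b kappa m j.
Proof. by rewrite /incr /fbridge; ring. Qed.

Lemma wsum_fbridge alpha w n k : wsum b alpha (fun t => fbridge W kappa t w) n k =
  wsum b alpha (fun t => W t w) n k - W 1 w * wsum b alpha kappa n k.
Proof.
rewrite /wsum big_distrr/= -sumrB; apply: eq_bigr => i _.
by rewrite incr_fbridge; ring.
Qed.

Lemma fbridge_adic_holder (gam : R) : gam < H -> gam <= tau ->
  {ae P, forall w, exists C : R, forall m j, (j < b ^ m)%N ->
    `|incr b (fun t => fbridge W kappa t w) m j| <= C * (B `^ (- gam)) ^+ m}.
Proof.
move=> gH gtau; have [Ck hCk] := incr_holder b0 kappa_tau.
have := fbm_adic_holder gH; apply: filterS => w [C hC].
exists (C + `|W 1 w| * `|Ck|) => m j jm; rewrite incr_fbridge.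
apply: le_trans (ler_normB _ _) _; rewrite mulrDl; apply: lerD; first exact: hC.
rewrite normrM -mulrA ler_wpM2l//; apply: le_trans (hCk _ _ jm) _.
have Bt0 : 0 <= B `^ (- tau) := powR_ge0 _ _.
apply: le_trans (ler_wpM2r (exprn_ge0 _ Bt0) (ler_norm _)) _; rewrite ler_wpM2l//.
apply: lerXn2r; rewrite ?nnegrE ?powR_ge0//; apply: ler_powR; first exact: ltW.
by rewrite lerN2.
Qed.

End Holder.

(** * The case H < K *)

Section Subcritical.
Context {R : realType} {d : measure_display} {T : measurableType d}.
Variables (P : probability T R) (H : R) (W : R -> T -> R) (b : nat).
Hypotheses (fbmW : is_fBm P H W) (H01 : 0 < H < 1) (b2 : (2 <= b)%N).
Notation B := (b%:R : R).
Notation ladic := (ladic H b).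

Let b0 : (0 < b)%N. Proof. exact: leq_trans b2. Qed.
Let B1 : 1 < B. Proof. by rewrite ltr1n. Qed.
Let B0 : 0 < B. Proof. by rewrite ltr0n. Qed.
Let Bn n : 0 < B ^+ n. Proof. by rewrite exprn_gt0. Qed.

Let g := Num.min (1 / 2) (1 - H).
Let r := B `^ (- g).
Let g2 : g <= 1 / 2. Proof. by rewrite ge_min lexx. Qed.
Let gH : g <= 1 - H. Proof. by rewrite ge_min lexx orbT. Qed.
Let r0 : 0 < r. Proof. by rewrite powR_gt0. Qed.
Let r1 : r < 1.
Proof.
have g0 : 0 < g by rewrite lt_min divr_gt0//= subr_gt0; case/andP: H01.
by have /andP[] := powRN_lt1 B1 g0.
Qed.

(** For a fixed cell of the finer order the cells of the coarser order are evenly spaced, so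
    [lcov_ladic_sum] applies with slope 1. *)
Lemma lcov_ladic_sum2 m m' :
  \sum_(j < b ^ m) \sum_(j' < b ^ m') `|lcov H (ladic m j) (ladic m' j')|
  <= 11 * (B ^+ m * B ^+ m') * (r ^+ m + r ^+ m').
Proof.
wlog mm : m m' / (m' <= m)%N => [hw|].
  have [/hw//|/ltnW/hw] := leqP m' m.
  rewrite exchange_big/= (mulrC (B ^+ m')) (addrC (r ^+ m')); apply: le_trans.
  by apply: ler_sum => j _; apply: ler_sum => j' _; rewrite lcovC.
apply: (@le_trans _ _ (\sum_(j < b ^ m) 11 * (B ^+ m' * r ^+ m'))).
  apply: ler_sum => j _.
  apply: (@lcov_ladic_sum _ _ _ _ _ _ _ fbmW H01 b2 g g2 gH m m' (fun=> j) 1 (j%:R * B ^+ m' / B ^+ m)) => //.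
    by lra.
  move=> a; rewrite -[X in _ = _ / X](gtr0_norm (Bn m')) -normf_div distrC; congr `|_|.
  by field; rewrite !gt_eqF.
rewrite sumr_const card_ord -[_ *+ (b ^ _)]mulr_natl natrX.
have := ltW (exprn_gt0 m r0); have : 0 <= B ^+ m * B ^+ m' by rewrite mulr_ge0 ?ltW.
move=> h1 h2; have := mulr_ge0 h1 h2; lra.
Qed.

(** These are two terms of one and the same sum, where both cells move with the index. For j = h
    b^m' + a their distance, in cells of order m', is |(1 - b^(m'-m)) a - z|, with slope at least
    1/2 because m' < m and b >= 2. This is why [count_affine] admits slopes down to 1/2. *)
Lemma lcov_ladic_sum1 m m' : (m' < m)%N ->
  \sum_(j < b ^ m) `|lcov H (ladic m j) (ladic m' (j %% b ^ m'))|
  <= 11 * (B ^+ m * r ^+ m').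
Proof.
move=> mm; have BmE : B ^+ m = B ^+ (m - m') * B ^+ m' by rewrite -exprD subnK// ltnW.
rewrite (_ : (b ^ m = b ^ (m - m') * b ^ m')%N); last by rewrite -expnD subnK// ltnW.
rewrite (sum_blocks (fun j => `|lcov H (ladic m j) (ladic m' (j %% b ^ m'))|)).
apply: (@le_trans _ _ (\sum_(h < b ^ (m - m')) 11 * (B ^+ m' * r ^+ m'))); last first.
  by rewrite sumr_const card_ord -[_ *+ (b ^ _)]mulr_natl natrX BmE; lra.
apply: ler_sum => h _.
rewrite [leLHS](eq_bigr (fun a : 'I_(b ^ m') =>
    `|lcov H (ladic m (h * b ^ m' + a)) (ladic m' a)|)); last first.
  by move=> a _; rewrite modnMDl modn_small.
apply: (@lcov_ladic_sum _ _ _ _ _ _ _ fbmW H01 b2 g g2 gH m m' (fun a => (h * b ^ m' + a)%N)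
  (1 - (B ^+ (m - m'))^-1) (h%:R * B ^+ m' / B ^+ (m - m'))).
- exact: ltnW.
- have : (B ^+ (m - m'))^-1 <= 2^-1.
    rewrite lef_pV2 ?posrE// -(@natrX R) ler_nat -[2%N]/(2 ^ 1)%N.
    apply: (@leq_trans (b ^ 1)); first by rewrite expn1.
    by rewrite leq_pexp2l// subn_gt0.
  lra.
- move=> a; rewrite -[X in _ = _ / X](gtr0_norm (Bn m')) -normf_div distrC; congr `|_|.
  by rewrite natrD natrM natrX BmE; field; rewrite !gt_eqF.
Qed.

Variable alpha : R.
Hypotheses (alpha0 : 0 < alpha) (beta1 : alpha * B `^ H < 1).
Let beta := alpha * B `^ H.
Let beta0 : 0 < beta. Proof. by rewrite mulr_gt0// powR_gt0. Qed.

(** Since (b^H)^n alpha^i = beta^i (b^H)^(n-i), the increment rescaled by b^(Hn) combines normalised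
    increments with weights beta^i. *)
Definition lwsum n k : seq (R * R) :=
  flatten [seq lscale (beta ^+ i) (ladic (n - i) (k %% b ^ (n - i))) | i <- iota 0 n].

Lemma nonneg_times_lwsum n k : nonneg_times (lwsum n k).
Proof.
by apply: nonneg_times_flatten => i; rewrite nonneg_timesZ nonneg_times_ladic.
Qed.

Lemma lform_lwsum n k w : lform W (lwsum n k) w = (B `^ H) ^+ n * wsum b alpha (fun t => W t w) n k.
Proof.
rewrite /lwsum lform_flatten -{1}(subn0 n) -[iota _ _]/(index_iota 0 n) big_mkord.
rewrite /wsum big_distrr/=; apply: eq_bigr => i _.
rewrite lformZ lform_ladic /beta exprMn.
have -> : (B `^ H) ^+ n = (B `^ H) ^+ i * (B `^ H) ^+ (n - i) by rewrite -exprD subnKC// ltnW.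
by ring.
Qed.

Let rho n i k j l := lcov H (ladic (n - i) (k %% b ^ (n - i))) (ladic (n - j) (l %% b ^ (n - j))).

Lemma lcov_lwsum n k l : lcov H (lwsum n k) (lwsum n l) =
  \sum_(i < n) \sum_(j < n) beta ^+ i * beta ^+ j * rho n i k j l.
Proof.
rewrite /lwsum lcov_flattenl -[X in iota 0 X](subn0 n) -[iota _ _]/(index_iota 0 n) big_mkord.
apply: eq_bigr => i _; rewrite lcovZl lcov_flattenr.
rewrite big_mkord big_distrr/=.
by apply: eq_bigr => j _; rewrite lcovZr mulrA.
Qed.

Let bb0 i j : 0 <= beta ^+ i * beta ^+ j.
Proof. by rewrite mulr_ge0// exprn_ge0// ltW. Qed.

Let S1 n := \sum_(i < n) beta ^+ i.
Let S2 n := \sum_(i < n) beta ^+ i * r ^+ (n - i).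

Let sumS n : \sum_(i < n) \sum_(j < n) beta ^+ i * beta ^+ j * (r ^+ (n - i) + r ^+ (n - j))
  = 2 * (S1 n * S2 n).
Proof.
transitivity (\sum_(i < n) \sum_(j < n) (beta ^+ i * r ^+ (n - i) * beta ^+ j + beta ^+ i * (beta ^+ j * r ^+ (n - j)))).
  by apply: eq_bigr => i _; apply: eq_bigr => j _; ring.
under eq_bigr do rewrite big_split/= -!big_distrr/=.
by rewrite big_split/= -!big_distrl/= /S1 /S2; ring.
Qed.

Let sum_mod (F : nat -> R) n i : \sum_(k < b ^ n) F (k %% b ^ (n - i))%N =
  B ^+ n / B ^+ (n - i) * \sum_(j < b ^ (n - i)) F j.
Proof.
rewrite (sum_mod_expn F b0 (leq_subr i n)); congr (_ * _).
rewrite natrX -[n in B ^+ n / _](subnK (leq_subr i n)) exprD mulfK//.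
by rewrite gt_eqF.
Qed.

(** Bilinearity reduces the double sum to pairs of orders. Each residue occurs equally often, so
    [lcov_ladic_sum2] applies, and the weights leave a convolution of geometric sequences. *)
Let avg_offdiag n : \sum_(k < b ^ n) \sum_(l < b ^ n) `|lcov H (lwsum n k) (lwsum n l)|
  <= (B ^+ n) ^+ 2 * (22 * (S1 n * S2 n)).
Proof.
apply: (@le_trans _ _ (\sum_(i < n) \sum_(j < n) beta ^+ i * beta ^+ j *
    \sum_(k < b ^ n) \sum_(l < b ^ n) `|rho n i k j l|)).
  apply: (@le_trans _ _ (\sum_(k < b ^ n) \sum_(l < b ^ n) \sum_(i < n) \sum_(j < n)
     beta ^+ i * beta ^+ j * `|rho n i k j l|)).
    apply: ler_sum => k _; apply: ler_sum => l _; rewrite lcov_lwsum.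
    apply: le_trans (ler_norm_sum _ _ _) _; apply: ler_sum => i _.
    apply: le_trans (ler_norm_sum _ _ _) _; apply: ler_sum => j _.
    by rewrite normrM (ger0_norm (bb0 _ _)).
  rewrite le_eqVlt; apply/orP; left; apply/eqP.
  under eq_bigr do rewrite exchange_big/=.
  rewrite exchange_big/=; apply: eq_bigr => i _.
  under eq_bigr do rewrite exchange_big/=.
  rewrite exchange_big/=; apply: eq_bigr => j _.
  by rewrite big_distrr/=; apply: eq_bigr => k _; rewrite big_distrr.
have -> : (B ^+ n) ^+ 2 * (22 * (S1 n * S2 n)) = \sum_(i < n) \sum_(j < n)
    beta ^+ i * beta ^+ j * ((B ^+ n) ^+ 2 * (11 * (r ^+ (n - i) + r ^+ (n - j)))).
  transitivity ((B ^+ n) ^+ 2 * 11 * (2 * (S1 n * S2 n))); first by ring.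
  rewrite -sumS big_distrr/=; apply: eq_bigr => i _; rewrite big_distrr/=.
  by apply: eq_bigr => j _; ring.
apply: ler_sum => i _; apply: ler_sum => j _; apply: ler_wpM2l => //.
rewrite (sum_mod (fun k => \sum_(l < b ^ n) `|lcov H (ladic (n - i) k) (ladic (n - j) (l %% b ^ (n - j)))|)).
under eq_bigr => k _ do rewrite (sum_mod (fun l => `|lcov H (ladic (n - i) k) (ladic (n - j) l)|)).
rewrite -big_distrr/= mulrA.
apply: le_trans (ler_wpM2l _ (lcov_ladic_sum2 _ _)) _.
  by rewrite mulr_ge0// divr_ge0// ltW.
by rewrite le_eqVlt; apply/orP; left; apply/eqP; field; rewrite !gt_eqF.
Qed.

Let v := (1 - beta ^+ 2)^-1.
Let beta21 : beta ^+ 2 < 1. Proof. by rewrite expr_lt1// ltW. Qed.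

(** Equal orders contribute the sum of beta^(2i), which misses [v] by v beta^(2n); distinct orders
    are averaged by [lcov_ladic_sum1]. *)
Let avg_diag n : \sum_(k < b ^ n) `|lcov H (lwsum n k) (lwsum n k) - v|
  <= B ^+ n * (v * beta ^+ n + 22 * (S1 n * S2 n)).
Proof.
have v0 : 0 < v by rewrite invr_gt0 subr_gt0.
apply: (@le_trans _ _ (\sum_(k < b ^ n) (v * beta ^+ n + \sum_(i < n) \sum_(j < n | j != i)
     beta ^+ i * beta ^+ j * `|rho n i k j k|))).
  apply: ler_sum => k _; rewrite lcov_lwsum.
  under eq_bigr => i _ do rewrite (bigD1 i)//= {1}/rho (lcov_ladic_self H01 b2) mulr1 -exprD addnn -mul2n exprM.
  rewrite big_split/= addrAC.
  have -> : \sum_(i < n) (beta ^+ 2) ^+ i - v = - (v * beta ^+ 2 ^+ n).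
    have := subrX1 (beta ^+ 2) n; rewrite /v; set s := \sum_(i < n) _ => h.
    have d0 : 1 - beta ^+ 2 != 0 by rewrite gt_eqF// subr_gt0.
    have -> : s = (1 - beta ^+ 2 ^+ n) / (1 - beta ^+ 2).
      by apply: (mulfI d0); rewrite [RHS]mulrC divfK// -opprB mulNr -h opprB.
    by rewrite mulrBl mul1r addrAC subrr add0r mulrC.
  apply: le_trans (ler_normD _ _) _; apply: lerD.
    rewrite normrN gtr0_norm ?mulr_gt0 ?exprn_gt0//; apply: ler_wpM2l; first exact: ltW.
    rewrite -exprM mulnC exprM expr2 ler_piMl//; first by rewrite exprn_ge0// ltW.
    by rewrite exprn_ile1 ?ltW.
  apply: le_trans (ler_norm_sum _ _ _) _; apply: ler_sum => i _.
  apply: le_trans (ler_norm_sum _ _ _) _; apply: ler_sum => j _.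
  by rewrite normrM (ger0_norm (bb0 _ _)).
rewrite big_split/= sumr_const card_ord -[_ *+ (b ^ n)]mulr_natl natrX mulrDr lerD2l.
rewrite exchange_big/=; under eq_bigr do rewrite exchange_big/=.
have -> : B ^+ n * (22 * (S1 n * S2 n)) = \sum_(i < n) \sum_(j < n)
    beta ^+ i * beta ^+ j * (B ^+ n * (11 * (r ^+ (n - i) + r ^+ (n - j)))).
  transitivity (B ^+ n * 11 * (2 * (S1 n * S2 n))); first by ring.
  rewrite -sumS big_distrr/=; apply: eq_bigr => i _; rewrite big_distrr/=.
  by apply: eq_bigr => j _; ring.
have rp k : 0 <= r ^+ k by rewrite exprn_ge0// ltW.
have key (i j : nat) : (i < n)%N -> (j < n)%N -> (i < j)%N ->
    \sum_(k < b ^ n) `|rho n i k j k| <= B ^+ n * (11 * (r ^+ (n - i) + r ^+ (n - j))).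
  move=> ni nj ij; rewrite (eq_bigr (fun k : 'I_(b ^ n) => `|lcov H (ladic (n - i) (k %% b ^ (n - i)))
      (ladic (n - j) ((k %% b ^ (n - i)) %% b ^ (n - j)))|)); last first.
    by move=> k _; rewrite modn_dvdm// dvdn_exp2l// leq_sub2l// ltnW.
  rewrite (sum_mod (fun k => `|lcov H (ladic (n - i) k) (ladic (n - j) (k %% b ^ (n - j)))|)).
  apply: le_trans (ler_wpM2l _ (lcov_ladic_sum1 _)) _.
  - by rewrite divr_ge0// ltW.
  - by rewrite ltn_sub2l.
  have -> : B ^+ n / B ^+ (n - i) * (11 * (B ^+ (n - i) * r ^+ (n - j))) = B ^+ n * (11 * r ^+ (n - j)).
    by field; rewrite gt_eqF.
  by apply: ler_wpM2l; [exact: ltW|rewrite ler_wpM2l// lerDr].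
apply: ler_sum => i _; rewrite big_mkcond/=; apply: ler_sum => j _.
have nn : 0 <= B ^+ n * (11 * (r ^+ (n - i) + r ^+ (n - j))).
  by rewrite mulr_ge0 ?(ltW (Bn n))// mulr_ge0// addr_ge0.
case: ifPn => [ji|_]; last by rewrite mulr_ge0.
rewrite -big_distrr/=; apply: ler_wpM2l => //.
have [ij|ij] := ltnP i j; first exact: key.
have {}ij : (j < i)%N by rewrite ltn_neqAle ij andbT; apply: contraNneq ji => h; apply/eqP/val_inj.
rewrite addrC; apply: le_trans (key _ _ _ _ ij) => //.
by apply: ler_sum => k _; rewrite /rho lcovC.
Qed.

Lemma lcov_lwsum_le n k : lcov H (lwsum n k) (lwsum n k) <= ((1 - beta)^-1) ^+ 2.
Proof.
have S1le : S1 n <= (1 - beta)^-1 by apply: sum_geo_le; rewrite ltW.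
have S10 : 0 <= S1 n by apply: sumr_ge0 => i _; rewrite exprn_ge0// ltW.
apply: (@le_trans _ _ (S1 n ^+ 2)); last first.
  by rewrite lerXn2r// nnegrE (le_trans S10).
rewrite lcov_lwsum expr2 big_distrl/=; apply: ler_sum => i _.
rewrite big_distrr/=; apply: ler_sum => j _.
apply: ler_piMr => //; apply: le_trans (ler_norm _) _.
exact: (lcov_ladic_le1 fbmW H01 b2).
Qed.

Lemma lcov_lwsum_avg : exists C q : R, [/\ 0 < C, 0 < q < 1 & forall n,
  \sum_(k < b ^ n) \sum_(l < b ^ n) (`|lcov H (lwsum n k) (lwsum n l)|
     + `|lcov H (lwsum n k) (lwsum n k) - v| + `|lcov H (lwsum n l) (lwsum n l) - v|)
  <= (b ^ n)%:R ^+ 2 * (C * q ^+ n) ^+ 4].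
Proof.
have b01 : 0 <= beta < 1 by rewrite ltW.
have r01 : 0 <= r < 1 by rewrite ltW.
have [rh [C [/andP[rh0 rh1] C0 hC]]] := sum_geo_conv b01 r01.
have v0 : 0 < v by rewrite invr_gt0 subr_gt0.
have d0 : 0 < (1 - beta)^-1 by rewrite invr_gt0 subr_gt0.
(* 66 collects 22 from the pairs and 22 from each of two diagonal deviations, 2v the two tails of
   the geometric series; the 1 ensures C1 <= C1^4. Below, [q] is a fourth root, to fit the y^4 of
   the law of large numbers. *)
pose q0 := Num.max rh beta; pose C1 := 66 * ((1 - beta)^-1 * C) + 2 * v + 1.
have q00 : 0 < q0 by rewrite lt_max rh0.
have q01 : q0 < 1 by rewrite gt_max rh1.
have C11 : 1 <= C1.
  by rewrite lerDr addr_ge0// ?mulr_ge0// ltW.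
pose q := Num.sqrt (Num.sqrt q0).
have q4 : q ^+ 4 = q0.
  by rewrite (exprM q 2 2) sqr_sqrtr ?sqrtr_ge0// sqr_sqrtr// ltW.
exists C1, q; split.
- exact: lt_le_trans C11.
- have sq x : x < 1 -> Num.sqrt x < 1 :> R by move=> x1; rewrite -[ltRHS]sqrtr1 ltr_sqrt.
  by rewrite /q !sqrtr_gt0 q00/= !sq.
move=> n; rewrite natrX exprMn -(exprM q) mulnC (exprM q) q4.
apply: (@le_trans _ _ ((B ^+ n) ^+ 2 * (C1 * q0 ^+ n))); last first.
  rewrite ler_wpM2l ?sqr_ge0// ler_wpM2r ?exprn_ge0 ?(ltW q00)//.
  by rewrite ler_eXnr.
under eq_bigr do rewrite !big_split/= sumr_const card_ord -[_ *+ (b ^ n)]mulr_natl.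
rewrite !big_split/= -big_distrr/= sumr_const card_ord -[(\sum_(i < b ^ n) _) *+ _]mulr_natl natrX.
have h1 := avg_offdiag n; have h2 := ler_wpM2l (ltW (Bn n)) (avg_diag n).
have rq : rh ^+ n <= q0 ^+ n by apply: lerXn2r; rewrite ?nnegrE ?(ltW rh0) ?(ltW q00)// /q0 le_max lexx.
have bq : beta ^+ n <= q0 ^+ n by apply: lerXn2r; rewrite ?nnegrE ?(ltW beta0) ?(ltW q00)// /q0 le_max lexx orbT.
have S12 : S1 n * S2 n <= (1 - beta)^-1 * C * q0 ^+ n.
  rewrite -mulrA; apply: ler_pM.
  - by apply: sumr_ge0 => i _; rewrite exprn_ge0// ltW.
  - by apply: sumr_ge0 => i _; rewrite mulr_ge0// exprn_ge0// ltW.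
  - by apply: sum_geo_le; rewrite ltW.
  - by apply: le_trans (hC n) _; rewrite ler_wpM2l.
have X2 := sqr_ge0 (B ^+ n).
have m1 := ler_wpM2l X2 S12; have m2 := ler_wpM2l X2 (ler_wpM2l (ltW v0) bq).
have m3 : 0 <= (B ^+ n) ^+ 2 * q0 ^+ n by rewrite mulr_ge0// exprn_ge0// ltW.
move: h1 h2 m1 m2 m3; rewrite /C1 expr2; lra.
Qed.

Let H0 : 0 < H. Proof. by case/andP: H01. Qed.
Let p := H^-1.
Let p1 : 1 < p. Proof. by rewrite invf_gt1//; case/andP: H01. Qed.
Let c := v `^ (p / 2) * gaussM p.
Let lw n k := lform W (lwsum n k).
Let K (t : R) n := Num.truncn (t * B ^+ n).

Let K_le t n : t <= 1 -> (K t n <= b ^ n)%N.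
Proof.
move=> t1; rewrite /K -[leqRHS](@natrK R); apply: le_truncn.
by rewrite natrX ler_piMl// ltW.
Qed.

(** [lln_moment] with y = C q^n gives L^1 errors that decay geometrically, hence almost sure
    convergence. *)
Lemma lwsum_lln t : 0 <= t <= 1 -> {ae P, forall w,
  (B ^+ n)^-1 * (\sum_(k < K t n) `|lw n k w| `^ p) @[n --> \oo] --> c * t}.
Proof.
move=> /andP[t0 t1].
have b21 : beta ^+ 2 < 1 by rewrite expr_lt1// ltW.
have v0 : 0 < v by rewrite invr_gt0 subr_gt0.
pose Vm := ((1 - beta)^-1) ^+ 2.
have Vm0 : 0 <= Vm by exact: sqr_ge0.
have vV : 0 <= v <= Vm.
  rewrite (ltW v0)/= /Vm exprVn /v lef_pV2 ?posrE ?subr_gt0 ?exprn_gt0 ?subr_gt0//.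
  have b1 : 0 <= 1 - beta by rewrite subr_ge0 ltW.
  rewrite -subr_ge0 (_ : _ - _ = 2 * beta * (1 - beta)); last by ring.
  by rewrite mulr_ge0// mulr_ge0// ltW.
have [C' C'0 hC'] := lln_moment P p1 Vm0.
have [C [q [C0 /andP[q0 q1] hC]]] := lcov_lwsum_avg.
have qn : (fun n => C * q ^+ n) @ \oo --> (0 : R).
  by rewrite -[X in _ --> X](mulr0 C); apply: cvgMl_tmp; apply: cvg_expr; rewrite gtr0_norm.
(* [lln_moment] needs y <= 1, so the sequence is started where C q^n <= 1. *)
have [n0 _ hn0] := cvgr_le _ qn 1 ltr01.
have {}hn0 n : C * q ^+ (n0 + n) <= 1 by apply: hn0 => /=; exact: leq_addr.
pose f n w := `|(b ^ n)%:R^-1 * (\sum_(k < K t n) `|lw n k w| `^ p) - (K t n)%:R / (b ^ n)%:R * c|.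
have mf n : measurable_fun setT (f n).
  apply: measurableT_comp => //; apply: measurable_funB => //; apply: measurable_funM => //.
  apply: measurable_sum => k.
  by apply: measurable_norm_powR; exact: (measurable_lform fbmW).
have fC n : (\int[P]_w (f (n0 + n)%N w)%:E <= (C' * C * q ^+ n0 * q ^+ n)%:E)%E.
  rewrite -[C' * C * _ * _]mulrA -exprD -[C' * C * _]mulrA.
  have := hC' _ _ (b ^ (n0 + n))%N (K t (n0 + n)) v (C * q ^+ (n0 + n))
    (gaussian_family_lform fbmW (nonneg_times_lwsum (n0 + n)))
    (fun k => gaussian_lform fbmW (nonneg_times_lwsum (n0 + n) k)).
  apply => //.
  - by rewrite expn_gt0 b0.
  - exact: K_le.
  - by rewrite mulr_gt0 ?exprn_gt0//=.
  - by move=> k; exact: lcov_lwsum_le.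
have := @ae_cvg0_geometric _ _ _ P (fun n => f (n0 + n)%N) (C' * C * q ^+ n0) q (fun n => mf _)
  (fun n w => normr_ge0 _).
rewrite (ltW q0) q1 => /(_ isT fC); apply: filterS => w fw.
have {}fw : (fun n => f n w) @ \oo --> (0 : R).
  by rewrite -(cvg_shiftn n0); under eq_fun do rewrite addnC.
have kt : (K t n)%:R / (b ^ n)%:R @[n --> \oo] --> t.
  by under eq_fun do rewrite natrX; exact: cvg_truncn_div.
under eq_fun do rewrite -natrX.
rewrite -[c * t]add0r (mulrC c).
set s := fun n => _.
rewrite (_ : s = fun n => (s n - (K t n)%:R / (b ^ n)%:R * c) + (K t n)%:R / (b ^ n)%:R * c); last first.
  by apply/funext => n; rewrite subrK.
apply: cvgD; first exact/norm_cvg0P.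
exact: cvgMr_tmp.
Qed.

Lemma lwsum_lln_all : {ae P, forall w, forall t, 0 <= t <= 1 ->
  (B ^+ n)^-1 * (\sum_(k < K t n) `|lw n k w| `^ p) @[n --> \oo] --> c * t}.
Proof.
have : {ae P, forall w, forall m i, (i <= m.+1)%N -> (B ^+ n)^-1 *
    (\sum_(k < K (i%:R / m.+1%:R) n) `|lw n k w| `^ p) @[n --> \oo] --> c * (i%:R / m.+1%:R)}.
  apply: ae_foralln => m; apply: ae_foralln => i.
  have [im|_] := leqP i m.+1; last exact: aeW.
  have : 0 <= (i%:R / m.+1%:R : R) <= 1.
    by rewrite divr_ge0//= ler_pdivrMr ?ltr0n// mul1r ler_nat.
  by move=> /lwsum_lln; apply: filterS => w h _.
apply: filterS => w h t t01.
apply: (@cvg_monotone_dense _ (fun n t => (B ^+ n)^-1 * (\sum_(k < K t n) `|lw n k w| `^ p))) => //.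
move=> n s u su; rewrite ler_wpM2l ?invr_ge0 ?(ltW (Bn n))//.
have Ksu : (K s n <= K u n)%N by apply: le_truncn; rewrite ler_wpM2r// ltW.
rewrite (big_ord_widen _ (fun k => `|lw n k w| `^ p) Ksu) big_mkcond/=.
by apply: ler_sum => k _; case: ifP => // _; exact: powR_ge0.
Qed.

Variables (kappa : R -> R) (tau : R).
Hypotheses (kappa_tau : holder01 kappa tau) (Htau : H < tau).

(** As H p = 1, the factor (b^H)^(np) is exactly b^n, so the mean over the grid is the p-th
    variation. The contribution of [kappa], rescaled by b^(Hn), is at most a convolution of the
    rates beta and b^(H-tau), both below 1. *)
Lemma wsum_fbridge_pvar : {ae P, forall w, forall t, 0 <= t <= 1 ->
  \sum_(k < K t n) `|wsum b alpha (fun s => fbridge W kappa s w) n k| `^ p @[n --> \oo] --> c * t}.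
Proof.
have [Ck hCk] := incr_holder b0 kappa_tau.
pose th := B `^ (- tau) * B `^ H.
have th01 : 0 <= th < 1.
  rewrite /th -powRD ?(gt_eqF B0) ?implybT// (_ : - tau + H = - (tau - H)); last by ring.
  by have /andP[/ltW -> ->] : 0 < B `^ (- (tau - H)) < 1 by apply: powRN_lt1; rewrite // subr_gt0.
have b01 : 0 <= beta < 1 by rewrite ltW.
have [rh [C [/andP[rh0 rh1] C0 hC]]] := sum_geo_conv b01 th01.
have := lwsum_lln_all; apply: filterS => w hw t t01.
have sE (f : R -> R) : (fun n => \sum_(k < K t n) `|wsum b alpha f n k| `^ p) =
   (fun n => (B ^+ n)^-1 * \sum_(k < K t n) `|(B `^ H) ^+ n * wsum b alpha f n k| `^ p).
  apply/funext => n; rewrite big_distrr/=; apply: eq_bigr => k _.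
  rewrite normrM powRM// ger0_norm ?exprn_ge0 ?powR_ge0// mulrA.
  rewrite -[(B `^ H) ^+ n]powR_mulrn ?powR_ge0// -!powRrM (_ : H * (n%:R * p) = n%:R); last first.
    by rewrite /p mulrCA mulfV ?mulr1// gt_eqF.
  by rewrite powR_mulrn ?(ltW B0)// mulVf ?mul1r// gt_eqF.
rewrite sE.
refine (mean_powR_perturb (x := fun n k => lw n k w) (y := fun n k => (B `^ H) ^+ n * wsum b alpha (fun s => fbridge W kappa s w) n k) (N := K t) (M := fun n => B ^+ n) (e := fun n => `|W 1 w| * (`|Ck| * C) * rh ^+ n) _ _ _ _ _ (hw t t01)).
- exact: ltW.
- exact: Bn.
- by move=> n; rewrite -natrX ler_nat K_le//; case/andP: t01.
- move=> n k; rewrite /lw lform_lwsum -mulrBr wsum_fbridge addrAC subrr add0r.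
  rewrite mulrN normrN mulrCA normrM -!mulrA ler_wpM2l//.
  rewrite normrM ger0_norm ?exprn_ge0 ?powR_ge0//.
  have hCk' m j : (j < b ^ m)%N -> `|incr b kappa m j| <= `|Ck| * (B `^ (- tau)) ^+ m.
    by move=> /hCk h; apply: le_trans h _; rewrite ler_wpM2r ?exprn_ge0 ?powR_ge0// ler_norm.
  have := wsum_le n k b0 (ltW alpha0) hCk'.
  move=> /(ler_wpM2l (exprn_ge0 n (powR_ge0 B H))) h; apply: (le_trans h).
  rewrite mulrCA ler_wpM2l//; apply: le_trans (hC n); rewrite big_distrr/=.
  apply: ler_sum => i _; rewrite /beta /th !exprMn.
  have -> : (B `^ H) ^+ n = (B `^ H) ^+ i * (B `^ H) ^+ (n - i) by rewrite -exprD subnKC// ltnW.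
  by rewrite le_eqVlt; apply/orP; left; apply/eqP; ring.
- rewrite -[X in _ --> X](mulr0 (`|W 1 w| * (`|Ck| * C))); apply: cvgMl_tmp.
  by apply: cvg_expr; rewrite gtr0_norm.
Qed.

End Subcritical.

(** * The case K < H *)

Section VarianceLowerBound.
Context {R : realType} {d : measure_display} {T : measurableType d}.
Variables (P : probability T R) (H : R) (W : R -> T -> R) (b : nat).
Hypotheses (fbmW : is_fBm P H W) (H01 : 0 < H < 1) (b2 : (2 <= b)%N).
Variables (kappa : R -> R) (tau K : R).
Hypotheses (kappa_tau : holder01 kappa tau) (Ktau : K < tau) (K01 : 0 < K < 1).
Notation B := (b%:R : R).
Notation alpha := (B `^ (- K)).

Let b0 : (0 < b)%N. Proof. exact: leq_trans b2. Qed.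
Let B1 : 1 < B. Proof. by rewrite ltr1n. Qed.
Let B0 : 0 < B. Proof. by rewrite ltr0n. Qed.
Let Bn n : 0 < B ^+ n. Proof. by rewrite exprn_gt0. Qed.
Let H0 : 0 < H. Proof. by case/andP: H01. Qed.
Let H1 : H < 1. Proof. by case/andP: H01. Qed.
Let alpha0 : 0 < alpha. Proof. by rewrite powR_gt0. Qed.

Definition lbridge m : seq (R * R) :=
  linc (0%:R / B ^+ m) (1%:R / B ^+ m) ++ [:: (- incr b kappa m 0, 1)].

Lemma lform_lbridge m w : lform W (lbridge m) w = incr b (fun t => fbridge W kappa t w) m 0.
Proof.
rewrite lform_cat lform_linc incr_fbridge /lform big_cons big_nil/= addr0 mulNr.
by rewrite (mulrC (W 1 w)).
Qed.

Lemma nonneg_times_lbridge m : nonneg_times (lbridge m).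
Proof.
rewrite nonneg_times_cat nonneg_times_linc ?mul0r ?divr_ge0 ?(ltW (Bn m))//.
by rewrite /nonneg_times/= ler01.
Qed.

(** This is [scaled_wsum] at index 0 as a form in [W]: all residues of 0 are 0, so only the first
    cells occur, of orders 1 to [M]. *)
Definition lorigin M : seq (R * R) :=
  flatten [seq lscale (alpha ^+ m.+1)^-1 (lbridge m.+1) | m <- iota 0 M].

Lemma nonneg_times_lorigin M : nonneg_times (lorigin M).
Proof. by apply: nonneg_times_flatten => m; rewrite nonneg_timesZ nonneg_times_lbridge. Qed.

Lemma lform_lorigin M w : lform W (lorigin M) w =
  \sum_(m < M) (alpha ^+ m.+1)^-1 * incr b (fun t => fbridge W kappa t w) m.+1 0.
Proof.
rewrite /lorigin lform_flatten -[X in iota 0 X](subn0 M) -[iota _ _]/(index_iota 0 M) big_mkord.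
by apply: eq_bigr => m _; rewrite lformZ lform_lbridge.
Qed.

(** The test functional: covariance with W(t+h) + W(t-h) - 2W(t) detects the kink of the covariance
    function at t. *)
Definition ldiff2 (t h : R) : seq (R * R) := [:: (1, t + h); (1, t - h); (-2, t)].

Let q (h x : R) : R := `|x + h| `^ (2 * H) + `|x - h| `^ (2 * H) - 2 * `|x| `^ (2 * H).

Let lcov_ldiff2 s t h : lcov H [:: (1, s)] (ldiff2 t h) =
  ((t + h) `^ (2 * H) + (t - h) `^ (2 * H) - 2 * t `^ (2 * H) - q h (t - s)) / 2.
Proof.
rewrite /lcov /ldiff2 !big_cons !big_nil /fcov /q/=.
rewrite (_ : t - s + h = t + h - s); last by ring.
by rewrite (_ : t - s - h = t - h - s); [field|ring].
Qed.

(** Away from 0 the function |x|^(2H) is smooth and its second difference is O(h^2), against 2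
    h^(2H) at 0. *)
Let q_le (h x x0 : R) : 0 < h -> h <= x0 -> x0 + x0 <= x -> `|q h x| <= 2 * x0 `^ (2 * H - 2) * h ^+ 2.
Proof.
have [HH0 HH1] := andP H01; move=> h0 hx0; have [u ->] : exists u, x = u + h by exists (x - h); rewrite subrK.
move=> xx; have u0 : x0 <= u by lra.
have x00 : 0 < x0 by exact: lt_le_trans hx0.
have u00 : 0 < u by exact: lt_le_trans u0.
have [p1 p2] : 0 <= u + h + h /\ 0 <= u + h by split; lra.
rewrite /q addrK (ger0_norm p1) (ger0_norm p2) (gtr0_norm u00).
have H22 : 2 * H <= 2 by lra.
have := powR_diff2_le H22 u00 (ltW h0) (ltW h0).
rewrite (_ : _ - _ - _ + _ = (u + h + h) `^ (2 * H) + u `^ (2 * H) - 2 * (u + h) `^ (2 * H)); last by ring.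
move=> h1; apply: (le_trans h1).
have HH : `|2 * H * (2 * H - 1)| <= 2 by rewrite ler_norml; apply/andP; split; nra.
have uu : u `^ (2 * H - 2) <= x0 `^ (2 * H - 2).
  have -> : 2 * H - 2 = - (2 - 2 * H) by ring.
  rewrite !powRN lef_pV2 ?posrE ?powR_gt0//.
  have e0 : 0 <= 2 - 2 * H by lra.
  by apply: (ge0_ler_powR e0); rewrite // nnegrE ltW.
rewrite (_ : _ * h * h * _ = `|2 * H * (2 * H - 1)| * u `^ (2 * H - 2) * h ^+ 2); last by ring.
by rewrite ler_wpM2r ?sqr_ge0//; apply: ler_pM => //; exact: powR_ge0.
Qed.

(** The weights alpha^(-m) = b^(Km) grow, so a bound O(h^2) at each end of the first cell would not
    sum. The difference of the two ends gains the cell length b^(-m), and K < 1 gives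
    convergence. *)
Let q_diff_le (h x s x0 : R) : 0 < h -> h <= x0 -> x0 + x0 <= x -> 0 <= s ->
  `|q h (x + s) - q h x| <= 4 * x0 `^ (2 * H - 3) * h ^+ 2 * s.
Proof.
have [HH0 HH1] := andP H01; move=> h0 hx0; have [u ->] : exists u, x = u + h by exists (x - h); rewrite subrK.
move=> xx s0; have u0 : x0 <= u by lra.
have x00 : 0 < x0 by exact: lt_le_trans hx0.
have u00 : 0 < u by exact: lt_le_trans u0.
have [p1 p2] : 0 <= u + h + h /\ 0 <= u + h by split; lra.
have [p3 [p4 p5]] : 0 <= u + s + h + h /\ 0 <= u + s + h /\ 0 <= u + s.
  by split; [lra|split; lra].
rewrite (_ : u + h + s = u + s + h); last by ring.
rewrite /q !addrK (ger0_norm p1) (ger0_norm p2) (gtr0_norm u00) (ger0_norm p3) (ger0_norm p4) (ger0_norm p5).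
have H23 : 2 * H <= 3 by lra.
have := powR_diff3_le H23 u00 s0 (ltW h0) (ltW h0).
set X := `|_| <= _; rewrite (_ : `| _ - (_ + _ - _)| = `|(u + s + h + h) `^ (2 * H) -
  (u + s + h) `^ (2 * H) - (u + s + h) `^ (2 * H) + (u + s) `^ (2 * H) -
  ((u + h + h) `^ (2 * H) - (u + h) `^ (2 * H) - (u + h) `^ (2 * H) + u `^ (2 * H))|);
  last by congr `|_|; ring.
rewrite /X => h1; apply: (le_trans h1).
have HH : `|2 * H * (2 * H - 1) * (2 * H - 2)| <= 4.
  have h2 : `|2 * H * (2 * H - 1)| <= 2 by rewrite ler_norml; apply/andP; split; nra.
  have h3 : `|2 * H - 2| <= 2 by rewrite ler_norml; lra.
  by rewrite normrM (_ : 4 = 2 * 2) ?ler_pM//; ring.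
have uu : u `^ (2 * H - 3) <= x0 `^ (2 * H - 3).
  have -> : 2 * H - 3 = - (3 - 2 * H) by ring.
  rewrite !powRN lef_pV2 ?posrE ?powR_gt0//.
  have e0 : 0 <= 3 - 2 * H by lra.
  by apply: (ge0_ler_powR e0); rewrite // nnegrE ltW.
have hs : 0 <= h ^+ 2 * s by rewrite mulr_ge0 ?sqr_ge0.
rewrite (_ : _ * h * h * s * _ = `|2 * H * (2 * H - 1) * (2 * H - 2)| * u `^ (2 * H - 3) * (h ^+ 2 * s)); last by ring.
rewrite -[leRHS]mulrA ler_wpM2r//; apply: ler_pM => //; exact: powR_ge0.
Qed.

Let alphaX m : (alpha ^+ m)^-1 = (B `^ K) ^+ m.
Proof. by rewrite powRN exprVn invrK. Qed.

(** Cauchy-Schwarz against one fixed form [Y]: the covariance with [Y] stays below -L for all M,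
    while the variance of [Y] does not depend on M. *)
Lemma lcov_lorigin_ge : exists2 c0 : R, 0 < c0 &
  forall M, c0 <= lcov H (lorigin M.+1) (lorigin M.+1).
Proof.
have [K0 K1] := andP K01; have [HH0 HH1] := andP H01; have Kt := Ktau.
have [Ck hCk] := incr_holder b0 kappa_tau.
pose t := B^-1; have t0 : 0 < t by rewrite invr_gt0.
have t2 : t <= 1 / 2 by rewrite div1r lef_pV2 ?posrE// ler_nat.
(* The other times involved, 0, 1 and b^(-m) with m >= 2, are at distance at least t/2 = 2 x0 from t
   = 1/b. *)
pose x0 := t / 4; have x00 : 0 < x0 by rewrite divr_gt0.
pose Q := 2 * x0 `^ (2 * H - 2); pose Q3 := 4 * x0 `^ (2 * H - 3).
have Q0 : 0 <= Q by rewrite mulr_ge0// powR_ge0.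
have Q30 : 0 <= Q3 by rewrite mulr_ge0// powR_ge0.
(* Ratios of two geometric series, [a1] from the smooth covariances and [a2] from the increments of
   [kappa]; they are below 1 by K < 1 and K < tau. *)
pose a1 := B `^ K * B^-1; pose a2 := B `^ K * B `^ (- tau).
have lt1 (x : R) : 0 < x -> 0 <= B `^ (- x) < 1.
  by move=> /(powRN_lt1 B1) /andP[/ltW -> ->].
have a1lt : 0 <= a1 < 1.
  rewrite /a1 -[B^-1](powR_inv1 (ltW B0)) -powRD ?(gt_eqF B0) ?implybT//.
  by rewrite (_ : K + -1 = - (1 - K)); [apply: lt1; lra|ring].
have a2lt : 0 <= a2 < 1.
  rewrite /a2 -powRD ?(gt_eqF B0) ?implybT//.
  by rewrite (_ : K + - tau = - (tau - K)); [apply: lt1; lra|ring].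
pose D := B `^ K * Q + (1 - a1)^-1 * Q3 + (1 - a2)^-1 * (`|Ck| * Q).
have D0 : 0 <= D.
  have d1 : 0 <= (1 - a1)^-1 by rewrite invr_ge0 subr_ge0; case/andP: a1lt => _ /ltW.
  have d2 : 0 <= (1 - a2)^-1 by rewrite invr_ge0 subr_ge0; case/andP: a2lt => _ /ltW.
  have BK0 : 0 <= B `^ K by exact: powR_ge0.
  exact: addr_ge0 (addr_ge0 (mulr_ge0 BK0 Q0) (mulr_ge0 d1 Q30)) (mulr_ge0 d2 (mulr_ge0 (normr_ge0 Ck) Q0)).
have e0 : 0 < 2 - 2 * H by lra.
(* Chosen so that D h^(2-2H) <= b^K/2: the terms of order h^2 then take at most half of the main
   term b^K h^(2H). *)
pose h1 := (B `^ K / (2 * (D + 1))) `^ (2 - 2 * H)^-1.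
have BK : 0 < B `^ K by exact: powR_gt0.
have h10 : 0 < h1 by rewrite powR_gt0// divr_gt0// mulr_gt0// ltr_wpDl.
pose h := Num.min x0 h1.
have h0 : 0 < h by rewrite lt_min x00.
have hx : h <= x0 by rewrite ge_min lexx.
have hh1 : h <= h1 by rewrite ge_min lexx orbT.
pose Y := ldiff2 t h.
have Y0 : nonneg_times Y.
  by rewrite /nonneg_times/= !andbT; apply/and3P; split; move: hx; rewrite /x0; lra.
(* The first term of the origin sum is centred at the same point 1/b as [Y], which makes its
   covariance with [Y] of exact order h^(2H); all other terms are smooth there and only
   contribute O(h^2). *)
have cov m : lcov H (lbridge m) Y = - q h (t - (B ^+ m)^-1) / 2 + q h t / 2
   - incr b kappa m 0 * (q h t - q h (t - 1)) / 2.
  have -> : lbridge m = [:: (1, 1%:R / B ^+ m)] ++ lscale (-1) [:: (1, 0)]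
      ++ lscale (- incr b kappa m 0) [:: (1, 1)].
    by rewrite /lbridge /linc /lscale/= !mulr1 mul0r.
  rewrite !lcov_catl !lcovZl !lcov_ldiff2 subr0 div1r.
  have AE : (t + h) `^ (2 * H) + (t - h) `^ (2 * H) - 2 * t `^ (2 * H) = q h t.
    have [p1 p2] : 0 <= t + h /\ 0 <= t - h by split; move: hx; rewrite /x0; lra.
    by rewrite /q (ger0_norm p1) (ger0_norm p2) (gtr0_norm t0).
  by rewrite !AE; field.
have qN x : q h (- x) = q h x.
  rewrite /q -opprB !normrN (_ : - x - h = - (x + h)); last by ring.
  by rewrite normrN opprB (addrC (`|_| `^ _)) (_ : - x + h = - (x - h)) ?normrN//; ring.
have xt : x0 + x0 <= t / 2 by rewrite /x0; lra.
have qt : `|q h t| <= Q * h ^+ 2 by apply: q_le => //; lra.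
have qt1 : `|q h (t - 1)| <= Q * h ^+ 2.
  by rewrite -opprB qN; apply: q_le => //; lra.
have kdiff m : `|incr b kappa m 0 * (q h t - q h (t - 1)) / 2|
    <= `|Ck| * (B `^ (- tau)) ^+ m * (Q * h ^+ 2).
  rewrite -mulrA normrM; apply: ler_pM => //.
    apply: le_trans (hCk m 0%N _) _; first by rewrite expn_gt0 b0.
    by rewrite ler_wpM2r ?exprn_ge0 ?powR_ge0// ler_norm.
  rewrite normrM [`|2^-1|]ger0_norm//; have := ler_normB (q h t) (q h (t - 1)); lra.
have h2 : 0 <= h ^+ 2 := sqr_ge0 h.
have cov1 : lcov H (lbridge 1) Y <= - h `^ (2 * H) + Q * h ^+ 2 + `|Ck| * (B `^ (- tau)) ^+ 1 * (Q * h ^+ 2).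
  rewrite cov expr1 subrr {1}/q add0r sub0r normrN normr0 powR0 ?mulf_neq0 ?(gt_eqF H0)//.
  rewrite mulr0 subr0 (gtr0_norm h0); move: (kdiff 1%N) qt; rewrite expr1 !ler_norml; lra.
have cov2 m : lcov H (lbridge m.+2) Y <=
    Q3 * h ^+ 2 * (B ^+ m.+2)^-1 + `|Ck| * (B `^ (- tau)) ^+ m.+2 * (Q * h ^+ 2).
  have Bt : (B ^+ m.+2)^-1 <= t / 2.
    rewrite exprS invfM -/t ler_wpM2l ?(ltW t0)//.
    rewrite lef_pV2 ?posrE// exprS; apply: (@le_trans _ _ (B * 1)).
      by rewrite mulr1 ler_nat.
    by rewrite ler_wpM2l ?(ltW B0)// exprn_ege1// ltW.
  have xm : x0 + x0 <= t - (B ^+ m.+2)^-1 by lra.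
  have := @q_diff_le h (t - (B ^+ m.+2)^-1) (B ^+ m.+2)^-1 x0 h0 hx xm.
  rewrite invr_ge0 (ltW (Bn _)) subrK => /(_ isT) qd.
  have p1 : 0 <= Q3 * h ^+ 2 * (B ^+ m.+2)^-1 by rewrite divr_ge0 ?(ltW (Bn _))// mulr_ge0.
  rewrite cov; move: (kdiff m.+2) qd; rewrite -/Q3 !ler_norml; lra.
pose V := lcov H Y Y.
have V0 : 0 <= V by exact: (lcov_ge0 fbmW Y0).
pose L := B `^ K * h `^ (2 * H) / 2.
have L0 : 0 < L by rewrite divr_gt0// mulr_gt0// powR_gt0.
(* V + 1 instead of [V] keeps the denominator positive. *)
exists (L ^+ 2 / (V + 1)); first by rewrite divr_gt0 ?exprn_gt0// ltr_wpDl.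
move=> M.
have covM : lcov H (lorigin M.+1) Y <= - L.
  rewrite /lorigin lcov_flattenl -[X in iota 0 X](subn0 M.+1) -[iota _ _]/(index_iota 0 M.+1) big_mkord.
  have S1 : \sum_(m < M) a1 ^+ m.+2 <= (1 - a1)^-1.
    apply: le_trans (sum_geo_le M a1lt); apply: ler_sum => m _.
    have [a10 /ltW a11] := andP a1lt.
    by rewrite !exprS mulrA ler_piMl ?exprn_ge0// mulr_ile1.
  have S2 : \sum_(m < M.+1) a2 ^+ m.+1 <= (1 - a2)^-1.
    apply: le_trans (sum_geo_le M.+1 a2lt); apply: ler_sum => m _.
    have [a20 /ltW a21] := andP a2lt.
    by rewrite !exprS ler_piMl ?exprn_ge0.
  apply: (@le_trans _ _ (B `^ K * (- h `^ (2 * H) + Q * h ^+ 2) + \sum_(m < M) a1 ^+ m.+2 * (Q3 * h ^+ 2)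
     + \sum_(m < M.+1) a2 ^+ m.+1 * (`|Ck| * (Q * h ^+ 2)))).
    rewrite big_ord_recl [X in _ <= _ + X]big_ord_recl.
    rewrite addrACA -big_split; apply: lerD.
      rewrite lcovZl alphaX expr1; apply: le_trans (ler_wpM2l (ltW BK) cov1) _.
      by rewrite le_eqVlt; apply/orP; left; apply/eqP; rewrite /a2 !expr1; ring.
    apply: ler_sum => m _; rewrite lcovZl alphaX.
    apply: le_trans (ler_wpM2l (exprn_ge0 _ (ltW BK)) (cov2 m)) _.
    rewrite [X in _ <= X](_ : _ = a1 ^+ m.+2 * (Q3 * h ^+ 2) + a2 ^+ m.+2 * (`|Ck| * (Q * h ^+ 2)))//.
    rewrite (_ : (lift ord0 m).+1 = m.+2)// le_eqVlt; apply/orP; left; apply/eqP.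
    by rewrite /a1 /a2 !exprMn exprVn; ring.
  rewrite -!big_distrl/=.
  have hh : D * h ^+ 2 <= L.
    have hE : h ^+ 2 = h `^ (2 - 2 * H) * h `^ (2 * H).
      rewrite -powRD ?(gt_eqF h0) ?implybT// -powR_mulrn ?(ltW h0)//.
      by congr (_ `^ _); ring.
    have hp : h `^ (2 - 2 * H) <= B `^ K / (2 * (D + 1)).
      apply: (@le_trans _ _ (h1 `^ (2 - 2 * H))).
        by apply: (ge0_ler_powR (ltW e0)); rewrite // nnegrE ltW.
      rewrite /h1 -powRrM mulVf ?gt_eqF// powRr1// divr_ge0 ?(ltW BK)//.
      by rewrite mulr_ge0// addr_ge0.
    rewrite hE /L mulrA [leRHS]mulrAC ler_wpM2r ?powR_ge0//.
    apply: le_trans (ler_wpM2l D0 hp) _.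
    rewrite mulrCA ler_wpM2l ?(ltW BK)// invfM mulrCA -[leRHS]mulr1 ler_wpM2l//.
    by rewrite ler_pdivrMr ?mul1r ?lerDl// ltr_wpDl.
  have m1 := ler_wpM2r (mulr_ge0 Q30 h2) S1.
  have m2 := ler_wpM2r (mulr_ge0 (normr_ge0 Ck) (mulr_ge0 Q0 h2)) S2.
  move: hh m1 m2; rewrite /D /L; lra.
have := lcov_CauchySchwarz fbmW (nonneg_times_lorigin M.+1) Y0.
rewrite -/V => cs; rewrite ler_pdivrMr ?ltr_wpDl//.
have v0 := lcov_ge0 fbmW (nonneg_times_lorigin M.+1).
apply: (@le_trans _ _ (lcov H (lorigin M.+1) Y ^+ 2)).
  rewrite -[X in _ <= X]sqrrN; apply: lerXn2r; rewrite ?nnegrE ?(ltW L0)//; lra.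
by apply: (le_trans cs); rewrite ler_wpM2l// lerDl.
Qed.

End VarianceLowerBound.

(** * Limits of Gaussian variables have no atom at 0 *)

Section LimitNonzero.
Context {R : realType} {d : measure_display} {T : measurableType d}.
Variable P : probability T R.

(** A version of the limit that is defined and measurable everywhere and equals the limit wherever
    the sequence converges. *)
Definition limsup_real (u : nat -> T -> R) (w : T) : R :=
  fine (limn_esup (fun n => (u n w)%:E)).

Lemma measurable_limsup_real (u : nat -> T -> R) :
  (forall n, measurable_fun setT (u n)) -> measurable_fun setT (limsup_real u).
Proof.
move=> mu; apply: (@measurableT_comp _ _ _ _ _ _ fine); first exact: fine_measurable.
by apply: measurable_fun_limn_esup => n; exact/measurable_EFinP.
Qed.

Lemma limsup_realE (u : nat -> T -> R) w (l : R) :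
  u n w @[n --> \oo] --> l -> limsup_real u w = l.
Proof.
move=> ul; have uE : (fun n => (u n w)%:E) @ \oo --> l%:E.
  by apply: cvg_EFin => //; exact: nearW.
rewrite /limsup_real is_cvg_limn_esupE; last exact: cvgP uE.
by move/cvg_lim : uE => ->.
Qed.

(* Dominates the indicator of {0}, while its Gaussian integrals are of order 1/N for large [la]. *)
Definition fejer (N : nat) (la x : R) : R :=
  (N%:R^-1 * \sum_(j < N) cos (j%:R * la * x)) ^+ 2.

Lemma fejer_ge0 N la x : 0 <= fejer N la x. Proof. exact: sqr_ge0. Qed.

Lemma fejer_le1 N la x : (0 < N)%N -> fejer N la x <= 1.
Proof.
move=> N0; have NR : 0 < N%:R :> R by rewrite ltr0n.
rewrite /fejer -real_normK ?num_real// expr_le1// normrM [`|_^-1|]ger0_norm ?invr_ge0//.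
rewrite mulrC ler_pdivrMr// mul1r; apply: le_trans (ler_norm_sum _ _ _) _.
apply: (@le_trans _ _ (\sum_(j < N) 1)); first by apply: ler_sum => j _; exact: cos_max.
by rewrite sumr_const card_ord.
Qed.

Lemma fejer0 N la : (0 < N)%N -> fejer N la 0 = 1.
Proof.
move=> N0; rewrite /fejer; under eq_bigr do rewrite mulr0 cos0.
by rewrite sumr_const card_ord mulVf ?expr1n// pnatr_eq0 -lt0n.
Qed.

Lemma continuous_fejer N la : continuous (fejer N la).
Proof.
move=> x; rewrite /fejer.
have cS : {for x, continuous (fun y : R => N%:R^-1 * \sum_(j < N) cos (j%:R * la * y))}.
  apply: cvgMl_tmp; apply: (@cvg_big _ _ +%R 0 xpredT) => [|j _]; first exact: add_continuous.
  apply: (@continuous_comp _ _ _ (fun y : R => j%:R * la * y) cos); last exact: continuous_cos.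
  exact: mulrl_continuous.
under [X in continuous_at _ X]eq_fun do rewrite expr2.
exact: cvgM.
Qed.

(** Expanding the square gives N diagonal terms with expectation at most 1; elsewhere the
    frequencies j + l and |j - l| are at least 1, and [la] makes their characteristic values at most
    1/N. *)
Lemma integral_fejer_le (xi : T -> R) (v c0 la : R) N : gaussian_var P xi v -> c0 <= v ->
  (0 < N)%N -> expR (- (la ^+ 2 * c0 / 2)) <= N%:R^-1 ->
  \int[P]_w fejer N la (xi w) <= 2 / N%:R.
Proof.
move=> [mxi v0 cxi] cv N0 laN; have NR : 0 < N%:R :> R by rewrite ltr0n.
have N10 : 0 <= N%:R^-1 :> R by rewrite invr_ge0.
have icos (a : R) : P.-integrable setT (EFin \o (fun w => cos (a * xi w))).
  apply: (@integrable_boundedP _ _ _ P _ 1); last by move=> w; exact: cos_max.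
  by apply: measurable_cos_comp; exact: measurable_funM.
pose G (j l : nat) w := 2^-1 * cos ((j%:R + l%:R) * la * xi w) + 2^-1 * cos ((j%:R - l%:R) * la * xi w).
have iG j l : P.-integrable setT (EFin \o G j l).
  exact: (integrableD measurableT (integrableZlR _ (icos _)) (integrableZlR _ (icos _))).
have -> : (fun w => fejer N la (xi w)) = (fun w => N%:R^-1 ^+ 2 * \sum_(j < N) \sum_(l < N) G j l w).
  apply/funext => w; rewrite /fejer exprMn; congr (_ * _); rewrite expr2 big_distrl/=.
  apply: eq_bigr => j _; rewrite big_distrr/=; apply: eq_bigr => l _.
  by rewrite /G !(mulrBl, mulrDl) cosD cosB; field.
rewrite RintegralZl//; last by apply: integrable_sumR => j; exact: integrable_sumR.
rewrite Rintegral_sum; last by move=> j; exact: integrable_sumR.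
under eq_bigr do rewrite Rintegral_sum//.
have ecos (a : R) : \int[P]_w cos (a * la * xi w) <= 1.
  by rewrite cxi -[leRHS]expR0 ler_expR oppr_le0 divr_ge0// mulr_ge0// sqr_ge0.
have ecos1 (a : R) : 1 <= a ^+ 2 -> \int[P]_w cos (a * la * xi w) <= N%:R^-1.
  move=> a1; rewrite cxi; apply: le_trans laN; rewrite ler_expR lerN2 ler_pM2r ?invr_gt0//.
  rewrite exprMn; apply: (@le_trans _ _ (la ^+ 2 * v)); first by rewrite ler_wpM2l ?sqr_ge0.
  have lv : 0 <= la ^+ 2 * v by rewrite mulr_ge0 ?sqr_ge0.
  by rewrite -[leRHS]mulrA; exact: ler_peMl.
have eG (j l : nat) : \int[P]_w G j l w <= (j == l)%:R + N%:R^-1.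
  rewrite /G RintegralD//; last 2 first.
  - exact: integrableZlR.
  - exact: integrableZlR.
  rewrite !RintegralZl//.
  have [->|jl] /= := eqVneq j l.
    rewrite mulr1n; have := ecos (l%:R + l%:R); have := ecos (l%:R - l%:R); by have := N10; lra.
  have sq1 (x : R) : 1 <= x -> 1 <= x ^+ 2 by move=> x1; rewrite exprn_ege1.
  have h1 : 1 <= (j%:R - l%:R : R) ^+ 2.
    case: (ltngtP j l) jl => // jl _.
      by rewrite -sqrrN opprB sq1// lerBrDr -[1]/(1%:R) -natrD ler_nat.
    by rewrite sq1// lerBrDr -[1]/(1%:R) -natrD ler_nat.
  have h2 : 1 <= (j%:R + l%:R : R) ^+ 2.
    rewrite -natrD sq1// -[1]/(1%:R) ler_nat lt0n addn_eq0; apply: contraNN jl.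
    by case/andP => /eqP -> /eqP ->.
  have := ecos1 _ h1; have := ecos1 _ h2; rewrite mulr0n add0r; lra.
apply: (@le_trans _ _ (N%:R^-1 ^+ 2 * \sum_(j < N) \sum_(l < N) ((j == l :> nat)%:R + N%:R^-1))).
  by rewrite ler_wpM2l ?sqr_ge0//; apply: ler_sum => j _; apply: ler_sum => l _; exact: eG.
under eq_bigr => j _.
  rewrite big_split/= (bigD1 j)//= eqxx big1 ?addr0; last first.
    by move=> l lj; rewrite eq_sym (negbTE (_ : (l : nat) != j)).
  rewrite sumr_const card_ord -[_ *+ N]mulr_natl mulfV ?gt_eqF// mulr1n; over.
rewrite sumr_const card_ord -[(1 + 1) *+ N]mulr_natl le_eqVlt; apply/orP; left; apply/eqP.
by field; rewrite gt_eqF.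
Qed.

(** The kernels equal 1 where the limit is 0, yet their integrals, carried over from [xi M] to the
    limit by dominated convergence, are summable; so almost surely they tend to 0. The common lower
    bound [c0] makes one choice of [la] valid for every M. *)
Lemma gaussian_limit_neq0 (xi : nat -> T -> R) (v : nat -> R) (c0 : R) : 0 < c0 ->
  (forall n, gaussian_var P (xi n) (v n)) -> (forall n, c0 <= v n) ->
  {ae P, forall w, cvgn (fun n => xi n w)} ->
  {ae P, forall w, forall z : R, xi n w @[n --> \oo] --> z -> z != 0}.
Proof.
move=> c00 g cv cxi; pose S := limsup_real xi.
have mS : measurable_fun setT S by apply: measurable_limsup_real => n; case: (g n).
have mF N la : measurable_fun setT (fejer N la).
  by apply: continuous_measurable_fun; exact: continuous_fejer.
(* N = 2^n makes the bounds 2/N summable; the frequency is such that exp(-la^2 c0/2) = exp(-2^n) <=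
   2^(-n). *)
pose f n w := fejer (2 ^ n) (Num.sqrt (2 * (2 ^ n)%:R / c0)) (S w).
have mf n : measurable_fun setT (f n) by exact: measurableT_comp.
have n2 n : (0 < 2 ^ n)%N by rewrite expn_gt0.
have fC n : (\int[P]_w (f n w)%:E <= (2 * 2^-1 ^+ n)%:E)%E.
  set la := Num.sqrt (2 * (2 ^ n)%:R / c0).
  have laE : expR (- (la ^+ 2 * c0 / 2)) <= ((2 ^ n)%N%:R)^-1.
    rewrite sqr_sqrtr; last by rewrite divr_ge0 ?mulr_ge0 ?(ltW c00).
    have -> : 2 * (2 ^ n)%:R / c0 * c0 / 2 = (2 ^ n)%:R by field; rewrite gt_eqF.
    rewrite expRN lef_pV2 ?posrE ?expR_gt0 ?ltr0n//.
    by apply: le_trans (expR_ge1Dx _); rewrite lerDr.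
  have [] := @dominated_convergence _ _ _ P setT measurableT
    (fun M w => (fejer (2 ^ n) la (xi M w))%:E) (fun w => (f n w)%:E) (fun=> 1%:E).
  - by move=> M; apply/measurable_EFinP; apply: measurableT_comp => //; case: (g M).
  - exact/measurable_EFinP.
  - apply: filterS cxi => w cw _; apply: cvg_EFin; first exact: nearW.
    rewrite /f -/la; apply: continuous_cvg; first exact: continuous_fejer.
    by rewrite /S (limsup_realE cw).
  - exact: finite_measure_integrable_cst.
  - by apply: aeW => w M _ /=; rewrite lee_fin ger0_norm ?fejer_ge0// fejer_le1.
  move=> _ _ cI; rewrite -(cvg_lim _ cI)//; apply: lime_le; first exact: cvgP cI.
  apply: nearW => M; rewrite /= -EFin_Rintegral.
    rewrite lee_fin; apply: le_trans (integral_fejer_le (g M) (cv M) (n2 n) laE) _.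
    by rewrite natrX exprVn.
  apply: (@integrable_boundedP _ _ _ P _ 1).
    by apply: measurableT_comp => //; case: (g M).
  by move=> w; rewrite ger0_norm ?fejer_ge0// fejer_le1.
have h2 : 0 <= (2^-1 : R) < 1 by rewrite invr_ge0 ler0n invf_lt1 ?ltr1n.
have := ae_cvg0_geometric mf (fun n w => fejer_ge0 _ _ _) h2 fC.
apply: filterS => w fw z xz; apply/eqP => z0; move: xz; rewrite z0 => x0.
have f1 : (fun n => f n w) = fun=> 1.
  by apply/funext => n; rewrite /f /S (limsup_realE x0) fejer0.
move: fw; rewrite f1 => /(cvg_unique (@norm_hausdorff _ _) (cvg_cst _))/eqP.
by rewrite oner_eq0.
Qed.

End LimitNonzero.

(** * Convergence of the rescaled increments *)

Section ScaledSums.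
Context {R : realType}.
Variables (b : nat) (alpha : R) (f : R -> R).
Hypotheses (b0 : (0 < b)%N) (alpha0 : 0 < alpha).

Definition scaled_wsum n k : R := (alpha ^+ n)^-1 * wsum b alpha f n k.

Lemma scaled_wsum0 k : scaled_wsum 0 k = 0.
Proof. by rewrite /scaled_wsum /wsum big_ord0 mulr0. Qed.

(** With [k] fixed, the next order only adds the term of finest order and all others persist, so the
    rescaled increments are partial sums of one series. *)
Lemma scaled_wsumS n k : scaled_wsum n.+1 k =
  scaled_wsum n k + (alpha ^+ n.+1)^-1 * incr b f n.+1 (k %% b ^ n.+1).
Proof.
rewrite /scaled_wsum /wsum big_ord_recl expr0 mul1r subn0 mulrDr addrC; congr (_ + _).
rewrite exprS invfM -mulrA mulrCA; congr (_ * _); rewrite big_distrr/=.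
apply: eq_bigr => i _; rewrite /bump/= add1n subSS exprS.
by field; rewrite gt_eqF.
Qed.

Lemma scaled_wsum_cauchy C th : 0 <= th < alpha ->
  (forall m j, (j < b ^ m)%N -> `|incr b f m j| <= C * th ^+ m) ->
  forall M n k, (M <= n)%N ->
  `|scaled_wsum n k - scaled_wsum M k| <= C / (1 - th / alpha) * (th / alpha) ^+ M.
Proof.
move=> /andP[th0 tha] hf M n k /subnKC <-; move: (n - M)%N => m {n}.
pose rho := th / alpha; rewrite -/rho.
have rho01 : 0 <= rho < 1 by rewrite divr_ge0 ?(ltW alpha0)//= ltr_pdivrMr// mul1r.
have [rho0 rho1] := andP rho01.
have C0 : 0 <= C by have := hf 0%N 0%N isT; rewrite expr0 mulr1; exact: le_trans.
apply: (@le_trans _ _ (C * rho ^+ M * \sum_(i < m) rho ^+ i)); last first.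
  rewrite [leRHS]mulrAC; apply: ler_wpM2l; last exact: sum_geo_le.
  by rewrite mulr_ge0// exprn_ge0.
elim: m => [|m IH]; first by rewrite addn0 subrr normr0 big_ord0 mulr0.
rewrite addnS scaled_wsumS addrAC big_ord_recr/= [leRHS]mulrDr.
apply: le_trans (ler_normD _ _) _; apply: lerD => //.
rewrite normrM gtr0_norm ?invr_gt0 ?exprn_gt0//.
have /(hf (M + m).+1) h : (k %% b ^ (M + m).+1 < b ^ (M + m).+1)%N by rewrite ltn_mod expn_gt0 b0.
apply: le_trans (ler_wpM2l _ h) _; first by rewrite invr_ge0 exprn_ge0 ?ltW.
rewrite mulrCA -[leRHS]mulrA -exprD ler_wpM2l// mulrC -expr_div_n -/rho exprS.
by rewrite ler_piMl ?exprn_ge0// ltW.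
Qed.

End ScaledSums.

Section Supercritical.
Context {R : realType} {d : measure_display} {T : measurableType d}.
Variables (P : probability T R) (H : R) (W : R -> T -> R) (b : nat).
Hypotheses (fbmW : is_fBm P H W) (H01 : 0 < H < 1) (b2 : (2 <= b)%N).
Variables (kappa : R -> R) (tau : R).
Hypotheses (kappa_tau : holder01 kappa tau) (Htau : H < tau).
Notation B := (b%:R : R).
Notation br w := (fun t => fbridge W kappa t w).

Let b0 : (0 < b)%N. Proof. exact: leq_trans b2. Qed.
Let B1 : 1 < B. Proof. by rewrite ltr1n. Qed.
Let B0 : 0 < B. Proof. by rewrite ltr0n. Qed.

Lemma measurable_wsum_fbridge alpha n k :
  measurable_fun setT (fun w => wsum b alpha (br w) n k).
Proof.
have [mW _] := fbmW; apply: measurable_sum => i; apply: measurable_funM => //.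
by apply: measurable_funB; apply: measurable_funB => //; exact: measurable_funM.
Qed.

(** A convolution of two decaying rates, for every alpha in (0,1). This is the uniform smallness
    that [psum_other_exponent] needs in both regimes. *)
Lemma wsum_fbridge_unif_cvg0 alpha : 0 < alpha < 1 ->
  {ae P, forall w, exists e : nat -> R,
    (forall n k, `|wsum b alpha (br w) n k| <= e n) /\ e @ \oo --> (0 : R)}.
Proof.
move=> /andP[a0 a1]; have [H0 H1] := andP H01.
pose gam := H / 2; have gam0 : 0 < gam by rewrite divr_gt0.
have gH : gam < H by rewrite /gam; lra.
have gt : gam <= tau by have := Htau; lra.
have := fbridge_adic_holder fbmW H01 b2 kappa_tau gH gt; apply: filterS => w [C hC].
have a01 : 0 <= alpha < 1 by rewrite ltW.
have th01 : 0 <= B `^ (- gam) < 1 by have /andP[/ltW -> ->] := powRN_lt1 B1 gam0.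
have [rho [C' [/andP[rho0 rho1] C'0 hC']]] := sum_geo_conv a01 th01.
have C0 : 0 <= C by have := hC 0%N 0%N isT; rewrite expr0 mulr1; exact: le_trans.
exists (fun n => C * C' * rho ^+ n); split.
  move=> n k; apply: le_trans (wsum_le n k b0 (ltW a0) hC) _.
  by rewrite -mulrA ler_wpM2l.
rewrite -[X in _ --> X](mulr0 (C * C')); apply: cvgMl_tmp.
by apply: cvg_expr; rewrite gtr0_norm.
Qed.

Variable K : R.
Hypotheses (K0 : 0 < K) (KH : K < H).
Notation alpha := (B `^ (- K)).
Notation Z w := (scaled_wsum b alpha (br w)).

Lemma scaled_wsum_lorigin n w : Z w n 0 = lform W (lorigin b kappa K n) w.
Proof.
rewrite lform_lorigin; elim: n => [|n IH]; first by rewrite scaled_wsum0 big_ord0.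
rewrite scaled_wsumS ?powR_gt0// IH big_ord_recr/=.
by rewrite mod0n.
Qed.

Lemma wsum_fbridge_pvar_random : exists V : T -> R, [/\ measurable_fun setT V,
  {ae P, forall w, 0 < V w} &
  {ae P, forall w, forall t, 0 <= t <= 1 ->
    \sum_(k < Num.truncn (t * B ^+ n)) `|wsum b alpha (br w) n k| `^ K^-1 @[n --> \oo] --> V w * t}].
Proof.
have [H0 H1] := andP H01; have KHh := KH; have K0h := K0.
have a0 : 0 < alpha by rewrite powR_gt0.
have p1 : 1 <= K^-1 by rewrite invf_ge1//; lra.
(* Strictly between: below [H] the bridge is Hoelder of this order on the grid, above [K] the rate
   b^(-gam) beats alpha. *)
pose gam := (K + H) / 2; have gH : gam < H by rewrite /gam; lra.
have gt : gam <= tau by have := Htau; lra.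
have gK : 0 < gam - K by rewrite /gam; lra.
have th0 : 0 <= B `^ (- gam) < alpha.
  rewrite powR_ge0/= (_ : - gam = - (gam - K) + - K); last by ring.
  rewrite powRD ?(gt_eqF B0) ?implybT// gtr_pMl//.
  by have /andP[] := powRN_lt1 B1 gK.
pose th := B `^ (- gam); pose rho := th / alpha.
have rho01 : 0 <= rho < 1.
  case/andP: th0 => h1 h2; rewrite divr_ge0 ?(ltW a0)//= ltr_pdivrMr// mul1r.
  exact: h2.
have holder := fbridge_adic_holder fbmW H01 b2 kappa_tau gH gt.
pose VM M w := (B ^+ M)^-1 * \sum_(j < b ^ M) `|Z w M j| `^ K^-1.
(* An upper limit, so that [V] is measurable without reference to the event of convergence. *)
pose V := limsup_real VM.
have mV : measurable_fun setT V.
  apply: measurable_limsup_real => M; apply: measurable_funM => //; apply: measurable_sum => j.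
  apply: measurable_norm_powR; apply: measurable_funM => //.
  exact: measurable_wsum_fbridge.
have K01 : 0 < K < 1 by apply/andP; split => //; lra.
have Ktau : K < tau by have := Htau; lra.
have [c0 c00 hc0] := lcov_lorigin_ge fbmW H01 b2 kappa_tau Ktau K01.
have mean w : (exists C, forall m j, (j < b ^ m)%N -> `|incr b (br w) m j| <= C * th ^+ m) ->
    cvgn (fun n => Z w n 0) /\ forall z : R, Z w n 0 @[n --> \oo] --> z -> exists v : R,
    [/\ VM M w @[M --> \oo] --> v, (forall t, 0 <= t <= 1 ->
       (B ^+ n)^-1 * (\sum_(k < Num.truncn (t * B ^+ n)) `|Z w n k| `^ K^-1) @[n --> \oo] --> v * t) &
      z != 0 -> 0 < v].
  move=> [C hC]; have Zc := scaled_wsum_cauchy b0 a0 th0 hC.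
  split; last first.
    move=> z Zz; have [] := adic_mean b2 p1 rho01 Zc (scaled_wsum0 b alpha (br w)).
      by move=> M k; rewrite /scaled_wsum wsum_mod.
    by move=> v [v1 v2 v3]; exists v; split => // z0; exact: v3 Zz z0.
  have [r0 r1] := andP rho01.
  have Crho : (fun M => C / (1 - rho) * rho ^+ M) @ \oo --> (0 : R).
    by rewrite -[X in _ --> X](mulr0 (C / (1 - rho))); apply: cvgMl_tmp; apply: cvg_expr; rewrite ger0_norm.
  apply/cauchy_cvgP/cauchy_exP => e e0.
  have [N _ hN] := cvgr_lt _ Crho e e0.
  exists (Z w N 0); exists N => // n /= Nn.
  by rewrite -ball_normE/= distrC; apply: le_lt_trans (Zc _ _ _ Nn) _; apply: hN => /=.
have nz : {ae P, forall w, forall z : R, Z w n 0 @[n --> \oo] --> z -> z != 0}.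
  (* The index is n + 1, as the variance bound concerns forms with at least one term. *)
  have := @gaussian_limit_neq0 _ _ _ P (fun n => lform W (lorigin b kappa K n.+1))
    (fun n => lcov H (lorigin b kappa K n.+1) (lorigin b kappa K n.+1)) c0 c00
    (fun n => gaussian_lform fbmW (nonneg_times_lorigin b2 kappa K n.+1)) hc0.
  have cZ : {ae P, forall w, cvgn (fun n => lform W (lorigin b kappa K n.+1) w)}.
    apply: filterS holder => w /mean[cZ _].
    have -> : (fun n => lform W (lorigin b kappa K n.+1) w) = (fun n => Z w n.+1 0).
      by apply/funext => n; rewrite scaled_wsum_lorigin.
    by apply: (cvgP (limn (fun n => Z w n 0))); rewrite (cvg_shiftS (fun n => Z w n 0)).
  move=> /(_ cZ); apply: filterS => w h z Zz; apply: h.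
  have -> : (fun n => lform W (lorigin b kappa K n.+1) w) = (fun n => Z w n.+1 0).
    by apply/funext => n; rewrite scaled_wsum_lorigin.
  by rewrite (cvg_shiftS (fun n => Z w n 0)).
have all : {ae P, forall w, 0 < V w /\ forall t, 0 <= t <= 1 ->
       (B ^+ n)^-1 * (\sum_(k < Num.truncn (t * B ^+ n)) `|Z w n k| `^ K^-1) @[n --> \oo] --> V w * t}.
  apply: filterS2 holder nz => w /mean[cZ mw] nzw.
  have [v [v1 v2 v3]] := mw _ cZ.
  rewrite /V (limsup_realE v1); split => //.
  by apply: v3; exact: nzw.
exists V; split => //; first by apply: filterS all => w [].
(* alpha^(-n/K) = b^n: rescaling by alpha^(-n) amounts exactly to the normalisation of the mean. *)
have alphaK n : (alpha ^+ n)^-1 `^ K^-1 = B ^+ n.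
  rewrite powRN exprVn invrK -[(B `^ K) ^+ n]powR_mulrn ?powR_ge0// -!powRrM.
  rewrite (_ : K * (n%:R * K^-1) = n%:R); last by field; rewrite gt_eqF.
  by rewrite powR_mulrn ?(ltW B0).
apply: filterS all => w [_ h] t t01.
rewrite (_ : (fun n => _) = (fun n => (B ^+ n)^-1 *
    (\sum_(k < Num.truncn (t * B ^+ n)) `|Z w n k| `^ K^-1))); first exact: h.
apply/funext => n; rewrite big_distrr/=; apply: eq_bigr => k _.
rewrite /scaled_wsum normrM powRM// gtr0_norm ?invr_gt0 ?exprn_gt0// alphaK mulrA.
by rewrite mulVf ?mul1r// gt_eqF// exprn_gt0.
Qed.

End Supercritical.

(** * Assembly of the two regimes *)

Unset Implicit Arguments.
Theorem theorem2p3 (R : realType) (d : measure_display) (T : measurableType d)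
  (P : probability T R) (H alpha tau : R) (b : nat) (W : R -> T -> R)
  (kappa : R -> R) :
  0 < H < 1 -> is_fBm P H W ->
  0 < alpha < 1 -> (2 <= b)%N ->
  (forall t, 0 <= t <= 1 -> 0 <= kappa t <= 1) -> kappa 0 = 0 -> kappa 1 = 1 ->
  H < tau <= 1 -> holder01 kappa tau ->
  let K := Num.min 1 (- (ln alpha / ln b%:R)) in
  H != K ->
  let p := (Num.min H K)^-1 in
  let X := wwbridge W kappa alpha b in
  ({ae P, forall w, forall q : R,
      (0 < q < p -> pvar_is b q (X ^~ w) 1 +oo%E) /\
      (p < q -> pvar_is b q (X ^~ w) 1 0%E)}) /\
  (K < H -> exists V : T -> R, measurable_fun setT V /\
      {ae P, forall w, 0 < V w} /\
      {ae P, forall w, forall t, 0 <= t <= 1 ->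
          pvar_is b K^-1 (X ^~ w) t (V w * t)%:E}) /\
  (H < K ->
      {ae P, forall w, forall t, 0 <= t <= 1 ->
          pvar_is b H^-1 (X ^~ w) t
            ((powR 2 (2 * H)^-1 * Gamma ((H + 1) / (2 * H))
              / (Num.sqrt pi * powR (1 - alpha ^+ 2 * powR b%:R (2 * H)) (2 * H)^-1))
             * t)%:E}).
Proof.
move=> H01 fbmW a01 b2 _ k0 k1 /andP[Htau _] kappa_tau K HK p X.
have [H0 H1] := andP H01; have [a0 a1] := andP a01.
have b0 : (0 < b)%N by exact: leq_trans b2.
have B1 : 1 < b%:R :> R by rewrite ltr1n.
have B0 : 0 < b%:R :> R by rewrite ltr0n.
have lnB : 0 < ln (b%:R : R) by exact: ln_gt0.
have lna : ln alpha < 0 by rewrite ln_lt0// a0.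
have K0 : 0 < K.
  by rewrite lt_min ltr01 oppr_gt0 ltr_pdivrMr// mul0r.
(* [W 0] vanishes only almost surely, so the grid formula for [X] is available on this event. *)
have ends : {ae P, forall w, fbridge W kappa 0 w = 0 /\ fbridge W kappa 1 w = 0}.
  apply: filterS (fbm0_ae fbmW H0) => w w0.
  by rewrite /fbridge k0 k1 w0 mul0r mul1r !subrr.
have pvE w t q : fbridge W kappa 0 w = 0 /\ fbridge W kappa 1 w = 0 ->
    pvar_sum b q (X ^~ w) t = (fun n => \sum_(k < Num.truncn (t * b%:R ^+ n))
      `|wsum b alpha (fun s => fbridge W kappa s w) n k| `^ q).
  by move=> [w0 w1]; apply/funext => n; rewrite pvar_sum_wwbridge.
have pvar_cvg w t q l : fbridge W kappa 0 w = 0 /\ fbridge W kappa 1 w = 0 ->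
    \sum_(k < Num.truncn (t * b%:R ^+ n)) `|wsum b alpha (fun s => fbridge W kappa s w) n k| `^ q @[n --> \oo] --> l ->
    pvar_is b q (X ^~ w) t l%:E.
  by move=> ew h; apply: cvg_EFin; [exact: nearW|rewrite /comp/= (pvE _ _ _ ew)].
(* K < H < 1 forces the minimum defining [K] to be its logarithmic entry. *)
have KHa : K < H -> alpha = b%:R `^ (- K).
  move=> KH; have KE : K = - (ln alpha / ln b%:R).
    by rewrite /K; apply/min_idPr; rewrite leNgt; apply/negP => h; move: KH; rewrite /K min_l ?(ltW h)//; lra.
  by rewrite KE opprK /powR (gt_eqF B0) divfK ?gt_eqF// lnK ?posrE.
(* H < K gives H < -log_b alpha, the same as alpha b^H < 1. *)
have HKb : H < K -> alpha * b%:R `^ H < 1.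
  rewrite lt_min => /andP[_]; rewrite -mulNr ltr_pdivlMr// => h.
  rewrite -ltr_ln ?posrE ?mulr_gt0 ?powR_gt0// ln1 lnM ?posrE ?powR_gt0// ln_powR; lra.
have caseA : K < H -> exists V : T -> R, measurable_fun setT V /\
      {ae P, forall w, 0 < V w} /\
      {ae P, forall w, forall t, 0 <= t <= 1 ->
        \sum_(k < Num.truncn (t * b%:R ^+ n)) `|wsum b alpha (fun s => fbridge W kappa s w) n k| `^ K^-1
        @[n --> \oo] --> V w * t}.
  move=> KH; have [V [V1 V2 V3]] := wsum_fbridge_pvar_random fbmW H01 b2 kappa_tau Htau K0 KH.
  by exists V; rewrite (KHa KH).
have p0 : 0 < p by rewrite invr_gt0 lt_min H0.
(* The remaining exponents need just one finite positive limit, at t = 1 and exponent [p], whichever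
   regime supplies it. *)
have other : {ae P, forall w, exists2 l : R, 0 < l &
    \sum_(k < Num.truncn (1 * (b%:R : R) ^+ n)) `|wsum b alpha (fun s => fbridge W kappa s w) n k| `^ p @[n --> \oo] --> l} ->
  {ae P, forall w, forall q : R,
      (0 < q < p -> pvar_is b q (X ^~ w) 1 +oo%E) /\
      (p < q -> pvar_is b q (X ^~ w) 1 0%E)}.
  move=> hl; have hu := wsum_fbridge_unif_cvg0 fbmW H01 b2 kappa_tau Htau a01.
  move: hl hu ends; apply: filterS3 => w [l l0 hl] [e [e1 e2]] ew q.
  rewrite /pvar_is (pvE _ _ _ ew).
  exact: (psum_other_exponent p0 l0 e1 e2 hl q).
have I1 : 0 <= (1 : R) <= 1 by apply/andP; split; [exact: ler01|exact: lexx].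
split; last split.
- apply: other; have [KH|HK'|/eqP] := ltgtP K H; last by rewrite eq_sym (negbTE HK).
    have [V [mV [V0 hV]]] := caseA KH; apply: filterS2 V0 hV => w Vw h.
    exists (V w) => //; rewrite /p min_r ?ltW//; have := h 1 I1; by rewrite mulr1.
  have := wsum_fbridge_pvar fbmW H01 b2 a0 (HKb HK') kappa_tau Htau.
  apply: filterS => w h; have := h 1 I1; rewrite mulr1 /p min_l ?(ltW HK')// => hc.
  eexists; last exact: hc.
  rewrite mulr_gt0 ?gaussM_gt0 ?invr_gt0// powR_gt0// invr_gt0 subr_gt0.
  by rewrite expr_lt1 ?HKb// mulr_ge0 ?powR_ge0// ltW.
- move=> KH; have [V [mV [V0 hV]]] := caseA KH; exists V; split => //; split => //.
  by apply: filterS2 hV ends => w h ew t t01; apply: pvar_cvg => //; exact: h.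
- move=> HK'; have := wsum_fbridge_pvar fbmW H01 b2 a0 (HKb HK') kappa_tau Htau.
  apply: filterS2 ends => w ew h t t01; apply: pvar_cvg => //.
  (* The limit arrives as v^(p/2) E|N|^p with N standard normal, p = 1/H and v = 1/(1 - alpha^2
     b^(2H)); the rest brings it to the stated form. *)
  have := h t t01; rewrite gaussME ?invf_gt1//.
  have b2H : (alpha * b%:R `^ H) ^+ 2 = alpha ^+ 2 * b%:R `^ (2 * H).
    by rewrite exprMn -[(b%:R `^ H) ^+ 2]powR_mulrn ?powR_ge0// -powRrM (mulrC H).
  have b1 : 0 < 1 - alpha ^+ 2 * b%:R `^ (2 * H).
    by rewrite subr_gt0 -b2H expr_lt1 ?HKb// mulr_ge0 ?powR_ge0// ltW.
  have -> : H^-1 / 2 = (2 * H)^-1 by rewrite -invfM mulrC.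
  have -> : (H^-1 + 1) / 2 = (H + 1) / (2 * H) by field; rewrite gt_eqF.
  rewrite b2H -[X in X `^ _](powR_inv1 (ltW b1)) powRAC powR_inv1 ?powR_ge0//.
  rewrite (_ : _ * (_ / Num.sqrt pi) = 2 `^ (2 * H)^-1 * Gamma ((H + 1) / (2 * H)) /
    (Num.sqrt pi * (1 - alpha ^+ 2 * b%:R `^ (2 * H)) `^ (2 * H)^-1)); first by [].
  by rewrite [(Num.sqrt pi * _)^-1]invfM; ring.
Qed.
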